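(* Let $\mathbf X=\boldsymbol\theta+\mathbf Y$ where $\mathbf Y\in\mathbb{R}^d$ has mean zero, covariance $\sigma^2\mathrm{Id}$, independent coordinates, and a strongly log-concave density. Then $\mathbf Y$ has a Stein kernel $T$ and there are constants $L$ with $\max_i|\sigma^2-T_{ii}|\le L$ a.s., and $a,C>0$ with $P(\|\mathbf Y\|\ge t)\le ae^{-t^2/C}$ for all $t>0$. Let $I=[0,\sqrt{C\log d}]$, $A=\|\boldsymbol\theta\|_\infty$, $M=\sup_{\lambda\in I,\,1\le i\le d}P(|X_i|>\lambda)/P(|X_i|>\lambda+A+1)$, and assume $LM<1/2$. Let $\widehat\lambda\in\arg\min_{\lambda\in I}\mathrm{SURE}(\mathbf f_\lambda,\mathbf X)$. Then $$(1-2LM)\,E_{\boldsymbol\theta}\|S_{\widehat\lambda}(\mathbf X)-\boldsymbol\theta\|^2\le(1+2LM)\min_{\lambda\in I}E_{\boldsymbol\theta}\|S_\lambda(\mathbf X)-\boldsymbol\theta\|^2+B\sqrt{d\log^3d},$$ where $B>0$ depends only on $C$.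
   Context: Here $S_\lambda$ is soft-thresholding: $(S_\lambda(\mathbf x))_i=\mathrm{sgn}(x_i)(|x_i|-\lambda)_+$ for $\lambda>0$, and $\mathbf f_\lambda(\mathbf x)=S_\lambda(\mathbf x)-\mathbf x$. $\mathrm{SURE}(\mathbf f_\lambda,\mathbf X)=d\sigma^2+\|\mathbf f_\lambda(\mathbf X)\|^2+2\sigma^2\sum_i\partial_if_{\lambda,i}(\mathbf X)=d\sigma^2+\sum_i\min(X_i^2,\lambda^2)-2\sigma^2\,\mathrm{Card}\{i:|X_i|\le\lambda\}$. A Stein kernel for $\mathbf Y$ is a random matrix $T$, function of $\mathbf Y$, with $E\langle\mathbf Y,\mathbf f(\mathbf Y)\rangle=E\langle T,\nabla\mathbf f(\mathbf Y)\rangle$ ($\langle A,B\rangle=\mathrm{Tr}(AB^\top)$, $\nabla\mathbf f$ Jacobian) for all $\mathbf f$ in the weighted Sobolev space $W^{1,2}$ of the law of $\mathbf Y$. A density $e^{-\phi}$ is strongly log-concave if $\phi$ is strongly convex. *)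

(* Defs.v *)
From HB Require Import structures.
From mathcomp Require Import all_boot all_order all_algebra.
From mathcomp Require Import all_classical all_reals all_analysis.
Set Implicit Arguments. Unset Strict Implicit. Unset Printing Implicit Defensive.
Import Order.TTheory GRing.Theory Num.Theory.
Import numFieldNormedType.Exports.
Local Open Scope classical_set_scope.
Local Open Scope ring_scope.

Section defs.
Context {R : realType}.

Definition sqnorm d (x : 'rV[R]_d) : R := \sum_(i < d) x ord0 i ^+ 2.
Definition enorm d (x : 'rV[R]_d) : R := Num.sqrt (sqnorm x).

Definition coord_sets d : set (set 'rV[R]_d) :=
  [set A | exists (i : 'I_d) (B : set R), measurable B /\ A = [set x : 'rV[R]_d | B (x ord0 i)]].
Definition rv_measurable d (A : set 'rV[R]_d) : Prop := <<s (@coord_sets d) >> A.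
Definition rv_measurable_fun d (g : 'rV[R]_d -> R) : Prop :=
  forall B : set R, measurable B -> rv_measurable (g @^-1` B).

(* d-dimensional Lebesgue integral, as the iterated one-dimensional Lebesgue
   integral over the coordinates d-1, ..., 0 *)
Fixpoint iint (k : nat) (g : (nat -> R) -> \bar R) : \bar R :=
  match k with
  | 0 => g (fun _ => 0)
  | k'.+1 => (\int[lebesgue_measure]_t iint k' (fun x => g (fun j => if j == k' then t else x j)))%E
  end.
Definition lebd d (g : 'rV[R]_d -> \bar R) : \bar R :=
  iint d (fun x => g (\row_(i < d) x (nat_of_ord i))).

Definition evec d (i : 'I_d) : 'rV[R]_d := delta_mx ord0 i.
Definition dpart d (s : seq 'I_d) (psi : 'rV[R]_d -> R) : 'rV[R]_d -> R :=
  foldr (fun i g => fun x => 'D_(evec i) g x) psi s.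
Definition test_fun d (psi : 'rV[R]_d -> R) : Prop :=
  (forall s : seq 'I_d, continuous (dpart s psi) /\
     forall (i : 'I_d) (x : 'rV[R]_d), derivable (dpart s psi) x (evec i)) /\
  exists r : R, forall x, r < enorm x -> psi x = 0.

Definition loc_integrable d (g : 'rV[R]_d -> R) : Prop :=
  rv_measurable_fun g /\
  forall r : R, (lebd (fun x => (`|g x| * (if enorm x <= r then 1 else 0))%:E) < +oo)%E.

Definition weak_jacobian d (f : 'rV[R]_d -> 'rV[R]_d) (G : 'rV[R]_d -> 'M[R]_d) : Prop :=
  forall (j k : 'I_d) (psi : 'rV[R]_d -> R), test_fun psi ->
    lebd (fun x => (f x ord0 j * 'D_(evec k) psi x)%:E) =
    (- lebd (fun x => (G x j k * psi x)%:E))%E.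

Section proba.
Context {dO : measure_display} {O : measurableType dO} (P : probability O R).

Definition sobolev12 d (Yv : O -> 'rV[R]_d) (f : 'rV[R]_d -> 'rV[R]_d)
    (G : 'rV[R]_d -> 'M[R]_d) : Prop :=
  (forall j, loc_integrable (fun x => f x ord0 j)) /\
  (forall j k, loc_integrable (fun x => G x j k)) /\
  (forall j, (\int[P]_w ((f (Yv w) ord0 j) ^+ 2)%:E < +oo)%E) /\
  (forall j k, (\int[P]_w ((G (Yv w) j k) ^+ 2)%:E < +oo)%E) /\
  weak_jacobian f G.

Definition stein_kernel d (Yv : O -> 'rV[R]_d) (T : 'rV[R]_d -> 'M[R]_d) : Prop :=
  (forall j k, rv_measurable_fun (fun x => T x j k)) /\
  forall f G, sobolev12 Yv f G ->
    (\int[P]_w (\sum_(j < d) Yv w ord0 j * f (Yv w) ord0 j)%:E =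
     \int[P]_w (\sum_(j < d) \sum_(k < d) T (Yv w) j k * G (Yv w) j k)%:E)%E.

Definition indep_coords d (Y : 'I_d -> O -> R) : Prop :=
  forall A : 'I_d -> set R, (forall i, measurable (A i)) ->
    P [set w | forall i, A i (Y i w)] = \big[*%E/1%E]_(i < d) P [set w | A i (Y i w)].

Definition has_density d (Yv : O -> 'rV[R]_d) (phi : 'rV[R]_d -> R) : Prop :=
  forall A, rv_measurable A ->
    P [set w | A (Yv w)] = lebd (fun x => (expR (- phi x) * \1_A x)%:E).

End proba.

Definition strongly_convex d (phi : 'rV[R]_d -> R) : Prop :=
  exists kappa : R, 0 < kappa /\
  forall (x y : 'rV[R]_d) (t : R), 0 <= t <= 1 ->
    phi (t *: x + (1 - t) *: y) <=
    t * phi x + (1 - t) * phi y - kappa / 2 * t * (1 - t) * sqnorm (x - y).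

Definition soft d (lam : R) (x : 'rV[R]_d) : 'rV[R]_d :=
  \row_i (Num.sg (x ord0 i) * Num.max (`|x ord0 i| - lam) 0).

Definition SURE d (sigma lam : R) (x : 'rV[R]_d) : R :=
  d%:R * sigma ^+ 2 + \sum_(i < d) Num.min (x ord0 i ^+ 2) (lam ^+ 2)
  - 2 * sigma ^+ 2 * #|[set i : 'I_d | `|x ord0 i| <= lam]|%:R.

Definition ratioE (num den : R) : \bar R :=
  if den == 0 then +oo%E else (num / den)%:E.

End defs.

(* Main.v *)
Require Import Defs.
From HB Require Import structures.
From mathcomp Require Import all_boot all_order all_algebra.
From mathcomp Require Import all_classical all_reals all_analysis.
From mathcomp Require Import measurable_realfun ring lra.
Import Order.TTheory GRing.Theory Num.Theory.
Import numFieldNormedType.Exports.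
Local Open Scope classical_set_scope.
Local Open Scope ring_scope.
Set Implicit Arguments. Unset Strict Implicit. Unset Printing Implicit Defensive.

(* Oracle inequality. The Stein identity for fields depending on one coordinate
   reads E[Y_i h(X_i)] = E[T_ii h'(X_i)]. For odd powers h it bounds the even
   moments of Y_i below by (sigma^2 - L)^k k!, so the Gaussian tails force
   sigma^2 - L <= 2C and sigma is controlled by C (M >= 1 and LM < 1/2 give
   L < 1/2). For h close to the clipping function it shows that the bias of SURE
   at lambda is at most 2L sum_i P(|X_i| > lambda), hence at most
   2LM sum_i P(|X_i| > lambda + A + 1); this is absorbed by the loss, since each
   index with |X_i| > lambda + A + 1 contributes at least 1 to it. The
   fluctuations of sum_i Y_i clip_lambda(X_i) and of Card{i : |X_i| > lambda},
   uniformly in lambda, are bounded by second moment estimates on a grid, with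
   dyadic chaining for the counts.

   Stein kernel. Independence and continuity factor the density as
   p_j(x_j) r_j(x), and T is diagonal with T_jj = q_j(x_j) / p_j(x_j), where
   q_j(t) is the integral of u p_j(u) over u > t; strong convexity bounds q_j / p_j.
   If f has weak derivative g in the coordinate j, then on almost every line in
   that direction f is a constant plus the primitive of g (test against products
   of smooth bumps), and the one-dimensional Stein identity is Fubini's theorem. *)

(** * Lebesgue measure on row vectors *)

(** The minimiser depends on the data, so loss and SURE are compared outcome by outcome and for all
    thresholds at once; expectations come last. Their difference contains
    [\sum_i (Y_i^2 - sigma^2)], which is the same for every threshold and cancels. The clipped sums
    are Lipschitz in the threshold, so a regular grid controls them at cost [sqrt (d log d)]. The
    counts jump, so their grid follows the quantiles of the expected count, at cost
    [log d * sqrt d]. For [d >= 2], [log d >= 1/2] bounds both by multiples of [sqrt (d log^3 d)].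
    The remainder depends on [C] alone: the bound on [sigma^2] compares growth rates of moments, and
    the factor [a] of the tail bound is lost as the order grows. Integrals over row vectors are
    given as iterated integrals in a fixed order. To integrate first in an arbitrary coordinate [j],
    they are realised by a sigma-finite measure [lebV] that is the image of Lebesgue measure times a
    measure [nuV j]. A weak derivative is tested on the whole space, whereas the Stein identity
    lives on lines; the passage is a du Bois-Reymond argument with the other coordinates as
    parameters. *)

Notation Vsp R d := (g_sigma_algebraType (@coord_sets R d)).

Section rV_measurable.
Context {R : realType} {d : nat}.
Local Notation V := (Vsp R d).

Lemma measurable_coord (i : 'I_d) : measurable_fun setT (fun x : V => x ord0 i).
Proof.
move=> _ B mB; rewrite setTI; apply: sub_sigma_algebra.
by exists i, B.
Qed.

Lemma measurable_fun_rV dT (T : measurableType dT) (f : T -> V) :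
  (forall i, measurable_fun setT (fun x => f x ord0 i)) -> measurable_fun setT f.
Proof.
move=> mf; apply: (@measurability _ _ T V setT f (@coord_sets R d)) => //.
move=> _ [_ [i [B [mB ->]] <-]].
exact: (mf i measurableT B mB).
Qed.

Lemma rv_measurable_funE (g : 'rV[R]_d -> R) :
  rv_measurable_fun g <-> measurable_fun setT (g : V -> R).
Proof.
split=> [mg _ B mB|mg B mB]; first by rewrite setTI; exact: mg.
by have := mg measurableT B mB; rewrite setTI.
Qed.

Definition upd (j : 'I_d) (t : R) (x : 'rV[R]_d) : 'rV[R]_d :=
  \row_i (if i == j then t else x ord0 i).

Lemma upd_same j t x : upd j t x ord0 j = t.
Proof. by rewrite mxE eqxx. Qed.

Lemma upd_neq j t x i : i != j -> upd j t x ord0 i = x ord0 i.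
Proof. by rewrite mxE => /negPf ->. Qed.

Lemma upd_upd j t u x : upd j t (upd j u x) = upd j t x.
Proof. by apply/rowP => i; rewrite !mxE; case: eqP. Qed.

Lemma upd_id j (x : 'rV[R]_d) : upd j (x ord0 j) x = x.
Proof. by apply/rowP => i; rewrite !mxE; case: eqP => // ->. Qed.

Lemma updC i j t u x : i != j -> upd i t (upd j u x) = upd j u (upd i t x).
Proof.
move=> ij; apply/rowP => k; rewrite !mxE.
by case: (eqVneq k i) => // ->; rewrite (negPf ij).
Qed.

Definition updp j (p : R * V) : V := upd j p.1 p.2.

Lemma measurable_updp j : measurable_fun setT (updp j).
Proof.
apply: measurable_fun_rV => i; rewrite /updp.
case: (eqVneq i j) => [->|ij].
  by under eq_fun do rewrite upd_same; exact: measurable_fst.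
under eq_fun do rewrite upd_neq //.
exact: (measurableT_comp (measurable_coord i) (measurable_snd)).
Qed.

Lemma measurable_cyl (s : seq 'I_d) (B : 'I_d -> set R) :
  (forall i, measurable (B i)) ->
  measurable [set x : V | forall i, i \in s -> B i (x ord0 i)].
Proof.
move=> mB.
rewrite (_ : mkset _ = \bigcap_(i in [set` s]) [set x : V | B i (x ord0 i)]) //.
apply: fin_bigcap_measurable => // i _.
by have := measurable_coord i measurableT (mB i); rewrite setTI.
Qed.

Lemma measurable_upd_val j x : measurable_fun setT (fun t => upd j t x : V).
Proof.
exact: (measurableT_comp (measurable_updp j) (pair2_measurable (x : V))).
Qed.

Lemma measurable_upd j t : measurable_fun setT (upd j t : V -> V).
Proof.
exact: (measurableT_comp (measurable_updp j) (pair1_measurable t)).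
Qed.

End rV_measurable.

Definition pushm d1 d2 (T1 : measurableType d1) (T2 : measurableType d2) (R : realType)
  (m : {measure set T1 -> \bar R}) (f : T1 -> T2) (mf : measurable_fun setT f) :
  {measure set T2 -> \bar R}.
Proof. by refine (pushforward m f). Defined.

Section iterated.
Context {R : realType} {d : nat}.
Local Notation V := (Vsp R d).
Local Notation leb := (@lebesgue_measure R).
Local Open Scope ereal_scope.

(** Unlike [iint], this works directly on row vectors and along any list of coordinates, so the list
    can be cut at a chosen coordinate. The head of the list is the outermost integral; coordinates
    outside the list are 0. *)
Fixpoint Iit (s : seq 'I_d) (g : 'rV[R]_d -> \bar R) : \bar R :=
  match s with
  | [::] => g 0%R
  | i :: s' => \int[leb]_t Iit s' (g \o upd i t)
  end.

Lemma iint_Iit (k : nat) : (k <= d)%N ->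
  exists s : seq 'I_d, [/\ uniq s, (forall i : 'I_d, (i \in s) = (i < k)%N) &
   forall G, iint k (fun x => G (\row_(i < d) x (nat_of_ord i))) = Iit s G].
Proof.
elim: k => [_|k IH kd].
  exists [::]; split => // G /=; congr G.
  by apply/rowP => i; rewrite !mxE.
have [s [us sE HG]] := IH (ltnW kd).
exists (Ordinal kd :: s); split.
- by rewrite /= us sE /= ltnn.
- by move=> i; rewrite in_cons sE ltnS [RHS]leq_eqVlt -(inj_eq val_inj).
move=> G /=; apply: eq_integral => t _; rewrite -HG; congr iint.
apply/funext => x; rewrite /=; congr G; apply/rowP => i.
by rewrite !mxE -(inj_eq val_inj).
Qed.

Lemma lebd_Iit : exists s : seq 'I_d, [/\ uniq s, (forall i : 'I_d, i \in s) &
   forall G, lebd G = Iit s G].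
Proof.
have [s [us sE HG]] := iint_Iit (leqnn d).
by exists s; split => // i; rewrite sE.
Qed.

(** No sign is assumed: the integral is by definition the difference of the integrals of the
    positive and negative parts, and Tonelli gives the measurability of each. *)
Lemma measurable_fun_integral dT (T : measurableType dT) (G : T * R -> \bar R) :
  measurable_fun setT G -> measurable_fun setT (fun a => \int[leb]_t G (a, t)).
Proof.
move=> mG.
under eq_fun do rewrite integralE.
apply: emeasurable_funB.
  rewrite (_ : (fun _ => _) = fubini_F leb (G^\+)).
    apply: measurable_fun_fubini_tonelli_F => //.
    exact: measurable_funepos.
  by apply/funext => x; rewrite /fubini_F; under eq_integral do rewrite funeposE; under [RHS]eq_integral do rewrite funeposE.
rewrite (_ : (fun _ => _) = fubini_F leb (G^\-)).
  apply: measurable_fun_fubini_tonelli_F => //.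
  exact: measurable_funeneg.
by apply/funext => x; rewrite /fubini_F; under eq_integral do rewrite funenegE; under [RHS]eq_integral do rewrite funenegE.
Qed.

(** The parameter space is arbitrary because the induction moves the outermost variable of
    integration into the parameter. *)
Lemma measurable_Iit s dT (T : measurableType dT) (G : T * V -> \bar R) :
  measurable_fun setT G -> measurable_fun setT (fun a => Iit s (fun x => G (a, x))).
Proof.
elim: s dT T G => [|i s IH] dT T G mG /=.
  exact: (measurableT_comp mG (pair2_measurable _)).
pose G' (p : (T * R) * V) := G (p.1.1, updp i (p.1.2, p.2)).
have mG' : measurable_fun setT G'.
  apply: (measurableT_comp mG); apply: measurable_fun_pair => /=.
    exact: (measurableT_comp measurable_fst measurable_fst).
  apply: (measurableT_comp (measurable_updp i)); apply: measurable_fun_pair => /=.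
    exact: (measurableT_comp measurable_snd measurable_fst).
  exact: measurable_snd.
by have := measurable_fun_integral (IH _ _ _ mG').
Qed.

Lemma Iit_ge0 s g : (forall x, 0 <= g x) -> 0 <= Iit s g.
Proof.
elim: s g => [|i s IH] g g0 /=; first exact: g0.
by apply: integral_ge0 => t _; apply: IH => x; exact: g0.
Qed.


(** Tonelli, pushing the integral in [j] to the innermost place. It needs a sigma-finite measure
    behind [Iit s2], which is why one is assumed; [j \notin s1] lets the updates commute. *)
Lemma Iit_insert (s1 s2 : seq 'I_d) j (g : V -> \bar R)
    (mu : {sigma_finite_measure set V -> \bar R}) :
  (forall h : V -> \bar R, measurable_fun setT h -> (forall x, 0 <= h x) ->
    Iit s2 h = \int[mu]_x h x) ->
  j \notin s1 -> measurable_fun setT g -> (forall x, 0 <= g x) ->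
  Iit (s1 ++ j :: s2) g = Iit (s1 ++ s2) (fun x => \int[leb]_t g (upd j t x)).
Proof.
move=> Hmu; elim: s1 g => [|i s1 IH] g /= js mg g0.
  have mgu : measurable_fun setT (g \o updp j).
    exact: (measurableT_comp mg (measurable_updp j)).
  rewrite Hmu; last 2 first.
  - by apply: (measurable_fun_fubini_tonelli_G (m1 := leb) (g \o updp j)) => // x; exact: g0.
  - by move=> x; apply: integral_ge0 => t _; exact: g0.
  transitivity (\int[leb]_t \int[mu]_x (g \o updp j) (t, x)); last first.
    by apply: (fubini_tonelli (m1 := leb) (m2 := mu) (g \o updp j)) => // x; exact: g0.
  apply: eq_integral => t _; rewrite Hmu //.
    exact: (measurableT_comp mg (measurable_upd j t)).
  by move=> x; exact: g0.
move: js; rewrite in_cons negb_or => /andP[ji js].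
apply: eq_integral => t _; rewrite IH //.
- congr Iit; apply/funext => x /=; apply: eq_integral => u _ /=.
  by rewrite updC // eq_sym.
- exact: (measurableT_comp mg (measurable_upd i t)).
- by move=> x; exact: g0.
Qed.

Definition represents (mu : set V -> \bar R) (s : seq 'I_d) :=
  (forall h : V -> \bar R, measurable_fun setT h -> (forall x, 0 <= h x) ->
    Iit s h = \int[mu]_x h x) /\
  (forall h : V -> \bar R, mu.-integrable setT h -> Iit s h = \int[mu]_x h x).

(** The measure starts as the Dirac mass at 0, and each coordinate adds a product with Lebesgue
    measure pushed forward by the update. Finiteness on boxes is carried along because it yields the
    sigma-finiteness required by the next product. *)
Lemma Iit_measure (s : seq 'I_d) : uniq s ->
  exists mu : {sigma_finite_measure set V -> \bar R},
   represents mu s /\ forall r : R, mu [set x | forall i, i \in s -> (`|x ord0 i| <= r)%R] < +oo.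
Proof.
elim: s => [_|i s IH /= /andP[is_ us]].
  exists (dirac (0%R : V)); split; first split => h mh /=.
  - by move=> h0; rewrite integral_dirac // diracT mul1e.
  - rewrite integral_dirac // ?diracT ?mul1e //; exact: measurable_int mh.
  - by move=> r; rewrite /= /dirac ltry.
have [mu [[mu1 mu2] mub]] := IH us.
pose m : {measure set V -> \bar R} := pushm (leb \x mu)%E (measurable_updp i).
have mb (r : R) : m [set x : V | forall k, k \in i :: s -> (`|x ord0 k| <= r)%R] < +oo.
  have mS := @measurable_cyl R d s (fun=> [set t | (`|t| <= r)%R]).
  pose D : set (R * V) := `[(- r)%R, r]%classic `*` [set x : V | forall k, k \in s -> (`|x ord0 k| <= r)%R].
  have mbox : measurable [set t : R | (`|t| <= r)%R].
    rewrite (_ : mkset _ = `[(- r)%R, r]%classic) //.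
    by apply/seteqP; split=> t /=; rewrite in_itv /= ler_norml.
  have mS' := mS (fun=> mbox).
  have mD : measurable D by apply: measurableX.
  apply: (@le_lt_trans _ _ ((leb \x mu) D)).
    change ((leb \x mu) (updp i @^-1` [set x : V | forall k, k \in i :: s -> (`|x ord0 k| <= r)%R]) <= (leb \x mu) D).
    apply: le_measure; rewrite ?inE //.
      rewrite -[_ @^-1` _]setTI; apply: measurable_updp => //.
      exact: (@measurable_cyl R d (i :: s) (fun=> [set t | (`|t| <= r)%R])).
    move=> [t x] /= H; split => /=.
      by have := H i (mem_head _ _); rewrite /updp upd_same in_itv /= ler_norml.
    move=> k ks; have := H k; rewrite in_cons ks orbT => /(_ isT).
    by rewrite /updp upd_neq //; apply: contraNneq is_ => <-.
  rewrite product_measure1E //= lte_mul_pinfty //.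
    by rewrite lebesgue_measure_itv /=; case: ifP.
  exact: mub.
have sf : sigma_finite setT m.
  exists (fun n => [set x : V | forall k, k \in i :: s -> (`|x ord0 k| <= n%:R)%R]).
    apply/seteqP; split=> // x _.
    pose r : R := (\sum_(k < d) `|x ord0 k|)%R.
    have [n rn] : exists n, (r <= n%:R)%R.
      by exists (Num.truncn r).+1; apply/ltW/truncnS_gt.
    exists n => // k _; apply: le_trans rn.
    by rewrite /r (bigD1 k) //= lerDl sumr_ge0.
  move=> n; split => //.
  apply: (@measurable_cyl R d (i :: s) (fun=> [set t | (`|t| <= n%:R)%R])) => _.
  rewrite (_ : mkset _ = `[(- n%:R)%R, n%:R]%classic) //.
  by apply/seteqP; split=> t /=; rewrite in_itv /= ler_norml.
pose msf : {sigma_finite_measure set V -> \bar R} :=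
  HB.pack (m : set V -> \bar R) (Measure.class m) (Measure_isSigmaFinite.Build _ _ _ m sf).
exists msf; split; last exact: mb.
split.
  move=> h mh h0 /=.
  rewrite -[RHS]/(\int[pushforward (leb \x mu) (updp i)]_x h x).
  rewrite ge0_integral_pushforward //; last exact: measurable_updp.
  rewrite preimage_setT fubini_tonelli1 //=.
  - apply: eq_integral => t _; rewrite /fubini_F mu1 //.
    + exact: (measurableT_comp mh (measurable_upd i t)).
    + by move=> x; exact: h0.
  - exact: (measurableT_comp mh (measurable_updp i)).
move=> h ih /=.
have mh := measurable_int _ ih.
rewrite -[RHS]/(\int[pushforward (leb \x mu) (updp i)]_x h x).
have ihu : (leb \x mu).-integrable setT (h \o updp i).
  apply/integrableP; split; first exact: (measurableT_comp mh (measurable_updp i)).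
  move/integrableP: ih => [_].
  rewrite -[X in X < _ -> _]/(\int[pushforward (leb \x mu) (updp i)]_x `|h x|).
  rewrite ge0_integral_pushforward //; first exact: measurable_updp.
  exact: measurableT_comp.
rewrite integral_pushforward //; last exact: measurable_updp.
rewrite preimage_setT -integral12_prod_meas1 //=.
(* For a signed [h] only almost every slice is integrable, so the induction hypothesis applies to
   almost every [t]. *)
apply: ae_eq_integral => //.
- have mG : measurable_fun setT (fun p : R * V => h (updp i p)).
    exact: (measurableT_comp mh (measurable_updp i)).
  exact: (measurable_Iit s mG).
- exact: (measurable_fubini_F (m1 := leb) ihu).
have := ae_integrable1 ihu.
apply: filterS => t it _ /=; rewrite -[LHS]/(Iit s (fun x => (h \o updp i) (t, x))).
by rewrite mu2.
Qed.

(** For each [j] the measure [nu j] comes from the same list of coordinates with [j] removed. This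
    makes every coordinate available as the first one to be integrated. *)
Lemma lebesgue_rV_subproof :
  exists (mu : {sigma_finite_measure set V -> \bar R})
         (nu : 'I_d -> {sigma_finite_measure set V -> \bar R}),
  [/\ forall h : V -> \bar R, measurable_fun setT h -> (forall x, 0 <= h x) ->
       lebd h = \int[mu]_x h x,
      forall h : V -> \bar R, mu.-integrable setT h -> lebd h = \int[mu]_x h x,
      forall r : R, mu [set x : V | forall i, (`|x ord0 i| <= r)%R] < +oo,
      forall j (r : R), nu j [set x : V | forall i, i != j -> (`|x ord0 i| <= r)%R] < +oo &
      forall j A, measurable A -> mu A = pushm (leb \x nu j) (measurable_updp j) A].
Proof.
have [s [us sT HG]] := lebd_Iit.
have [mu [[mu1 mu2] mub]] := Iit_measure us.
have /choice [nu nuP] : forall j : 'I_d, exists nu : {sigma_finite_measure set V -> \bar R},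
   (forall r : R, nu [set x : V | forall i, i != j -> (`|x ord0 i| <= r)%R] < +oo) /\
   forall A, measurable A -> mu A = pushm (leb \x nu) (measurable_updp j) A.
  move=> j; move: (sT j) us mu1 => /splitPr [s1 s2].
  rewrite cat_uniq => /and3P[us1 /hasPn us12 /= /andP[js2 us2]] mu1.
  have js1 : j \notin s1 by apply: us12; rewrite mem_head.
  have us' : uniq (s1 ++ s2).
    rewrite cat_uniq us1 us2 andbT /=; apply/hasPn => k ks; apply: us12.
    by rewrite in_cons ks orbT.
  (* [nu] serves the list without [j]; [m2] serves the tail after [j], as [Iit_insert] requires. *)
  have [nu [[nu1 nu2] nub]] := Iit_measure us'.
  have [m2 [[m21 _] _]] := Iit_measure us2.
  exists nu; split.
    move=> r; apply: le_lt_trans (nub r); apply: le_measure; rewrite ?inE.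
    - have mI : measurable [set t : R | (`|t| <= r)%R].
        rewrite (_ : mkset _ = `[(- r)%R, r]%classic) //.
        by apply/seteqP; split=> t /=; rewrite in_itv /= ler_norml.
      have := @measurable_cyl R d (seq.filter (predC1 j) (enum 'I_d)) (fun=> [set t | (`|t| <= r)%R]) (fun=> mI).
      rewrite (_ : mkset _ = [set x : V | forall i, i != j -> (`|x ord0 i| <= r)%R]) //.
      apply/seteqP; split=> x /= H i; move: (H i); rewrite mem_filter /= mem_enum /= andbT //.
    - have mI : measurable [set t : R | (`|t| <= r)%R].
        rewrite (_ : mkset _ = `[(- r)%R, r]%classic) //.
        by apply/seteqP; split=> t /=; rewrite in_itv /= ler_norml.
      exact: (@measurable_cyl R d (s1 ++ s2) (fun=> [set t | (`|t| <= r)%R]) (fun=> mI)).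
    - move=> x /= H i; rewrite mem_cat => /orP[] is1; apply: H; apply/negP => /eqP ij.
        by move: js1; rewrite -ij is1.
      by move: js2; rewrite -ij is1.
  move=> A mA.
  have mi : measurable_fun setT (fun x : V => (\1_A x)%:E : \bar R).
    by apply/measurable_EFinP; exact: measurable_indic.
  transitivity (\int[mu]_x (\1_A x)%:E); first by rewrite integral_indic // setIT.
  rewrite -mu1 //.
  rewrite (@Iit_insert s1 s2 j _ m2) //.
  have mm : measurable_fun setT ((fun x : V => (\1_A x)%:E : \bar R) \o updp j).
    exact: (measurableT_comp mi (measurable_updp j)).
  rewrite nu1.
  - have -> : pushm (leb \x nu) (measurable_updp j) A = (leb \x nu) (updp j @^-1` A) by [].
    transitivity (\int[leb \x nu]_x (\1_(updp j @^-1` A) x)%:E); last first.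
      rewrite integral_indic ?setIT //.
      by rewrite -[_ @^-1` _]setTI; exact: measurable_updp.
    by rewrite -(fubini_tonelli2 (m1 := leb) (m2 := nu) ((fun x : V => (\1_A x)%:E : \bar R) \o updp j)) // => x /=; rewrite lee_fin.
  - apply: (measurable_fun_fubini_tonelli_G (m1 := leb) ((fun x : V => (\1_A x)%:E : \bar R) \o updp j)) => // x.
    by rewrite /= lee_fin.
  - by move=> x; apply: integral_ge0 => t _; rewrite lee_fin.
exists mu, nu; split.
- by move=> h mh h0; rewrite HG mu1.
- by move=> h ih; rewrite HG mu2.
- move=> r; rewrite (_ : mkset _ = [set x : V | forall k, k \in s -> (`|x ord0 k| <= r)%R]); first exact: mub.
  by apply/seteqP; split => x /= H i; [move=> _; exact: H|exact: H].
- by move=> j r; exact: (nuP j).1.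
- by move=> j A; exact: (nuP j).2.
Qed.

End iterated.

Section lebV.
Context {R : realType} {d : nat}.
Local Notation V := (Vsp R d).
Local Notation leb := (@lebesgue_measure R).
Local Open Scope ereal_scope.

(** The existence statement is turned into data so that the measures can be named. *)
Lemma lebV_sig :
  {mu : {sigma_finite_measure set V -> \bar R} &
  {nu : 'I_d -> {sigma_finite_measure set V -> \bar R} |
  [/\ forall h : V -> \bar R, measurable_fun setT h -> (forall x, 0 <= h x) ->
       lebd h = \int[mu]_x h x,
      forall h : V -> \bar R, mu.-integrable setT h -> lebd h = \int[mu]_x h x,
      forall r : R, mu [set x : V | forall i, (`|x ord0 i| <= r)%R] < +oo,
      forall j (r : R), nu j [set x : V | forall i, i != j -> (`|x ord0 i| <= r)%R] < +oo &
      forall j A, measurable A -> mu A = pushm (leb \x nu j) (measurable_updp j) A]}}.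
Proof. by have [mu /cid nu] := cid (@lebesgue_rV_subproof R d); exists mu. Qed.

Definition lebV : {sigma_finite_measure set V -> \bar R} := projT1 lebV_sig.
Definition nuV : 'I_d -> {sigma_finite_measure set V -> \bar R} := sval (projT2 lebV_sig).

Let lebVP := svalP (projT2 lebV_sig).

Lemma lebd_ge0E (h : V -> \bar R) : measurable_fun setT h -> (forall x, 0 <= h x) ->
  lebd h = \int[lebV]_x h x.
Proof. by move=> mh h0; case: lebVP => H _ _ _ _; exact: H. Qed.

Lemma lebdE (h : V -> \bar R) : lebV.-integrable setT h -> lebd h = \int[lebV]_x h x.
Proof. by move=> ih; case: lebVP => _ H _ _ _; exact: H. Qed.

Lemma lebV_box (r : R) : lebV [set x : V | forall i, (`|x ord0 i| <= r)%R] < +oo.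
Proof. by case: lebVP => _ _ H _ _; exact: H. Qed.

Lemma lebV_nuV j A : measurable A -> lebV A = pushm (leb \x nuV j) (measurable_updp j) A.
Proof. by move=> mA; case: lebVP => _ _ _ _ H; exact: H. Qed.

Lemma lebV_split_ge0 j (h : V -> \bar R) : measurable_fun setT h -> (forall x, 0 <= h x) ->
  \int[lebV]_x h x = \int[nuV j]_x \int[leb]_t h (upd j t x).
Proof.
move=> mh h0.
rewrite (eq_measure_integral (pushm (leb \x nuV j) (measurable_updp j))); last first.
  by move=> A mA _; exact: lebV_nuV.
rewrite ge0_integral_pushforward //; last exact: measurable_updp.
rewrite preimage_setT (fubini_tonelli2 (m1 := leb) (m2 := nuV j)) //.
- exact: (measurableT_comp mh (measurable_updp j)).
- by move=> x; exact: h0.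
Qed.

Lemma lebV_split_integrable j (h : V -> \bar R) : lebV.-integrable setT h ->
  (leb \x nuV j).-integrable setT (h \o updp j).
Proof.
move=> /integrableP[mh ih]; apply/integrableP; split.
  exact: (measurableT_comp mh (measurable_updp j)).
move: ih; rewrite (eq_measure_integral (pushm (leb \x nuV j) (measurable_updp j))); last first.
  by move=> A mA _; exact: lebV_nuV.
rewrite ge0_integral_pushforward //; first exact: measurable_updp.
exact: measurableT_comp.
Qed.

Lemma lebV_split j (h : V -> \bar R) : lebV.-integrable setT h ->
  \int[lebV]_x h x = \int[nuV j]_x \int[leb]_t h (upd j t x).
Proof.
move=> ih; have mh := measurable_int _ ih.
rewrite (eq_measure_integral (pushm (leb \x nuV j) (measurable_updp j))); last first.
  by move=> A mA _; exact: lebV_nuV.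
have ihu := lebV_split_integrable j ih.
rewrite integral_pushforward //; last exact: measurable_updp.
by rewrite preimage_setT -(integral21_prod_meas1 (m1 := leb)).
Qed.

Lemma lebV_ae_integrable j (h : V -> \bar R) : lebV.-integrable setT h ->
  {ae nuV j, forall x, leb.-integrable setT (fun t => h (upd j t x))}.
Proof. by move=> /(lebV_split_integrable j) /ae_integrable2. Qed.

Lemma lebV_integrable_inner j (h : V -> \bar R) : lebV.-integrable setT h ->
  (nuV j).-integrable setT (fun x => \int[leb]_t h (upd j t x)).
Proof.
move=> /(lebV_split_integrable j) ih; have mh := measurable_int _ ih.
apply/integrableP; split; first exact: (measurable_fubini_G ih).
have := (@integrable21ltyP _ _ _ _ _ leb (nuV j) _ mh).1 ih; apply: le_lt_trans.
apply: ge0_le_integral => //.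
- by apply: measurableT_comp => //; exact: (measurable_fubini_G ih).
- apply: (measurable_fun_fubini_tonelli_G (m1 := leb) (abse \o (h \o updp j))) => //.
    exact: measurableT_comp.
  by move=> x; exact: abse_ge0.
- move=> x _; apply: le_abse_integral => //.
  exact: (measurableT_comp mh (pair2_measurable x)).
Qed.

End lebV.

Lemma integrable_bounded_supp dT (T : measurableType dT) (R : realType)
    (mu : {measure set T -> \bar R}) (A : set T) (g : T -> R) (K : R) :
  measurable A -> (mu A < +oo)%E -> measurable_fun setT g ->
  (forall x, ~ A x -> g x = 0) -> (forall x, A x -> `|g x| <= K) ->
  mu.-integrable setT (EFin \o g).
Proof.
move=> mA Aoo mg g0 gK; apply/integrableP; split; first exact/measurable_EFinP.
apply: (@le_lt_trans _ _ (\int[mu]_x ((Num.max K 0)%:E * (\1_A x)%:E))%E).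
  apply: ge0_le_integral => //.
  - by apply/measurableT_comp => //; exact/measurable_EFinP.
  - by apply: measurable_funeM; apply/measurable_EFinP; exact: measurable_indic.
  - move=> x _ /=; rewrite -EFinM lee_fin indicE.
    have [/set_mem Ax|/negP Ax] := boolP (x \in A).
      by rewrite mulr1 le_max gK.
    by rewrite g0 ?normr0 ?mulr0 // => /mem_set.
rewrite ge0_integralZl //; last 2 first.
- by apply/measurable_EFinP; exact: measurable_indic.
- by rewrite lee_fin le_max lexx orbT.
by rewrite integral_indic // setIT lte_mul_pinfty // lee_fin le_max lexx orbT.
Qed.

(** * Open sets, continuous functions and boxes of row vectors *)

Section topology_rV.
Context {R : realType} {d : nat}.
Local Notation V := (Vsp R d).

Lemma nbhs_rVP (x : 'rV[R]_d) (A : set 'rV[R]_d) :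
  nbhs x A -> exists2 e : R, 0 < e & forall y : 'rV[R]_d,
    (forall i, `|x ord0 i - y ord0 i| < e) -> A y.
Proof.
move=> /nbhs_ballP[e e0 H]; exists e => // y Hy; apply: H.
split => // i j; rewrite ord1 -ball_normE /ball_ /=; exact: Hy.
Qed.

(** The sigma-algebra is generated by coordinates, not by open sets. An open set is the union of the
    cubes with rational centre and radius [1/(n+1)] that it contains, and these are countably
    many. *)
Lemma open_measurable_rV (U : set 'rV[R]_d) : open U -> measurable (U : set V).
Proof.
move=> oU.
pose cube (q : 'rV[rat]_d) (n : nat) : set V :=
  [set y : V | forall i, i \in enum 'I_d -> [set t | `|ratr (q ord0 i) - t| < n.+1%:R^-1] (y ord0 i)].
have mcube q n : measurable (cube q n).
  apply: (@measurable_cyl R d (enum 'I_d) (fun i => [set t | `|ratr (q ord0 i) - t| < n.+1%:R^-1])) => i.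
  have -> : [set t : R | `|ratr (q ord0 i) - t| < n.+1%:R^-1] = ball (ratr (q ord0 i) : R) n.+1%:R^-1.
    by rewrite -ball_normE.
  exact: measurable_ball.
pose F (m : nat) : set V := if unpickle m is Some (q, n) then
   if `[< cube q n `<=` U >] then cube q n else set0 else set0.
have -> : U = \bigcup_m F m.
  apply/seteqP; split => [x Ux|x [m _]]; last first.
    rewrite /F; case: unpickle => [[q n]|//].
    by case: asboolP => // + qx; exact.
  have /nbhs_rVP [e e0 He] : nbhs x U by exact: open_nbhs_nbhs.
  have [n ne] : exists n : nat, n.+1%:R^-1 < e / 2.
    exists (Num.truncn (e / 2)^-1); rewrite invf_plt ?posrE // ?divr_gt0 //.
    exact: truncnS_gt.
  have /choice [q qP] : forall i : 'I_d, exists q : rat, `|ratr q - x ord0 i| < n.+1%:R^-1.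
    move=> i; have : x ord0 i - n.+1%:R^-1 < x ord0 i + n.+1%:R^-1.
      by rewrite ltrBlDr -addrA ltrDl addr_gt0.
    move=> /rat_in_itvoo[q]; rewrite in_itv /= => /andP[q1 q2].
    exists q; move: q1 q2; move: (n.+1%:R^-1) => a q1 q2.
    by rewrite ltr_norml; apply/andP; split; lra.
  pose q' : 'rV[rat]_d := \row_i q i.
  exists (pickle (q', n)) => //; rewrite /F pickleK.
  have -> : `[< cube q' n `<=` U >].
    apply/asboolP => y /= yq; apply: He => i.
    have := yq i; rewrite mem_enum => /(_ isT); rewrite mxE => h1.
    rewrite -(subrKA (ratr (q i))) (le_lt_trans (ler_normD _ _)) //.
    rewrite [e]splitr ltrD //; last exact: lt_trans ne.
    by rewrite distrC; exact: lt_trans ne.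
  by move=> i _ /=; rewrite mxE; exact: qP.
apply: bigcupT_measurable => m; rewrite /F.
case: unpickle => [[q n]|]; last exact: measurable0.
by case: asboolP => _; [exact: mcube|exact: measurable0].
Qed.

Lemma continuous_measurable_rV (g : 'rV[R]_d -> R) :
  continuous g -> measurable_fun setT (g : V -> R).
Proof.
move=> cg; apply: (measurability _ (RGenOInfty.measurableE R)) => //.
move=> /= _ [_ [x ->] <-]; rewrite setTI; apply: open_measurable_rV.
by move/continuousP : cg => /(_ `]x, +oo[%classic); apply; exact: interval_open.
Qed.

Definition box (r : R) : set 'rV[R]_d := [set x | forall i, `|x ord0 i| <= r].

Lemma compact_box r : compact (box r).
Proof.
have := @rV_compact R d (fun=> `[- r, r]%classic) (fun=> @segment_compact R (- r) r).
rewrite (_ : mkset _ = box r) //.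
apply/seteqP; split => x /= H i; have := H i; rewrite /= in_itv /= ler_norml //.
Qed.

Lemma measurable_box r : measurable (box r : set V).
Proof.
have -> : box r = [set x : V | forall i, i \in enum 'I_d -> [set t | `|t| <= r] (x ord0 i)].
  by apply/seteqP; split=> x /= H i => [_|]; [exact: H|apply: H; rewrite mem_enum].
apply: (@measurable_cyl R d (enum 'I_d) (fun=> [set t | `|t| <= r])) => _.
rewrite (_ : mkset _ = `[- r, r]%classic) //.
by apply/seteqP; split=> t /=; rewrite in_itv /= ler_norml.
Qed.

Lemma integrable_bounded_box (g : 'rV[R]_d -> R) (r K : R) :
  measurable_fun setT (g : V -> R) -> (forall x, ~ box r x -> g x = 0) ->
  (forall x, box r x -> `|g x| <= K) -> lebV.-integrable setT (EFin \o (g : V -> R)).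
Proof.
move=> mg g0 gK.
apply: (@integrable_bounded_supp _ _ _ lebV (box r) g K) => //.
- exact: measurable_box.
- exact: lebV_box.
Qed.

Lemma integrable_continuous_box (g : 'rV[R]_d -> R) (r : R) :
  continuous g -> (forall x, ~ box r x -> g x = 0) ->
  lebV.-integrable setT (EFin \o (g : V -> R)).
Proof.
move=> cg g0.
have /compact_bounded [M [_ HM]] : compact (g @` box r).
  by apply: continuous_compact; [exact: continuous_subspaceT|exact: compact_box].
apply: (@integrable_bounded_box g r (M + 1)) => //.
  exact: continuous_measurable_rV.
by move=> x bx; apply: HM; [rewrite ltrDl|exists x].
Qed.

End topology_rV.

(** * Derivatives along coordinate lines and integration by parts *)

Section test_functions.
Context {R : realType} {d : nat}.

Lemma upd_line (k : 'I_d) (t s : R) (x : 'rV[R]_d) :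
  upd k (s + t) x = s *: evec k + upd k t x.
Proof.
apply/rowP => i; rewrite !mxE eqxx /=; case: eqP => _; rewrite ?mulr1 //.
by rewrite mulr0 add0r.
Qed.

(** Both derivatives are limits of the same difference quotient. *)
Lemma derive_upd (psi : 'rV[R]_d -> R) (k : 'I_d) (x : 'rV[R]_d) (t : R) :
  derivable psi (upd k t x) (evec k) ->
  is_derive t (1 : R) (fun u => psi (upd k u x)) ('D_(evec k) psi (upd k t x)).
Proof.
move=> dpsi.
have E : (fun h : R => h^-1 *: ((fun u => psi (upd k u x)) (h *: (1:R) + t) - (fun u => psi (upd k u x)) t))
  = (fun h => h^-1 *: (psi (h *: evec k + upd k t x) - psi (upd k t x))).
  by apply/funext => h /=; rewrite /GRing.scale /= mulr1 upd_line.
split; first by rewrite /derivable E.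
by rewrite /derive E.
Qed.

Lemma test_fun_support (psi : 'rV[R]_d -> R) : test_fun psi ->
  exists r : R, 0 <= r /\ forall x, ~ box r x -> psi x = 0.
Proof.
move=> [_ [r Hr]]; exists (Num.max r 0); split; first by rewrite le_max lexx orbT.
move=> x; rewrite /box /= => /existsNP [i /negP]; rewrite -ltNge gt_max => /andP[ri _].
apply: Hr; apply: (lt_le_trans ri).
rewrite /enorm -(sqrtr_sqr (x ord0 i)) ler_sqrt; last by apply: sumr_ge0 => j _; exact: sqr_ge0.
by rewrite /sqnorm (bigD1 i) //= lerDl sumr_ge0 // => j _; exact: sqr_ge0.
Qed.

(** Outside the box some coordinate exceeds [r] in absolute value and still does after a small
    shift, so the difference quotient is 0 near 0. *)
Lemma derive_support (psi : 'rV[R]_d -> R) (r : R) (k : 'I_d) :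
  (forall x, ~ box r x -> psi x = 0) ->
  forall x, ~ box r x -> 'D_(evec k) psi x = 0.
Proof.
move=> H x; rewrite /box /= => /existsNP [i /negP]; rewrite -ltNge => ri.
have near0 : \forall h \near (0 : R)^', h^-1 *: (psi (h *: evec k + x) - psi x) = 0.
  have : \forall h \near (0 : R), `|h| < `|x ord0 i| - r.
    by apply: nbhs0_lt; rewrite subr_gt0.
  move=> Hn; apply: (@nbhs_dnbhs _ (0:R)); move: Hn; apply: filterS => h hr.
  rewrite !H ?subrr ?scaler0 // /box /= => /(_ i); apply/negP; rewrite -ltNge //.
  rewrite !mxE; apply: (@lt_le_trans _ _ (`|x ord0 i| - `|h|)); first lra.
  have bh : `|h * ((ord0 == ord0 :> 'I_1) && (i == k))%:R| <= `|h|.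
    by case: (_ && _); rewrite ?mulr1 ?mulr0 ?normr0.
  have := ler_normB (h * ((ord0 == ord0 :> 'I_1) && (i == k))%:R + x ord0 i) (h * ((ord0 == ord0 :> 'I_1) && (i == k))%:R).
  by rewrite addrAC subrr add0r; lra.
rewrite /derive; apply: cvg_lim => //.
by apply: cvg_near_cst; move: near0; apply: filterS => h ->.
Qed.

End test_functions.

Section one_dim.
Context {R : realType}.
Local Notation leb := (@lebesgue_measure R).

Lemma is_derive_continuous (F f : R -> R) :
  (forall x, is_derive x (1 : R) F (f x)) -> continuous F.
Proof.
move=> dF x; apply: differentiable_continuous; apply/derivable1_diffP.
by have [] := dF x.
Qed.

Lemma FTC_is_derive (F f : R -> R) (a b : R) :
  (forall x, is_derive x (1 : R) F (f x)) -> continuous f -> a < b ->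
  (\int[leb]_(x in `[a, b]) (f x)%:E = (F b - F a)%:E)%E.
Proof.
move=> dF cf ab; have cF := is_derive_continuous dF.
rewrite (@continuous_FTC2 _ f F) ?EFinB //.
- exact: continuous_subspaceT.
- split.
  + by move=> x _; have [] := dF x.
  + by apply: cvg_at_right_filter; exact: cF.
  + by apply: cvg_at_left_filter; exact: cF.
- by move=> x _; rewrite derive1E; have [] := dF x.
Qed.

Lemma integral_derive_compact (F f : R -> R) (r : R) :
  (forall x, is_derive x (1 : R) F (f x)) -> continuous f -> 0 <= r ->
  (forall x, r < `|x| -> F x = 0) -> (forall x, r < `|x| -> f x = 0) ->
  (\int[leb]_x (f x)%:E = 0)%E.
Proof.
move=> dF cf r0 F0 f0.
have rr : - (r + 1) < r + 1 by lra.
rewrite (_ : (fun x => (f x)%:E) = ((fun x => (f x)%:E) \_ `[- (r + 1), r + 1])).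
  rewrite -integral_mkcond (FTC_is_derive dF cf rr) !F0 ?subrr //.
    by rewrite normrN ger0_norm; lra.
  by rewrite ger0_norm; lra.
apply/funext => x; rewrite patchE; case: ifPn => // /negP xr; rewrite f0 //.
rewrite ltNge; apply/negP => xr'; apply: xr; apply/mem_set.
by move: xr'; rewrite ler_norml /= in_itv /= => /andP[? ?]; apply/andP; split; lra.
Qed.

End one_dim.

Section weak_jacobian_coord.
Context {R : realType} {d : nat}.
Local Notation V := (Vsp R d).

Lemma continuous_coord (i : 'I_d) : continuous (fun x : 'rV[R]_d => x ord0 i).
Proof. exact: coord_continuous. Qed.

Lemma continuous_upd (k : 'I_d) (x : 'rV[R]_d) : continuous (fun t => upd k t x).
Proof.
move=> t A /nbhs_rVP [e e0 He]; apply/nbhs_ballP; exists e => // u tu.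
apply: He => i; case: (eqVneq i k) => [->|ik].
  by rewrite !upd_same; move: tu; rewrite -ball_normE.
by rewrite !upd_neq // subrr normr0.
Qed.

(** Says that [h (x_j)] has the expected weak partial derivatives. On each line in direction [k] the
    sum of the two integrands is the derivative of [h (x_j) * psi], which has compact support, so
    its integral is 0. *)
Lemma lebd_coord_by_parts (j k : 'I_d) (h h' : R -> R) (psi : 'rV[R]_d -> R) :
  (forall t, is_derive t (1 : R) h (h' t)) -> continuous h' -> test_fun psi ->
  lebd (fun x => (h (x ord0 j) * 'D_(evec k) psi x)%:E) =
  (- lebd (fun x => ((k == j)%:R * h' (x ord0 j) * psi x)%:E))%E.
Proof.
move=> dh ch' tpsi.
have [r [r0 psi0]] := test_fun_support tpsi.
have [/(_ [::]) /= [cpsi dpsi] _] := tpsi.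
have [/(_ [:: k]) /= [cdpsi _] _] := tpsi.
have dpsi0 := derive_support k psi0.
have ch := is_derive_continuous dh.
pose f1 (x : 'rV[R]_d) := h (x ord0 j) * 'D_(evec k) psi x.
pose f2 (x : 'rV[R]_d) := (k == j)%:R * h' (x ord0 j) * psi x.
have cf1 : continuous f1.
  move=> x; apply: (@continuousM _ _ (fun x : 'rV[R]_d => h (x ord0 j)) ('D_(evec k) psi)); last exact: cdpsi.
  by apply: continuous_comp; [exact: continuous_coord|exact: ch].
have cf2 : continuous f2.
  move=> x; apply: (@continuousM _ _ (fun x : 'rV[R]_d => (k == j)%:R * h' (x ord0 j)) psi); last exact: cpsi.
  apply: (@continuousM _ _ (fun=> (k == j)%:R) (fun x : 'rV[R]_d => h' (x ord0 j))); first exact: cst_continuous.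
  by apply: continuous_comp; [exact: continuous_coord|exact: ch'].
have i1 : lebV.-integrable setT (EFin \o (f1 : V -> R)).
  apply: (@integrable_continuous_box _ _ f1 r) => // x /dpsi0 xr.
  by rewrite /f1 xr mulr0.
have i2 : lebV.-integrable setT (EFin \o (f2 : V -> R)).
  apply: (@integrable_continuous_box _ _ f2 r) => // x /psi0 xr.
  by rewrite /f2 xr mulr0.
rewrite (lebdE i1) (lebdE i2).
suff E : (\int[lebV]_x (EFin \o (f1 : V -> R)) x + \int[lebV]_x (EFin \o (f2 : V -> R)) x = 0)%E.
  have F1 := integrable_fin_num measurableT i1.
  have F2 := integrable_fin_num measurableT i2.
  move: E F1 F2; case: (\int[lebV]_x (EFin \o (f1 : V -> R)) x)%E => // u.
  case: (\int[lebV]_x (EFin \o (f2 : V -> R)) x)%E => // v.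
  by rewrite -EFinD -EFinN => -[] uv _ _; congr EFin; lra.
rewrite -integralD //.
have i12 : lebV.-integrable setT (EFin \o (fun x : V => f1 x + f2 x)).
  by rewrite (_ : EFin \o _ = (EFin \o (f1 : V -> R)) \+ (EFin \o (f2 : V -> R))) //; exact: integrableD.
rewrite (lebV_split k i12); apply: integral0_eq => x _ /=.
apply: (@integral_derive_compact _ (fun t => h ((upd k t x) ord0 j) * psi (upd k t x)) _ r) => //.
- move=> t; have dp := derive_upd (dpsi k (upd k t x)).
  have dhk : is_derive t (1 : R) (fun t => h ((upd k t x) ord0 j)) ((k == j)%:R * h' ((upd k t x) ord0 j)).
    case: (eqVneq k j) => [<-|kj].
      rewrite mul1r upd_same (_ : (fun t => _) = h); first exact: dh.
      by apply/funext => u; rewrite upd_same.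
    rewrite mul0r (_ : (fun t => _) = cst (h (x ord0 j))); first exact: is_derive_cst.
    by apply/funext => u; rewrite upd_neq // eq_sym.
  apply: (is_derive_eq (is_deriveM dhk dp)).
  by rewrite /f1 /f2 /GRing.scale /= addrC [in RHS]addrC; congr (_ + _); rewrite mulrC.
- move=> t; apply: (@continuous_comp _ _ _ (fun t => upd k t x) (fun y => f1 y + f2 y)).
    exact: continuous_upd.
  by apply: continuousD; [exact: cf1|exact: cf2].
- move=> t rt; rewrite psi0 ?mulr0 // => /(_ k); rewrite upd_same.
  by apply/negP; rewrite -ltNge.
- move=> t rt; rewrite /f1 /f2 psi0 ?dpsi0 ?mulr0 ?addr0 // => /(_ k); rewrite upd_same;
  by apply/negP; rewrite -ltNge.
Qed.

End weak_jacobian_coord.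

(** * Expectation and independence *)

Section expectation.
Context {R : realType} {dO : measure_display} {O : measurableType dO} (P : probability O R).
Local Notation intg f := (P.-integrable setT (EFin \o (f : O -> R))).

Lemma intg_measurable (f : O -> R) : intg f -> measurable_fun setT f.
Proof. by move=> /measurable_int /measurable_EFinP. Qed.

Lemma intg_le (f g : O -> R) : measurable_fun setT f -> intg g ->
  (forall w, `|f w| <= g w) -> intg f.
Proof.
move=> mf ig fg; apply: (le_integrable measurableT _ _ ig).
- exact/measurable_EFinP.
- by move=> w _; rewrite /= lee_fin (le_trans (fg w)) // ler_norm.
Qed.

Lemma intg_cst (c : R) : intg (fun=> c).
Proof. exact: finite_measure_integrable_cst. Qed.

Lemma intg_bounded (f : O -> R) (K : R) : measurable_fun setT f ->
  (forall w, `|f w| <= K) -> intg f.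
Proof. by move=> mf fK; apply: (intg_le mf (intg_cst K)). Qed.

Lemma intgD (f g : O -> R) : intg f -> intg g -> intg (fun w => f w + g w).
Proof. by move=> *; rewrite (_ : EFin \o _ = (EFin \o f) \+ (EFin \o g))%E //; exact: integrableD. Qed.

Lemma intgB (f g : O -> R) : intg f -> intg g -> intg (fun w => f w - g w).
Proof. by move=> *; rewrite (_ : EFin \o _ = (EFin \o f) \- (EFin \o g))%E //; exact: integrableB. Qed.

Lemma intgZ (c : R) (f : O -> R) : intg f -> intg (fun w => c * f w).
Proof. by move=> *; rewrite (_ : EFin \o _ = (fun w => c%:E * (EFin \o f) w))%E //; exact: integrableZl. Qed.

Lemma intg_sum (I : Type) (s : seq I) (q : pred I) (f : I -> O -> R) :
  (forall i, q i -> intg (f i)) -> intg (fun w => \sum_(i <- s | q i) f i w).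
Proof.
move=> H; elim: s => [|i s IH].
  by under eq_fun do rewrite big_nil; exact: intg_cst.
under eq_fun do rewrite big_cons.
by case: (boolP (q i)) => [qi|_] //; apply: intgD => //; exact: H.
Qed.

Lemma intg_norm (f : O -> R) : intg f -> intg (fun w => `|f w|).
Proof. by move=> i; have := integrable_norm i. Qed.

Lemma intg_mul (f g : O -> R) : measurable_fun setT f -> measurable_fun setT g ->
  intg (fun w => f w ^+ 2) -> intg (fun w => g w ^+ 2) -> intg (fun w => f w * g w).
Proof.
move=> mf mg i1 i2; apply: (intg_le _ (intgD i1 i2)); first exact: measurable_funM.
move=> w; rewrite normrM -(real_normK (num_real (f w))) -(real_normK (num_real (g w))).
have := sqr_ge0 (`|f w| - `|g w|); nra.
Qed.

Lemma intg_sqr (f : O -> R) : measurable_fun setT f ->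
  intg (fun w => f w ^+ 2) -> intg f.
Proof.
move=> mf i; apply: (intg_le mf (intgD i (intg_cst 1))) => w.
rewrite -(real_normK (num_real (f w))).
have := sqr_ge0 (`|f w| - 1); nra.
Qed.

(** Expectations are real numbers; an infinite integral would be read as 0, hence the integrability
    conditions of the rules below. *)
Definition Ex (f : O -> R) : R := (\int[P]_w f w)%R.

Lemma ExE (f : O -> R) : intg f -> (\int[P]_w (f w)%:E = (Ex f)%:E)%E.
Proof. by move=> i; rewrite /Ex /Rintegral fineK //; exact: integrable_fin_num. Qed.

Lemma eq_Ex (f g : O -> R) : (forall w, f w = g w) -> Ex f = Ex g.
Proof. by move=> fg; congr Ex; exact/funext. Qed.

Lemma ExD (f g : O -> R) : intg f -> intg g -> Ex (fun w => f w + g w) = Ex f + Ex g.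
Proof. by move=> *; exact: RintegralD. Qed.

Lemma ExB (f g : O -> R) : intg f -> intg g -> Ex (fun w => f w - g w) = Ex f - Ex g.
Proof. by move=> *; exact: RintegralB. Qed.

Lemma ExZ (c : R) (f : O -> R) : intg f -> Ex (fun w => c * f w) = c * Ex f.
Proof. by move=> *; exact: RintegralZl. Qed.

Lemma Ex_cst (c : R) : Ex (fun=> c) = c.
Proof. by rewrite /Ex Rintegral_cst //= [P _]probability_setT mulr1. Qed.

Lemma Ex_sum (I : Type) (s : seq I) (q : pred I) (f : I -> O -> R) :
  (forall i, q i -> intg (f i)) ->
  Ex (fun w => \sum_(i <- s | q i) f i w) = \sum_(i <- s | q i) Ex (f i).
Proof.
move=> H; elim: s => [|i s IH].
  by under eq_Ex do rewrite big_nil; rewrite Ex_cst big_nil.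
under eq_Ex do rewrite big_cons; rewrite big_cons.
case: (boolP (q i)) => [qi|_] //; rewrite ExD ?IH //; first exact: H.
exact: intg_sum.
Qed.

Lemma le_Ex (f g : O -> R) : intg f -> intg g -> (forall w, f w <= g w) -> Ex f <= Ex g.
Proof. by move=> i1 i2 fg; apply: le_Rintegral. Qed.

Lemma Ex_ge0 (f : O -> R) : (forall w, 0 <= f w) -> 0 <= Ex f.
Proof. by move=> f0; apply: Rintegral_ge0. Qed.

Lemma Ex_abs_le (f g : O -> R) : intg f -> intg g ->
 (forall w, `|f w| <= g w) -> `|Ex f| <= Ex g.
Proof.
move=> i1 i2 fg; rewrite ler_norml; apply/andP; split.
  rewrite -[- _]mulN1r -ExZ //; apply: le_Ex => //; first exact: intgZ.
  by move=> w; have := fg w; rewrite ler_norml => /andP[]; lra.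
by apply: le_Ex => // w; have := fg w; rewrite ler_norml => /andP[].
Qed.

(** Expand the expectation of [(|f| - m)^2], which is nonnegative, with [m] the mean of [|f|]. *)
Lemma Ex_norm_sqrt (f : O -> R) : measurable_fun setT f -> intg (fun w => f w ^+ 2) ->
  Ex (fun w => `|f w|) <= Num.sqrt (Ex (fun w => f w ^+ 2)).
Proof.
move=> mf i; have i1 := intg_sqr mf i; have i2 := intg_norm i1.
set m := Ex (fun w => `|f w|).
have m0 : 0 <= m by apply: Ex_ge0.
rewrite -(ger0_norm m0) -sqrtr_sqr ler_sqrt; last by apply: Ex_ge0 => w; exact: sqr_ge0.
have : 0 <= Ex (fun w => (f w ^+ 2 - 2 * m * `|f w|) + m ^+ 2).
  apply: Ex_ge0 => w; rewrite -(real_normK (num_real (f w))).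
  have := sqr_ge0 (`|f w| - m); nra.
rewrite ExD ?ExB ?ExZ ?Ex_cst //; [rewrite -/m; nra|..].
- exact: intg_cst.
- exact: intgZ.
- by apply: intgB => //; exact: intgZ.
- exact: intg_cst.
Qed.

Definition prob (A : set O) : R := fine (P A).

Lemma prob_indic (A : set O) : measurable A -> Ex (\1_A) = prob A.
Proof. by move=> mA; rewrite /Ex /Rintegral integral_indic // setIT. Qed.

Lemma Ex_norm_sum_sqrt (I : finType) (Z : I -> O -> R) :
  (forall i, measurable_fun setT (Z i)) ->
  (forall i, intg (fun w => Z i w ^+ 2)) -> (forall i, Ex (Z i) = 0) ->
  (forall i j, i != j -> Ex (fun w => Z i w * Z j w) = 0) ->
  intg (fun w => (\sum_i Z i w) ^+ 2) /\
  Ex (fun w => (\sum_i Z i w) ^+ 2) = \sum_i Ex (fun w => Z i w ^+ 2).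
Proof.
move=> mZ iZ Z0 Z2.
have E w : (\sum_i Z i w) ^+ 2 = \sum_i \sum_j Z i w * Z j w.
  by rewrite expr2 mulr_suml; apply: eq_bigr => i _; rewrite mulr_sumr.
have iij i j : intg (fun w => Z i w * Z j w) by exact: intg_mul.
split.
  rewrite (_ : (fun w => _) = fun w => \sum_i \sum_j Z i w * Z j w).
    by apply: intg_sum => i _; apply: intg_sum.
  exact/funext.
rewrite (eq_Ex E) Ex_sum; last by move=> i _; apply: intg_sum.
apply: eq_bigr => i _; rewrite Ex_sum // (bigD1 i) //= big1 ?addr0.
  by apply: eq_Ex => w; rewrite expr2.
by move=> j ji; rewrite Z2 // eq_sym.
Qed.

(** The joint law agrees with the product of the marginals on rectangles, hence everywhere. Tonelli
    on absolute values gives integrability and Fubini the product formula. *)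
Lemma Ex_prod_indep (X1 X2 : O -> R) (F G : R -> R) :
  measurable_fun setT X1 -> measurable_fun setT X2 ->
  (forall A B, measurable A -> measurable B ->
     P (X1 @^-1` A `&` X2 @^-1` B) = (P (X1 @^-1` A) * P (X2 @^-1` B))%E) ->
  measurable_fun setT F -> measurable_fun setT G ->
  intg (F \o X1) -> intg (G \o X2) ->
  intg (fun w => F (X1 w) * G (X2 w)) /\
  Ex (fun w => F (X1 w) * G (X2 w)) = Ex (F \o X1) * Ex (G \o X2).
Proof.
move=> m1 m2 ind mF mG i1 i2.
pose X1' : {RV P >-> R} := HB.pack X1 (isMeasurableFun.Build _ _ _ _ _ m1).
pose X2' : {RV P >-> R} := HB.pack X2 (isMeasurableFun.Build _ _ _ _ _ m2).
have mXY : measurable_fun setT (fun w => (X1 w, X2 w)) by exact: measurable_fun_pair.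
pose Q := pushm P mXY.
pose Q1 := distribution P X1'; pose Q2 := distribution P X2'.
have QE A : measurable A -> (Q1 \x Q2)%E A = Q A.
  apply: product_measure_unique => A1 A2 mA1 mA2.
  by rewrite -[LHS]/(P (X1 @^-1` A1 `&` X2 @^-1` A2)) ind.
pose H (p : R * R) := F p.1 * G p.2.
have mH : measurable_fun setT H.
  by apply: measurable_funM; [exact: (measurableT_comp mF measurable_fst)|exact: (measurableT_comp mG measurable_snd)].
have j1 : Q1.-integrable setT (EFin \o F).
  by apply: integrable_pushforward => //; exact/measurable_EFinP.
have j2 : Q2.-integrable setT (EFin \o G).
  by apply: integrable_pushforward => //; exact/measurable_EFinP.
have iH : (Q1 \x Q2)%E.-integrable setT (EFin \o H).
  apply/integrable12ltyP; first exact/measurable_EFinP.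
  have aG : (0 <= \int[Q2]_y `|(G y)%:E|)%E by apply: integral_ge0.
  have -> : (\int[Q1]_x \int[Q2]_y `|(EFin \o H) (x, y)| =
      (\int[Q1]_x `|(F x)%:E|) * (\int[Q2]_y `|(G y)%:E|))%E.
    rewrite -ge0_integralZr //; last first.
      by apply: measurableT_comp => //; exact/measurable_EFinP.
    apply: eq_integral => x _; rewrite -ge0_integralZl //; last first.
      by apply: measurableT_comp => //; exact/measurable_EFinP.
    by apply: eq_integral => y _; rewrite /= normrM EFinM.
  by apply: lte_mul_pinfty; [exact: integral_ge0|
    rewrite ge0_fin_numE; [by move/integrableP : j1 => []|exact: integral_ge0]|
    by move/integrableP : j2 => []].
have iQ : Q.-integrable setT (EFin \o H).
  apply/integrableP; split; first exact/measurable_EFinP.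
  rewrite (eq_measure_integral (Q1 \x Q2)%E); first by move/integrableP : iH => [].
  by move=> A mA _; symmetry; exact: QE.
have iE : intg (fun w => F (X1 w) * G (X2 w)).
  apply/integrableP; split.
    exact/measurable_EFinP/(measurableT_comp mH mXY).
  move/integrableP : iQ => [_]; rewrite ge0_integral_pushforward //.
  by apply/measurableT_comp => //; exact/measurable_EFinP.
split => //.
apply/EFin_inj; rewrite -ExE // EFinM -!ExE //.
transitivity (\int[Q]_p (EFin \o H) p)%E.
  by rewrite integral_pushforward //; exact/measurable_EFinP.
rewrite (eq_measure_integral (Q1 \x Q2)%E); last by move=> A mA _; symmetry; exact: QE.
rewrite -integral12_prod_meas1 //.
transitivity (\int[Q1]_x ((F x)%:E * \int[Q2]_y (G y)%:E))%E.
  apply: eq_integral => x _; rewrite /fubini_F /= -integralZl //.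
rewrite -(fineK (integrable_fin_num measurableT j2)) integralZr //.
rewrite fineK; last exact: (integrable_fin_num measurableT j2).
by congr (_ * _)%E; rewrite integral_pushforward //; exact/measurable_EFinP.
Qed.

End expectation.

(** * Uniform deviations *)

(** The path from 0 to [k] follows the binary digits of [k] and uses at most one increment per
    scale. That increment is at most the root of the sum of all squared increments of its scale, a
    bound independent of [k]. *)
Lemma dyadic_chain (R : realType) (K : nat) (c : nat -> R) (k : nat) : (k <= 2 ^ K)%N ->
  `|c k - c 0%N| <= \sum_(l < K.+1) Num.sqrt (\sum_(j < 2 ^ l)
     (c (j.+1 * 2 ^ (K - l))%N - c (j * 2 ^ (K - l))%N) ^+ 2).
Proof.
elim: K c k => [|K IH] c k kK.
  rewrite big_ord_recr big_ord0 /= add0r big_ord_recr big_ord0 /= add0r.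
  rewrite expn0 muln1 mul0n; move: kK; case: k => [_|[_|//]].
    by rewrite subrr normr0 sqrtr_ge0.
  by rewrite sqrtr_sqr.
rewrite big_ord_recr /=.
set k' := k./2.
have k'K : (k' <= 2 ^ K)%N.
  by rewrite /k' -(doubleK (2 ^ K)%N) half_leq // -mul2n -expnS.
(* The even indices carry the [K] coarser scales; going from [2 * k'] to [k] costs nothing or one
   increment of the finest scale. *)
have := IH (fun j => c (2 * j)%N) k' k'K; rewrite muln0 => H.
have E : \sum_(l < K.+1) Num.sqrt (\sum_(j < 2 ^ l)
     (c (2 * (j.+1 * 2 ^ (K - l)))%N - c (2 * (j * 2 ^ (K - l)))%N) ^+ 2) =
  \sum_(l < K.+1) Num.sqrt (\sum_(j < 2 ^ l)
     (c (j.+1 * 2 ^ (K.+1 - l))%N - c (j * 2 ^ (K.+1 - l))%N) ^+ 2).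
  apply: eq_bigr => l _; congr Num.sqrt; apply: eq_bigr => j _.
  have lK : (l <= K)%N by rewrite -ltnS.
  by rewrite subSn // expnS !mulnA ![(2 * _)%N]mulnC.
rewrite E in H.
have -> : c k - c 0%N = (c (2 * k')%N - c 0%N) + (c k - c (2 * k')%N) by ring.
apply: le_trans (ler_normD _ _) _; apply: lerD => //.
rewrite subnn expn0.
have [ko|ke] := boolP (odd k); last first.
  by rewrite mul2n even_halfK // subrr normr0 sqrtr_ge0.
have k1 : k = (2 * k').+1 by rewrite mul2n -[LHS]odd_double_half ko.
have kl : (2 * k' < 2 ^ K.+1)%N by rewrite -k1.
rewrite -sqrtr_sqr ler_sqrt; last by apply: sumr_ge0 => j _; exact: sqr_ge0.
rewrite (bigD1 (Ordinal kl)) //= !muln1 -k1 lerDl.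
by apply: sumr_ge0 => j _; exact: sqr_ge0.
Qed.

Lemma measurable_ind_gt (R : realType) dT (T : measurableType dT) (f : T -> R) (t : R) : measurable_fun setT f ->
  measurable_fun setT (fun w => ((t < f w)%R%:R : R)).
Proof.
move=> mf; rewrite (_ : (fun w => _) = \1_[set w | t < f w]); last first.
  by apply/funext => w; rewrite indicE; congr (nat_of_bool _)%:R; apply/idP/idP; rewrite inE.
apply: measurable_indic; rewrite -[X in measurable X]setTI.
have := mf measurableT `]t, +oo[%classic (measurable_itv _).
by rewrite (_ : f @^-1` _ = [set w | t < f w]) //; apply/seteqP; split => w /=; rewrite in_itv /= andbT.
Qed.

(** The part of [x] removed by soft thresholding, that is minus the coordinate of [f_lambda] (see
    [soft_clip]). *)
Definition clip (R : realType) (lam x : R) : R := Num.max (- lam) (Num.min x lam).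

Lemma clip0 (R : realType) (x : R) : clip 0 x = 0.
Proof. by rewrite /clip oppr0; apply/max_idPl; rewrite ge_min lexx orbT. Qed.

Lemma clip_lip (R : realType) (lam lam' x : R) : 0 <= lam -> lam <= lam' ->
  `|clip lam' x - clip lam x| <= lam' - lam.
Proof.
move=> l0 ll; rewrite /clip; rewrite ler_norml.
have [h1|h1] := leP x lam'; have [h2|h2] := leP x lam.
- by have [h3|h3] := leP (- lam') x; have [h4|h4] := leP (- lam) x; apply/andP; split; lra.
- by have [h3|h3] := leP (- lam') x; have [h4|h4] := leP (- lam) lam; apply/andP; split; lra.
- by have [h3|h3] := leP (- lam') lam'; have [h4|h4] := leP (- lam) x; apply/andP; split; lra.
- by have [h3|h3] := leP (- lam') lam'; have [h4|h4] := leP (- lam) lam; apply/andP; split; lra.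
Qed.

Lemma measurable_clip (R : realType) (lam : R) : measurable_fun setT (clip lam).
Proof.
apply: measurable_maxr; first exact: measurable_cst.
by apply: measurable_minr => //; exact: measurable_cst.
Qed.

Section empirical.
Context {R : realType} {dO : measure_display} {O : measurableType dO} (P : probability O R).
Local Notation intg f := (P.-integrable setT (EFin \o (f : O -> R))).
Local Notation Ex := (Ex P).
Local Notation prob := (prob P).
Variables (d : nat) (Y : 'I_d -> O -> R).
Hypothesis mY : forall i, measurable_fun setT (Y i).
Hypothesis indY : forall i j, i != j -> forall A B : set R, measurable A -> measurable B ->
     P (Y i @^-1` A `&` Y j @^-1` B) = (P (Y i @^-1` A) * P (Y j @^-1` B))%E.

Lemma intg_comp_Y (F : 'I_d -> R -> R) i : measurable_fun setT (F i) ->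
  intg (fun w => F i (Y i w) ^+ 2) -> intg (fun w => F i (Y i w)).
Proof. by move=> mF iF; apply: intg_sqr => //; exact: measurableT_comp. Qed.

(** Centred terms are orthogonal under pairwise independence, and a variance is at most the second
    moment. *)
Lemma centered_sum_var (F : 'I_d -> R -> R) :
  (forall i, measurable_fun setT (F i)) ->
  (forall i, intg (fun w => F i (Y i w) ^+ 2)) ->
  intg (fun w => (\sum_i (F i (Y i w) - Ex (fun w => F i (Y i w)))) ^+ 2) /\
  Ex (fun w => (\sum_i (F i (Y i w) - Ex (fun w => F i (Y i w)))) ^+ 2) <=
    \sum_i Ex (fun w => F i (Y i w) ^+ 2).
Proof.
move=> mF iF.
pose G i (y : R) := F i y - Ex (fun w => F i (Y i w)).
have mFY i : measurable_fun setT (fun w => F i (Y i w)) by exact: measurableT_comp.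
have iF1 i := intg_comp_Y (mF i) (iF i).
have mG i : measurable_fun setT (G i) by apply: measurable_funB => //; exact: measurable_cst.
have E i w : G i (Y i w) ^+ 2 = F i (Y i w) ^+ 2 - 2 * Ex (fun w => F i (Y i w)) * F i (Y i w) + Ex (fun w => F i (Y i w)) ^+ 2.
  by rewrite /G; ring.
have iG2 i : intg (fun w => G i (Y i w) ^+ 2).
  rewrite (_ : (fun w => G i (Y i w) ^+ 2) = fun w => F i (Y i w) ^+ 2 - 2 * Ex (fun w => F i (Y i w)) * F i (Y i w) + Ex (fun w => F i (Y i w)) ^+ 2); last exact/funext.
  by apply: intgD; [apply: intgB => //; exact: intgZ|exact: intg_cst].
have iG i := intg_comp_Y (mG i) (iG2 i).
have G0 i : Ex (fun w => G i (Y i w)) = 0.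
  by rewrite /G ExB ?Ex_cst ?subrr //; exact: intg_cst.
have [H1 H2] := @Ex_norm_sum_sqrt _ _ _ P _ (fun i w => G i (Y i w))
   (fun i => measurableT_comp (mG i) (mY i)) iG2 G0
   (fun i j ij => etrans (Ex_prod_indep (mY i) (mY j) (indY ij) (mG i) (mG j) (iG i) (iG j)).2
      (etrans (congr1 (fun z => z * _) (G0 i)) (mul0r _))).
split => //; rewrite H2; apply: ler_sum => i _.
rewrite (eq_Ex P (E i)) ExD ?ExB ?ExZ ?Ex_cst //; [|exact: intg_cst|exact: intgZ|by apply: intgB => //; exact: intgZ|exact: intg_cst].
have := sqr_ge0 (Ex (fun w => F i (Y i w))); nra.
Qed.

Lemma centered_sum_abs (F : 'I_d -> R -> R) (v : R) :
  (forall i, measurable_fun setT (F i)) ->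
  (forall i, intg (fun w => F i (Y i w) ^+ 2)) ->
  \sum_i Ex (fun w => F i (Y i w) ^+ 2) <= v ->
  intg (fun w => `|\sum_i (F i (Y i w) - Ex (fun w => F i (Y i w)))|) /\
  Ex (fun w => `|\sum_i (F i (Y i w) - Ex (fun w => F i (Y i w)))|) <= Num.sqrt v.
Proof.
move=> mF iF Fv; have [H1 H2] := centered_sum_var mF iF.
have mS : measurable_fun setT (fun w => \sum_i (F i (Y i w) - Ex (fun w => F i (Y i w)))).
  apply: measurable_sum => i; apply: measurable_funB; last exact: measurable_cst.
  exact: measurableT_comp.
split; first by apply: intg_norm; exact: intg_sqr.
apply: (le_trans (Ex_norm_sqrt mS H1)); rewrite ler_sqrt ?(le_trans H2) //.
by apply: le_trans Fv; apply: sumr_ge0 => i _; apply: Ex_ge0 => w; exact: sqr_ge0.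
Qed.

Section tails.
Variable Z : 'I_d -> R -> R.
Hypothesis mZ : forall i, measurable_fun setT (Z i).
Local Notation ind b := ((nat_of_bool b)%:R : R).

Let p i (t : R) := Ex (fun w => ind (t < Z i (Y i w))).
Let H (t : R) := \sum_i p i t.

Lemma intg_ind (b : O -> bool) : measurable_fun setT (fun w => ind (b w)) ->
  intg (fun w => ind (b w)).
Proof.
by move=> mb; apply: (@intg_bounded _ _ _ P _ 1) => // w; case: (b w); rewrite ?normr0 ?normr1.
Qed.

Lemma intg_ind_gt i t : intg (fun w => ind (t < Z i (Y i w))).
Proof. by apply: intg_ind; apply: measurable_ind_gt; exact: measurableT_comp. Qed.

Lemma tail_nonincr i s t : s <= t -> p i t <= p i s.
Proof.
move=> st; apply: le_Ex; [exact: intg_ind_gt|exact: intg_ind_gt|] => w.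
by rewrite ler_nat; case: (ltP t) => //= tz; rewrite (le_lt_trans st).
Qed.

Lemma tail_ge0 i t : 0 <= p i t.
Proof. by apply: Ex_ge0. Qed.

Lemma tail_le1 i t : p i t <= 1.
Proof.
rewrite -(Ex_cst P 1); apply: le_Ex; [exact: intg_ind_gt|exact: intg_cst|] => w.
by case: (_ < _).
Qed.

Lemma H_nonincr s t : s <= t -> H t <= H s.
Proof. by move=> st; apply: ler_sum => i _; exact: tail_nonincr. Qed.

(* Rademacher-Menshov chaining: at each of the K+1 dyadic scales the blocks are
   disjoint, so their variances add up to at most d. *)
Lemma grid_deviation (K : nat) (t : nat -> R) :
  (forall k, (k < 2 ^ K)%N -> t k <= t k.+1) ->
  exists S : O -> R, [/\ intg S, Ex S <= K.+1%:R * Num.sqrt d%:R &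
   forall w k, (k <= 2 ^ K)%N ->
     `|\sum_i (ind (t k < Z i (Y i w)) - p i (t k)) - \sum_i (ind (t 0%N < Z i (Y i w)) - p i (t 0%N))| <= S w].
Proof.
move=> tmono.
have tm a b : (a <= b)%N -> (b <= 2 ^ K)%N -> t a <= t b.
  elim: b => [|b IH]; first by rewrite leqn0 => /eqP ->.
  rewrite leq_eqVlt => /orP[/eqP -> //|ab bK].
  by apply: le_trans (tmono b bK); apply: IH => //; exact: ltnW.
pose c w k := \sum_i (ind (t k < Z i (Y i w)) - p i (t k)).
pose Q l w := \sum_(j < 2 ^ l) (c w (j.+1 * 2 ^ (K - l))%N - c w (j * 2 ^ (K - l))%N) ^+ 2.
have block a b : (a <= b)%N -> (b <= 2 ^ K)%N ->
    intg (fun w => (c w b - c w a) ^+ 2) /\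
    Ex (fun w => (c w b - c w a) ^+ 2) <= H (t a) - H (t b).
  move=> ab bK.
  pose F i y := ind (t b < Z i y) - ind (t a < Z i y).
  have tab := tm _ _ ab bK.
  have mF i : measurable_fun setT (F i).
    by apply: measurable_funB; apply: measurable_ind_gt.
  (* [F] takes only the values 0 and -1, so the variance of a block is at most its expected number
     of points. *)
  have F2 i w : F i (Y i w) ^+ 2 = ind (t a < Z i (Y i w)) - ind (t b < Z i (Y i w)).
    rewrite /F; case: (ltP (t b)) => [h|h] /=.
      by rewrite (le_lt_trans tab h) /=; ring.
    by case: (_ < _) => /=; ring.
  have iF i : intg (fun w => F i (Y i w) ^+ 2).
    under eq_fun do rewrite F2.
    by apply: intgB; exact: intg_ind_gt.
  have [H1 H2] := centered_sum_var mF iF.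
  have E w : c w b - c w a = \sum_i (F i (Y i w) - Ex (fun w => F i (Y i w))).
    rewrite /c -sumrB; apply: eq_bigr => i _.
    by rewrite /F ExB; [rewrite /p; ring|exact: intg_ind_gt|exact: intg_ind_gt].
  split; first by under eq_fun do rewrite E.
  under eq_Ex do rewrite E.
  apply: (le_trans H2); rewrite /H -sumrB; apply: ler_sum => i _.
  under eq_Ex do rewrite F2.
  by rewrite ExB; [|exact: intg_ind_gt|exact: intg_ind_gt].
have idx l j : (l < K.+1)%N -> (j < 2 ^ l)%N -> (j.+1 * 2 ^ (K - l) <= 2 ^ K)%N.
  move=> lK jl; rewrite -[in leqRHS](@subnKC l K) // expnD.
  by rewrite leq_mul2r jl orbT.
have idx' l j : (j * 2 ^ (K - l) <= j.+1 * 2 ^ (K - l))%N by rewrite leq_mul2r leqnSn orbT.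
have iQ l : (l < K.+1)%N -> intg (Q l).
  by move=> lK; apply: intg_sum => j _; have [] := block _ _ (idx' l j) (idx l j lK (ltn_ord j)).
have Q0 l w : 0 <= Q l w by apply: sumr_ge0 => j _; exact: sqr_ge0.
have EQ l : (l < K.+1)%N -> Ex (Q l) <= d%:R.
  move=> lK; rewrite /Q Ex_sum; last first.
    by move=> j _; have [] := block _ _ (idx' l j) (idx l j lK (ltn_ord j)).
  apply: (@le_trans _ _ (\sum_(j < 2 ^ l) (H (t (j * 2 ^ (K - l))%N) - H (t (j.+1 * 2 ^ (K - l))%N)))).
    by apply: ler_sum => j _; have [] := block _ _ (idx' l j) (idx l j lK (ltn_ord j)).
  rewrite (_ : \sum_(j < _) _ = - \sum_(0 <= j < 2 ^ l) (H (t (j.+1 * 2 ^ (K - l))%N) - H (t (j * 2 ^ (K - l))%N))); last first.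
    by rewrite -sumrN big_mkord; apply: eq_bigr => j _; rewrite opprB.
  rewrite (telescope_sumr (fun j => H (t (j * 2 ^ (K - l))%N))) // opprB.
  have h1 : H (t (0 * 2 ^ (K - l))%N) <= d%:R.
    rewrite -[d in d%:R]card_ord -sum1_card natr_sum; apply: ler_sum => i _; exact: tail_le1.
  have h2 : 0 <= H (t (2 ^ l * 2 ^ (K - l))%N) by apply: sumr_ge0 => i _; exact: tail_ge0.
  lra.
have msq l : (l < K.+1)%N -> measurable_fun setT (fun w => Num.sqrt (Q l w)).
  move=> lK; have ms : measurable_fun setT (@Num.sqrt R).
    by apply: continuous_measurable_fun; exact: sqrt_continuous.
  exact: (measurableT_comp ms (intg_measurable (iQ l lK))).
have isq l : (l < K.+1)%N -> intg (fun w => Num.sqrt (Q l w)).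
  move=> lK; apply: intg_sqr; first exact: msq.
  by under eq_fun do rewrite sqr_sqrtr //; exact: iQ.
exists (fun w => \sum_(l < K.+1) Num.sqrt (Q l w)); split.
- by apply: intg_sum => l _; exact: isq.
- rewrite Ex_sum; last by move=> l _; exact: isq.
  rewrite -[K.+1 in leRHS]card_ord -sum1_card natr_sum mulr_suml; apply: ler_sum => l _.
  rewrite mul1r; have := @Ex_norm_sqrt _ _ _ P (fun w => Num.sqrt (Q l w)) (msq l (ltn_ord l)).
  under eq_fun do rewrite sqr_sqrtr //.
  rewrite (_ : Ex (fun w : O => `|Num.sqrt (Q l w)|) = Ex (fun w => Num.sqrt (Q l w))); last first.
    by apply: eq_Ex => w; rewrite ger0_norm ?sqrtr_ge0.
  move=> /(_ (iQ l (ltn_ord l))) /le_trans; apply.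
  by rewrite ler_sqrt ?EQ.
- by move=> w k kK; exact: (dyadic_chain (c w)).
Qed.

Hypothesis Z0 : forall i y, 0 <= Z i y.
Hypothesis atomless : forall i c, 0 <= c -> P [set w | Z i (Y i w) = c] = 0%E.

(** The indicators at [s] and [t] differ only if [Z] is within [|s - t|] of [t]. These events
    decrease to [Z = t], which is null. Continuity is what lets the intermediate value theorem place
    the grid. *)
Lemma tail_continuous i : continuous (p i).
Proof.
move=> t; apply/cvgrPdist_lt => e e0.
pose F (n : nat) := [set w | `|Z i (Y i w) - t| <= n.+1%:R^-1].
have mZY : measurable_fun setT (fun w => Z i (Y i w)) by exact: measurableT_comp.
have mF n : measurable (F n).
  have mf : measurable_fun setT (fun w => `|Z i (Y i w) - t|).
    apply: measurableT_comp => //; apply: measurable_funB => //; exact: measurable_cst.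
  have := mf measurableT `]-oo, n.+1%:R^-1]%classic (measurable_itv _).
  by rewrite setTI (_ : _ @^-1` _ = F n) //; apply/seteqP; split => w /=; rewrite in_itv /=.
have F0 : P (\bigcap_n F n) = 0%E.
  have -> : \bigcap_n F n = [set w | Z i (Y i w) = t].
    apply/seteqP; split => [w Fw|w /= wt n _]; last by rewrite /F /= wt subrr normr0.
    apply/eqP; rewrite -subr_eq0 -normr_le0; apply/ler_addgt0Pr => r r0.
    rewrite add0r; have := Fw (Num.truncn r^-1) I; rewrite /F /= => /le_trans; apply.
    by rewrite invf_ple ?posrE //; apply/ltW; exact: truncnS_gt.
  (* Null level sets are assumed for nonnegative levels only; the negative ones are empty. *)
  have [t0|t0] := leP 0 t; first exact: atomless.
  rewrite (_ : mkset _ = set0) ?measure0 //; apply/seteqP; split => w //= Zt.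
  by have := Z0 i (Y i w); rewrite Zt leNgt t0.
have cF : P (F n) @[n --> \oo] --> 0%E.
  rewrite -F0; apply: nonincreasing_cvg_mu => //.
  - by rewrite ltey_eq fin_num_measure.
  - exact: bigcapT_measurable.
  - move=> m n mn; apply/subsetPset => w /le_trans; apply.
    by rewrite lef_pV2 ?posrE // ler_nat.
have [n Pn] : exists n, (P (F n) < e%:E)%E.
  move/fine_cvgP : cF => [_ /cvgrPdist_lt /(_ e e0)].
  move=> /(@filter_ex _ _ _ _) [n /=]; rewrite sub0r normrN => h; exists n.
  rewrite -(fineK (fin_num_measure P _ (mF n))) lte_fin; apply: le_lt_trans h; exact: ler_norm.
near=> s.
have st : `|t - s| <= n.+1%:R^-1.
  by near: s; apply: (@cvgr_dist_le _ _ _ _ _ id); [exact: cvg_id|rewrite invr_gt0].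
have : `|p i t - p i s| <= Ex (\1_(F n)).
  rewrite -ExB; [|exact: intg_ind_gt|exact: intg_ind_gt].
  have iF : intg (\1_(F n)).
    apply: (@intg_bounded _ _ _ P _ 1); first exact: measurable_indic.
    by move=> w; rewrite indicE; case: (_ \in _); rewrite ?normr0 ?normr1.
  apply: Ex_abs_le => //; first by apply: intgB; exact: intg_ind_gt.
  move=> w; rewrite indicE.
  have [|/negP h] := boolP (w \in F n).
    by case: (_ < _) => _; case: (_ < _) => /=; rewrite ?subrr ?subr0 ?sub0r ?normrN ?normr0 ?normr1.
  have {}h : n.+1%:R^-1 < `|Z i (Y i w) - t| by rewrite ltNge; apply/negP => h'; apply: h; rewrite inE.
  rewrite (_ : (t < Z i (Y i w)) = (s < Z i (Y i w))) ?subrr ?normr0 //.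
  move: h st; move: (n.+1%:R^-1) (Z i (Y i w)) => a z.
  move=> az ts; case: (ltP t z) => tz; apply/esym.
    by move: az ts; rewrite gtr0_norm ?subr_gt0 // ler_norml => az /andP[]; lra.
  apply/negbTE; rewrite -leNgt.
  by move: az ts; rewrite ler0_norm ?subr_le0 // ler_norml => az /andP[]; lra.
move=> /le_lt_trans; apply.
by rewrite prob_indic // -lte_fin /prob fineK // fin_num_measure.
Unshelve. all: by end_near. Qed.

Lemma tail_vanish i (e : R) : 0 < e -> exists2 b : R, 0 <= b & p i b < e.
Proof.
move=> e0.
pose F (n : nat) := [set w | n%:R < Z i (Y i w)].
have mZY : measurable_fun setT (fun w => Z i (Y i w)) by exact: measurableT_comp.
have mF n : measurable (F n).
  have := mZY measurableT `]n%:R, +oo[%classic (measurable_itv _).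
  by rewrite setTI (_ : _ @^-1` _ = F n) //; apply/seteqP; split => w /=; rewrite in_itv /= andbT.
have cF : P (F n) @[n --> \oo] --> 0%E.
  rewrite -(measure0 P) (_ : set0 = \bigcap_n F n).
    apply: nonincreasing_cvg_mu => //.
    - by rewrite ltey_eq fin_num_measure.
    - exact: bigcapT_measurable.
    - by move=> m n mn; apply/subsetPset => w; apply: le_lt_trans; rewrite ler_nat.
  apply/seteqP; split => w // /(_ (Num.truncn (Z i (Y i w))).+1 I).
  by rewrite /F /= ltNge => /negP; apply; apply/ltW; exact: truncnS_gt.
move/fine_cvgP : cF => [_ /cvgrPdist_lt /(_ e e0)].
move=> /(@filter_ex _ _ _ _) [n /=]; rewrite sub0r normrN => h; exists n%:R => //.
apply: le_lt_trans h; apply: le_trans (ler_norm _).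
rewrite -[leRHS]/(prob (F n)) -prob_indic // le_eqVlt; apply/orP; left; apply/eqP.
apply: eq_Ex => w; rewrite indicE; congr (nat_of_bool _)%:R.
by apply/idP/idP => [h|/set_mem //]; exact/mem_set.
Qed.

Lemma tail_sum_continuous : continuous H.
Proof.
rewrite (_ : H = fun t => \sum_i p i t) // => t.
elim: (index_enum _) => [|i s IH].
  by rewrite (_ : (fun _ => _) = cst 0); [exact: cst_continuous|apply/funext => x; rewrite big_nil].
rewrite (_ : (fun _ => _) = fun x => p i x + \sum_(j <- s) p j x); last first.
  by apply/funext => x; rewrite big_cons.
by apply: continuousD => //; exact: tail_continuous.
Qed.

Lemma tail_lt0 i (t : R) : t < 0 -> p i t = 1.
Proof.
move=> t0; rewrite -[RHS](Ex_cst P); apply: eq_Ex => w.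
by rewrite (lt_le_trans t0 (Z0 _ _)).
Qed.

(** The grid consists of quantiles: the expected count [H] drops by at most [u = d / 2^K <= 1] from
    one point to the next. Count and expected count are both nonincreasing, so between neighbours
    the deviation exceeds that at the grid points by at most [u], the [+ 1] of the bound. *)
Lemma uniform_tail_deviation (K : nat) (b0 : R) : (0 < d)%N -> (d <= 2 ^ K)%N ->
  exists D : O -> R, [/\ intg D, Ex D <= K.+1%:R * Num.sqrt d%:R + 1 &
    forall w (lam : R), 0 <= lam <= b0 ->
      `|\sum_i (ind (lam < Z i (Y i w)) - p i lam)| <= D w].
Proof.
move=> d0 dK.
pose N := (2 ^ K)%N.
have N0 : (0 < N)%N by rewrite expn_gt0.
have NR0 : 0 < N%:R :> R by rewrite ltr0n.
have dR0 : 0 < d%:R :> R by rewrite ltr0n.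
pose u : R := d%:R / N%:R.
have u0 : 0 < u by rewrite divr_gt0.
have u1 : u <= 1 by rewrite ler_pdivrMr // mul1r ler_nat.
(* The last point lies so far out that [H b < u], which keeps the last drop below [u] too. *)
have [b [bb0 b_ge0 Hb]] : exists b, [/\ b0 <= b, 0 <= b & H b < u].
  have /choice [bi Hbi] : forall i, exists bi, 0 <= bi /\ p i bi < N%:R^-1 / 2.
    move=> i; have [|bi ? ?] := @tail_vanish i (N%:R^-1 / 2); first by rewrite divr_gt0 ?invr_gt0.
    by exists bi.
  exists (Num.max b0 0 + \sum_i bi i).
  have s0 : 0 <= \sum_i bi i by apply: sumr_ge0 => i _; exact: (Hbi i).1.
  have m0 : b0 <= Num.max b0 0 by rewrite le_max lexx.
  have m1 : 0 <= Num.max b0 0 by rewrite le_max lexx orbT.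
  split; [lra|lra|].
  suff : H (Num.max b0 0 + \sum_i bi i) <= u / 2 by lra.
  rewrite /u -[d in d%:R]card_ord -sum1_card natr_sum !mulr_suml.
  apply: ler_sum => i _; rewrite mul1r; apply/ltW.
  apply: le_lt_trans (Hbi i).2; apply: tail_nonincr.
  rewrite (bigD1 i) //=; have : 0 <= \sum_(j | j != i) bi j by apply: sumr_ge0 => j _; exact: (Hbi j).1.
  lra.
have Hm1 : H (-1) = d%:R.
  rewrite /H -[d in RHS]card_ord -sum1_card natr_sum; apply: eq_bigr => i _.
  by apply: tail_lt0; lra.
have /choice [t0 Ht0] : forall k : nat, exists t : R, (0 < k < N)%N -> [/\ -1 <= t, t <= b & H t = d%:R - k%:R * u].
  move=> k; have [/andP[k0 kN]|_] := boolP (0 < k < N)%N; last by exists 0.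
  have [|||t] := @IVT R H (-1) b (d%:R - k%:R * u).
  - by lra.
  - exact: continuous_subspaceT tail_sum_continuous.
  - have kN' : k%:R * u <= (N%:R - 1) * u.
      by rewrite ler_pM2r // lerBrDr natr1 ler_nat.
    have kk : 0 <= k%:R * u by rewrite mulr_ge0 // ltW.
    have Nu : N%:R * u = d%:R by rewrite /u mulrC divfK // gt_eqF.
    have Hbm : H b <= H (-1) by apply: H_nonincr; lra.
    rewrite Hm1 in Hbm *.
    by rewrite ge_min le_max; apply/andP; split; apply/orP; [right|left]; nra.
  - by rewrite in_itv /= => /andP[? ?] ?; exists t.
(* Below 0 every index is counted with certainty, so the chain starts at [-1] from a deviation that
   is exactly 0. *)
pose t (k : nat) := if k == 0%N then -1 else if (k < N)%N then t0 k else b.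
have Ht k : (k < N)%N -> H (t k) = d%:R - k%:R * u /\ -1 <= t k <= b.
  move=> kN; rewrite /t; case: eqP => [->|/eqP k0].
    by rewrite Hm1 mul0r subr0; split => //; apply/andP; split; lra.
  rewrite kN; have [|-> -> ->] := Ht0 k; first by rewrite kN lt0n k0.
  by [].
have tN : t N = b by rewrite /t ltnn; case: eqP => // N0'; move: N0; rewrite N0'.
have HtS k : (k < N)%N -> H (t k) - H (t k.+1) <= u.
  move=> kN; have [-> _] := Ht k kN.
  have [kN1|kN1] := ltnP k.+1 N.
    by have [-> _] := Ht _ kN1; rewrite -natr1; lra.
  have -> : k.+1 = N by apply/eqP; rewrite eqn_leq kN kN1.
  rewrite tN; have Hb0 : 0 <= H b by apply: sumr_ge0 => i _; exact: tail_ge0.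
  have kk : k.+1 = N by apply/eqP; rewrite eqn_leq kN kN1.
  have Nu : N%:R * u = d%:R by rewrite /u mulrC divfK // gt_eqF.
  by rewrite -kk -natr1 in Nu; lra.
have tmono k : (k < N)%N -> t k <= t k.+1.
  move=> kN; have [Hk /andP[tk1 tkb]] := Ht k kN.
  have [kN1|kN1] := ltnP k.+1 N; last first.
    have -> : k.+1 = N by apply/eqP; rewrite eqn_leq kN kN1.
    by rewrite tN.
  have [Hk1 _] := Ht _ kN1.
  rewrite leNgt; apply/negP => /ltW /H_nonincr; rewrite Hk Hk1 -natr1; lra.
have [S [iS ES HS]] := grid_deviation tmono.
exists (fun w => S w + u); split.
- by apply: intgD => //; exact: intg_cst.
- by rewrite ExD ?Ex_cst //; [lra|exact: intg_cst].
move=> w lam /andP[l0 lb].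
have [k [kN tk tk1]] : exists k, [/\ (k < N)%N, t k <= lam & lam <= t k.+1].
  have ex : exists k, lam <= t k by exists N; rewrite tN; lra.
  case: (ex_minnP ex) => -[|k] lk kmin.
    by move: lk; rewrite /t eqxx; lra.
  have kN : (k < N)%N by apply: kmin; rewrite tN; lra.
  exists k; split => //; rewrite leNgt; apply/negP => /ltW /kmin.
  by rewrite ltnn.
have dk j : (j <= N)%N -> `|\sum_i (ind (t j < Z i (Y i w)) - p i (t j))| <= S w.
  move=> jN; have := HS w j jN; rewrite [X in _ - X]big1 ?subr0 // => i _.
  rewrite tail_lt0; last by rewrite /t eqxx; lra.
  by rewrite (lt_le_trans _ (Z0 _ _)) ?subrr // /t eqxx; lra.
have split_dev s : \sum_i (ind (s < Z i (Y i w)) - p i s) = \sum_i ind (s < Z i (Y i w)) - H s.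
  by rewrite sumrB.
have cm s s' : s <= s' -> \sum_i ind (s' < Z i (Y i w)) <= \sum_i ind (s < Z i (Y i w)).
  move=> ss; apply: ler_sum => i _; rewrite ler_nat; case: (ltP s') => //= sz.
  by rewrite (le_lt_trans ss sz).
have := dk k (ltnW kN); have := dk k.+1 kN; rewrite !split_dev !ler_norml.
have := HtS k kN; have := cm _ _ tk; have := cm _ _ tk1.
have := H_nonincr tk; have := H_nonincr tk1.
move=> h1 h2 h3 h4 h5 /andP[h6 h7] /andP[h8 h9].
by apply/andP; split; lra.
Qed.

End tails.

(** A grid of mesh [dl = Lam / d] suffices. Each of the [d] increments has standard deviation at
    most [dl * s * sqrt d], in total [Lam * s * sqrt d]; inside a cell the Lipschitz bound costs
    [dl * \sum_i (|Y_i| + s)], of mean at most [2 * Lam * s]. Since [sqrt d >= 1], the factor 3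
    covers both. *)
Lemma clip_deviation (th : 'I_d -> R) (s Lam : R) : (0 < d)%N -> 0 <= Lam -> 0 <= s ->
  (forall i, intg (fun w => Y i w ^+ 2)) -> (forall i, Ex (fun w => Y i w ^+ 2) <= s ^+ 2) ->
  exists D : O -> R, [/\ intg D, Ex D <= 3 * Lam * s * Num.sqrt d%:R &
    forall w (lam : R), 0 <= lam <= Lam ->
      `|\sum_i (Y i w * clip lam (th i + Y i w) - Ex (fun w => Y i w * clip lam (th i + Y i w)))| <= D w].
Proof.
move=> d0 L0 s0 iY2 EY2.
have dR0 : 0 < d%:R :> R by rewrite ltr0n.
pose dl : R := Lam / d%:R.
have dl0 : 0 <= dl by rewrite divr_ge0 // ltW.
have ddl : d%:R * dl = Lam by rewrite /dl mulrC divfK // gt_eqF.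
have iY i : intg (Y i) by apply: intg_sqr.
have iYn i : intg (fun w => `|Y i w|) by exact: intg_norm.
have EYn i : Ex (fun w => `|Y i w|) <= s.
  apply: (le_trans (Ex_norm_sqrt (mY i) (iY2 i))).
  by rewrite -(ger0_norm s0) -sqrtr_sqr ler_sqrt ?sqr_ge0.
pose C lam i y := y * clip lam (th i + y).
have mC lam i : measurable_fun setT (C lam i).
  apply: measurable_funM => //; apply: (measurableT_comp (measurable_clip lam)).
  by apply: measurable_funD => //; exact: measurable_cst.
have Cdiff lam lam' i y : 0 <= lam -> lam <= lam' -> `|C lam' i y - C lam i y| <= `|y| * (lam' - lam).
  move=> l0 ll; rewrite /C -mulrBr normrM; apply: ler_wpM2l => //.
  exact: clip_lip.
have C0 i y : C 0 i y = 0 by rewrite /C clip0 mulr0.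
have iC lam i : 0 <= lam -> intg (fun w => C lam i (Y i w)).
  move=> l0; apply: (intg_le _ (intgZ lam (iYn i))).
    exact: (measurableT_comp (mC lam i) (mY i)).
  by move=> w; have := @Cdiff 0 lam i (Y i w) (lexx _) l0; rewrite C0 !subr0 mulrC.
pose W lam w := \sum_i (C lam i (Y i w) - Ex (fun w => C lam i (Y i w))).
have W0 w : W 0 w = 0.
  rewrite /W big1 // => i _; rewrite C0; under eq_Ex do rewrite C0.
  by rewrite Ex_cst subrr.
have lk k : 0 <= k%:R * dl by rewrite mulr_ge0.
have lkS k : k%:R * dl <= k.+1%:R * dl by rewrite ler_wpM2r // ler_nat.
have Wdiff lam lam' w : 0 <= lam -> lam <= lam' ->
    `|W lam' w - W lam w| <= (lam' - lam) * \sum_i (`|Y i w| + s).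
  move=> l0 ll; rewrite /W -sumrB mulr_sumr; apply: le_trans (ler_norm_sum _ _ _) _.
  apply: ler_sum => i _.
  have i1 := iC lam i l0; have i2 := iC lam' i (le_trans l0 ll).
  have h1 := Cdiff _ _ i (Y i w) l0 ll.
  have h2 : `|Ex (fun w => C lam' i (Y i w)) - Ex (fun w => C lam i (Y i w))| <= (lam' - lam) * s.
    rewrite -ExB //; apply: (@le_trans _ _ (Ex (fun w => (lam' - lam) * `|Y i w|))).
      apply: Ex_abs_le; [exact: intgB|exact: intgZ|] => v.
      by rewrite mulrC; exact: Cdiff.
    by rewrite ExZ //; apply: ler_wpM2l; [lra|exact: EYn].
  rewrite (_ : _ - _ = (C lam' i (Y i w) - C lam i (Y i w)) -
     (Ex (fun w => C lam' i (Y i w)) - Ex (fun w => C lam i (Y i w)))); last by ring.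
  by apply: le_trans (ler_normB _ _) _; lra.
pose V k w := `|W (k.+1%:R * dl) w - W (k%:R * dl) w|.
have HV k : intg (V k) /\ Ex (V k) <= Num.sqrt (d%:R * (dl ^+ 2 * s ^+ 2)).
  pose F i y := C (k.+1%:R * dl) i y - C (k%:R * dl) i y.
  have mF i : measurable_fun setT (F i) by exact: measurable_funB.
  have Fle i w : F i (Y i w) ^+ 2 <= dl ^+ 2 * Y i w ^+ 2.
    have := Cdiff _ _ i (Y i w) (lk k) (lkS k).
    rewrite -/(F i (Y i w)) -natr1 mulrDl mul1r addrAC subrr add0r => h.
    rewrite -(real_normK (num_real (F i (Y i w)))) -(real_normK (num_real (Y i w))) -exprMn.
    by rewrite ler_sqr ?nnegrE ?mulr_ge0 // mulrC.
  have iF i : intg (fun w => F i (Y i w) ^+ 2).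
    apply: (intg_le _ (intgZ (dl ^+ 2) (iY2 i))).
      by apply: measurable_funX; exact: (measurableT_comp (mF i) (mY i)).
    by move=> w; rewrite ger0_norm ?sqr_ge0.
  have [|iFs EFs] := centered_sum_abs (v := d%:R * (dl ^+ 2 * s ^+ 2)) mF iF.
    rewrite -[d in leRHS]card_ord -sum1_card natr_sum mulr_suml; apply: ler_sum => i _.
    rewrite mul1r; apply: (@le_trans _ _ (dl ^+ 2 * Ex (fun w => Y i w ^+ 2))).
      by rewrite -ExZ //; apply: le_Ex => //; exact: intgZ.
    by apply: ler_wpM2l => //; exact: sqr_ge0.
  have E w : \sum_i (F i (Y i w) - Ex (fun w => F i (Y i w))) = W (k.+1%:R * dl) w - W (k%:R * dl) w.
    rewrite /W -sumrB; apply: eq_bigr => i _.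
    by rewrite /F ExB; [ring|exact: iC|exact: iC].
  have VE : V k = fun w => `|\sum_i (F i (Y i w) - Ex (fun w => F i (Y i w)))|.
    by apply/funext => w; rewrite E.
  by rewrite VE.
pose D w := \sum_(k < d) V k w + dl * \sum_i (`|Y i w| + s).
have iD1 : intg (fun w => \sum_(k < d) V k w) by apply: intg_sum => k _; exact: (HV k).1.
have iYs i : intg (fun w => `|Y i w| + s) by apply: intgD => //; exact: intg_cst.
have iD2 : intg (fun w => \sum_i (`|Y i w| + s)) by apply: intg_sum.
exists D; split.
- by apply: intgD => //; exact: intgZ.
- rewrite /D ExD ?ExZ ?Ex_sum //; last by exact: intgZ.
    apply: (@le_trans _ _ (\sum_(k < d) Num.sqrt (d%:R * (dl ^+ 2 * s ^+ 2)) + dl * (\sum_(i < d) (2 * s)))).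
      apply: lerD; first by apply: ler_sum => k _; exact: (HV k).2.
      apply: ler_wpM2l => //; apply: ler_sum => i _; rewrite ExD // ?Ex_cst; last exact: intg_cst.
      by have := EYn i; lra.
    have sc (c : R) : \sum_(i < d) c = d%:R * c by rewrite sumr_const card_ord mulr_natl.
    rewrite !sc.
    have -> : Num.sqrt (d%:R * (dl ^+ 2 * s ^+ 2)) = Num.sqrt d%:R * (dl * s).
      rewrite sqrtrM ?ler0n // -exprMn sqrtr_sqr ger0_norm // mulr_ge0 //.
    have sq1 : 1 <= Num.sqrt (d%:R : R) by rewrite -[leLHS]sqrtr1 ler_sqrt ?ler0n // ler1n.
    have -> : d%:R * (Num.sqrt d%:R * (dl * s)) + dl * (d%:R * (2 * s)) = (d%:R * dl) * s * (Num.sqrt d%:R + 2) by ring.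
    rewrite ddl; have : 0 <= Lam * s by exact: mulr_ge0.
    by nra.
  by move=> k _; exact: (HV k).1.
move=> w lam /andP[l0 lL].
have [k [kd kl lk1]] : exists k, [/\ (k <= d)%N, k%:R * dl <= lam & lam <= k%:R * dl + dl].
  have ex : exists k, lam <= k%:R * dl by exists d; rewrite ddl.
  case: (ex_minnP ex) => -[|k] lk' kmin.
    by exists 0%N; split => //; rewrite ?mul0r // in lk' *; lra.
  exists k; split.
  - by apply: ltnW; apply: kmin; rewrite ddl.
  - by rewrite leNgt; apply/negP => /ltW /kmin; rewrite ltnn.
  - by move: lk'; rewrite -natr1 mulrDl mul1r.
have Wk : `|W (k%:R * dl) w| <= \sum_(j < d) V j w.
  apply: (@le_trans _ _ (\sum_(j < k) V j w)).
    elim: k {kd kl lk1} => [|k IH]; first by rewrite mul0r W0 normr0 big_ord0.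
    rewrite big_ord_recr /=.
    rewrite (_ : W (k.+1%:R * dl) w = W (k%:R * dl) w + (W (k.+1%:R * dl) w - W (k%:R * dl) w)); last by ring.
    by apply: le_trans (ler_normD _ _) _; apply: lerD.
  rewrite -(big_mkord predT (fun j => V j w)) -(big_mkord predT (fun j => V j w)).
  rewrite (@big_cat_nat _ _ _ k 0 d) //= lerDl; apply: sumr_ge0 => j _; exact: normr_ge0.
change (`|W lam w| <= D w).
have -> : W lam w = W (k%:R * dl) w + (W lam w - W (k%:R * dl) w) by ring.
apply: le_trans (ler_normD _ _) _; apply: lerD => //.
apply: le_trans (Wdiff _ _ w (lk k) kl) _.
apply: ler_wpM2r; last by lra.
by apply: sumr_ge0 => i _; rewrite addr_ge0.
Qed.

End empirical.

(** * Consequences of a Stein kernel *)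

Section exp_moment.
Context {R : realType} {dO : measure_display} {O : measurableType dO} (P : probability O R).
Local Notation intg f := (P.-integrable setT (EFin \o (f : O -> R))).
Local Notation Ex := (Ex P).

Lemma Ex_dct (f_ : nat -> O -> R) (f g : O -> R) :
  (forall n, measurable_fun setT (f_ n)) -> measurable_fun setT f -> intg g ->
  (forall n w, `|f_ n w| <= g w) -> {ae P, forall w, f_ n w @[n --> \oo] --> f w} ->
  intg f /\ (Ex (f_ n) @[n --> \oo] --> Ex f).
Proof.
move=> mf_ mf ig fg ff.
have ifn n : intg (f_ n) by exact: (intg_le (mf_ n) ig).
have [] := @dominated_convergence _ _ _ P setT measurableT
  (fun n => EFin \o f_ n) (EFin \o f) (EFin \o g).
- by move=> n; exact/measurable_EFinP.
- exact/measurable_EFinP.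
- by move: ff; apply: filterS => w h _; apply/fine_cvgP; split => //; exact: nearW.
- exact: ig.
- by apply: aeW => w n _; rewrite /= lee_fin; exact: fg.
move=> if_ _ H.
split => //.
move: H; rewrite (_ : (fun n => _) = fun n => (Ex (f_ n))%:E); last first.
  by apply/funext => n /=; rewrite -ExE.
by rewrite ExE // => /fine_cvgP[].
Qed.

Lemma geometric_half_le (n : nat) : \sum_(k < n) (2^-1 : R) ^+ k <= 2.
Proof.
suff : \sum_(k < n) (2^-1 : R) ^+ k = 2 - 2 * 2^-1 ^+ n.
  move=> ->; have : 0 <= (2^-1 : R) ^+ n by apply: exprn_ge0; lra.
  by lra.
elim: n => [|n IH]; first by rewrite big_ord0 expr0; ring.
by rewrite big_ord_recr /= IH exprS; field.
Qed.

(** [exp Z] is at most the sum of [e^(n+1)] over the integers [n <= Z]. The tail [e^(-2n)] leaves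
    [e^(-n) <= 2^(-n)], which is summable. *)
Lemma exp_moment (Z : O -> R) (a : R) : measurable_fun setT Z -> (forall w, 0 <= Z w) -> 0 <= a ->
  (forall s, 0 < s -> (P [set w | (s <= Z w)%R] <= (a * expR (- 2 * s))%:E)%E) ->
  intg (fun w => expR (Z w)).
Proof.
move=> mZ Z0 a0 Htail.
have mA n : measurable [set w | n%:R <= Z w].
  have := mZ measurableT `[n%:R, +oo[%classic (measurable_itv _).
  by rewrite setTI (_ : _ @^-1` _ = [set w | n%:R <= Z w]) //; apply/seteqP; split => w /=; rewrite in_itv /= andbT.
pose f n (w : O) : \bar R := (expR n.+1%:R * \1_[set w | n%:R <= Z w] w)%:E.
have mf n : measurable_fun setT (f n).
  by apply/measurable_EFinP; apply: measurable_funM; [exact: measurable_cst|exact: measurable_indic].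
have f0 n w : (0 <= f n w)%E by rewrite lee_fin mulr_ge0 ?expR_ge0.
apply/integrableP; split.
  by apply/measurable_EFinP; apply: measurableT_comp => //; exact: measurable_expR.
apply: (@le_lt_trans _ _ (\int[P]_w (\sum_(n <oo) f n w))%E).
  apply: ge0_le_integral => //.
  - apply: measurableT_comp => //; apply/measurable_EFinP.
    by apply: measurableT_comp => //; exact: measurable_expR.
  - exact: ge0_emeasurable_sum.
  move=> w _; set n := Num.truncn (Z w).
  have nZ : n%:R <= Z w by rewrite truncn_le.
  have Zn : Z w < n.+1%:R by exact: truncnS_gt.
  apply: (@le_trans _ _ (\sum_(0 <= k < n.+1) f k w)%E); last first.
    by apply: nneseries_lim_ge => k _ _.
  rewrite big_nat_recr //= -[leLHS]add0e; apply: leeD; first by apply: sume_ge0.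
  rewrite /f indicE mem_set // mulr1 lee_fin ger0_norm ?expR_ge0 // ler_expR.
  exact: ltW.
rewrite integral_nneseries //.
(* The tail bound holds for positive [s] only, so the term [n = 0] is bounded by [e], using that a
   probability is at most 1. *)
pose B := expR 1 + a * expR 1 * 2.
apply: (@le_lt_trans _ _ B%:E); last exact: ltry.
apply: lime_le; first by apply: is_cvg_nneseries => n _ _; apply: integral_ge0.
apply: nearW => n; rewrite big_mkord.
have fb k : (\int[P]_w f k w <= (if k == 0%N then expR 1 else a * expR 1 * 2^-1 ^+ k)%:E)%E.
  rewrite /f; under eq_integral do rewrite EFinM.
  rewrite ge0_integralZl //; last by apply/measurable_EFinP; exact: measurable_indic.
  rewrite integral_indic // setIT.
  case: eqP => [->|/eqP k0].
    rewrite -[leRHS]mule1; apply: lee_pmul; rewrite ?lee_fin ?expR_ge0 //.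
    exact: probability_le1.
  apply: (@le_trans _ _ ((expR k.+1%:R)%:E * (a * expR (-2 * k%:R))%:E)%E).
    by apply: lee_pmul; rewrite ?lee_fin ?expR_ge0 // Htail // ltr0n lt0n.
  rewrite -EFinM lee_fin mulrCA -expRD -mulrA; apply: ler_wpM2l => //.
  rewrite (_ : k.+1%:R + -2 * k%:R = 1 + k%:R * (-1)); last by rewrite -natr1; ring.
  rewrite expRD; apply: ler_wpM2l; first exact: expR_ge0.
  rewrite expRM_natl expRN; apply: lerXn2r; rewrite ?nnegrE ?invr_ge0 ?expR_ge0 //.
  by rewrite lef_pV2 ?posrE ?expR_gt0 //; have := expR_ge1Dx (1 : R).
apply: (@le_trans _ _ (\sum_(k < n) (if k == 0%N :> nat then expR 1 else a * expR 1 * 2^-1 ^+ k)%:E)%E).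
  by apply: lee_sum => k _; exact: fb.
rewrite sumEFin lee_fin /B.
have ae : 0 <= a * expR 1 by rewrite mulr_ge0 // expR_ge0.
apply: (@le_trans _ _ (expR 1 + a * expR 1 * \sum_(k < n) 2^-1 ^+ k)); last first.
  by rewrite lerD2l ler_wpM2l //; exact: geometric_half_le.
have pk k : 0 <= (2^-1 : R) ^+ k by apply: exprn_ge0; lra.
case: n => [|n]; first by rewrite !big_ord0 mulr0 addr0 expR_ge0.
rewrite !big_ord_recl /= expr0 mulrDr mulr1 lerD2l mulr_sumr.
rewrite -[leLHS]add0r lerD //.
Qed.

(** This is [z^k <= k! e^z] at [z = y^2 / (2c)]. *)
Lemma even_moment_le (y c : R) (k : nat) : 0 < c ->
  y ^+ (2 * k) <= k`!%:R * (2 * c) ^+ k * expR (y ^+ 2 / (2 * c)).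
Proof.
move=> c0; set z := y ^+ 2 / (2 * c).
have z0 : 0 <= z by rewrite divr_ge0 ?sqr_ge0 // mulr_ge0 // ltW.
have -> : y ^+ (2 * k) = (2 * c) ^+ k * z ^+ k.
  by rewrite -exprMn exprM /z mulrC divfK // gt_eqF // mulr_gt0.
rewrite -mulrA mulrCA; apply: ler_wpM2l; first by rewrite exprn_ge0 // mulr_ge0 // ltW.
case: k => [|k].
  by rewrite expr0 mul1r; have := expR_ge1Dx z; lra.
have fk : 0 < (k.+1`!)%:R :> R by rewrite ltr0n fact_gt0.
rewrite -ler_pdivrMl // mulrC; have := expR_ge1Dxn k z0; lra.
Qed.

End exp_moment.

Section stein.
Context {R : realType} {d : nat} {dO : measure_display} {O : measurableType dO} (P : probability O R).
Local Notation intg f := (P.-integrable setT (EFin \o (f : O -> R))).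
Local Notation Ex := (Ex P).
Local Notation V := (Vsp R d).
Variables (Y : 'I_d -> O -> R) (sigma : R).
Hypothesis mY : forall i, measurable_fun setT (Y i).
Let Yv w : 'rV[R]_d := \row_i Y i w.

Lemma measurable_sqnorm : measurable_fun setT (@sqnorm R d : V -> R).
Proof.
apply: measurable_sum => i; apply: measurable_funX; exact: measurable_coord.
Qed.

Lemma enorm_box (x : 'rV[R]_d) (r : R) : enorm x <= r -> box r x.
Proof.
move=> xr i; apply: le_trans xr.
rewrite /enorm -(sqrtr_sqr (x ord0 i)) ler_sqrt; last by apply: sumr_ge0 => j _; exact: sqr_ge0.
by rewrite /sqnorm (bigD1 i) //= lerDl sumr_ge0 // => j _; exact: sqr_ge0.
Qed.

Lemma measurable_enorm : measurable_fun setT (@enorm R d : V -> R).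
Proof.
have ms : measurable_fun setT (@Num.sqrt R).
  by apply: continuous_measurable_fun; exact: sqrt_continuous.
exact: (measurableT_comp ms measurable_sqnorm).
Qed.

Lemma loc_integrable_continuous (g : 'rV[R]_d -> R) : continuous g -> loc_integrable g.
Proof.
move=> cg; have mg := continuous_measurable_rV cg.
split; first exact/rv_measurable_funE.
move=> r.
have /compact_bounded [M [_ HM]] : compact (g @` box r).
  by apply: continuous_compact; [exact: continuous_subspaceT|exact: compact_box].
pose ball_ind (x : V) : R := if enorm x <= r then 1 else 0.
have mb : measurable_fun setT ball_ind.
  have -> : ball_ind = \1_[set x : V | enorm x <= r].
    apply/funext => x; rewrite indicE /ball_ind.
    by case: ifPn => [h|/negP h]; [rewrite mem_set|rewrite memNset].
  apply: measurable_indic.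
  have := measurable_enorm measurableT (measurable_itv `]-oo, r]).
  by rewrite setTI (_ : _ @^-1` _ = [set x : V | enorm x <= r]) //; apply/seteqP; split => w /=; rewrite in_itv.
have ig : lebV.-integrable setT (EFin \o (fun x : V => `|g x| * ball_ind x)).
  apply: (@integrable_bounded_box _ _ _ r (M + 1)).
  - by apply: measurable_funM => //; exact: measurableT_comp.
  - move=> x xr; rewrite /ball_ind ifF ?mulr0 //; apply/negP => /enorm_box; exact: xr.
  - move=> x bx; rewrite normrM normr_id.
    have gM : `|g x| <= M + 1 by apply: HM; [rewrite ltrDl|exists x].
    rewrite /ball_ind; case: ifP => _; rewrite ?normr1 ?normr0 ?mulr1 ?mulr0 //.
    exact: le_trans gM.
rewrite (lebdE ig); have := integrable_lty measurableT ig.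
by apply.
Qed.

Variable T : 'rV[R]_d -> 'M[R]_d.
Hypothesis steinT : stein_kernel P Yv T.

(** The field [h (x_j) e_j] has a Jacobian with a single entry, so only [T_jj] survives in the
    identity. *)
Lemma stein_coord (j : 'I_d) (h h' : R -> R) :
  (forall t, is_derive t (1 : R) h (h' t)) -> continuous h' ->
  intg (fun w => h (Y j w) ^+ 2) -> intg (fun w => h' (Y j w) ^+ 2) ->
  Ex (fun w => Y j w * h (Y j w)) = Ex (fun w => T (Yv w) j j * h' (Y j w)).
Proof.
move=> dh ch' ih ih'; have ch := is_derive_continuous dh.
pose f (x : 'rV[R]_d) : 'rV[R]_d := \row_i (if i == j then h (x ord0 j) else 0).
pose G (x : 'rV[R]_d) : 'M[R]_d := \matrix_(i, k) (if (i == j) && (k == j) then h' (x ord0 j) else 0).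
have YvE w i : Yv w ord0 i = Y i w by rewrite mxE.
have chj : continuous (fun x : 'rV[R]_d => h (x ord0 j)).
  by move=> x; apply: continuous_comp; [exact: continuous_coord|exact: ch].
have chj' : continuous (fun x : 'rV[R]_d => h' (x ord0 j)).
  by move=> x; apply: continuous_comp; [exact: continuous_coord|exact: ch'].
have S : sobolev12 P Yv f G.
  split.
    move=> i; apply: loc_integrable_continuous.
    rewrite (_ : (fun x => _) = if i == j then (fun x : 'rV[R]_d => h (x ord0 j)) else (fun=> 0)).
      by case: ifP => _; [exact: chj|exact: cst_continuous].
    by apply/funext => x; rewrite mxE; case: ifP.
  split.
    move=> i k; apply: loc_integrable_continuous.
    rewrite (_ : (fun x => _) = if (i == j) && (k == j) then (fun x : 'rV[R]_d => h' (x ord0 j)) else (fun=> 0)).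
      by case: ifP => _; [exact: chj'|exact: cst_continuous].
    by apply/funext => x; rewrite mxE; case: ifP.
  split.
    move=> i; under eq_integral do rewrite mxE YvE.
    case: eqP => _; last by under eq_integral do rewrite expr0n /=; rewrite integral0 ltry.
    by have := integrable_lty measurableT ih; apply.
  split.
    move=> i k; under eq_integral do rewrite mxE YvE.
    case: ((i == j) && (k == j)); last by under eq_integral do rewrite expr0n /=; rewrite integral0 ltry.
    by have := integrable_lty measurableT ih'; apply.
  move=> i k psi tpsi.
  have [->|ij] := eqVneq i j.
    transitivity (lebd (fun x => (h (x ord0 j) * 'D_(evec k) psi x)%:E)).
      by congr lebd; apply/funext => x; rewrite mxE eqxx.
    rewrite (@lebd_coord_by_parts _ _ j k h h' psi) //; congr (- lebd _)%E.
    apply/funext => x; rewrite mxE eqxx /=.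
    by case: (k == j); rewrite ?mul1r ?mul0r.
  have z : lebd (fun _ : 'rV[R]_d => 0%E : \bar R) = 0%E.
    rewrite lebd_ge0E ?integral0 //; exact: measurable_cst.
  transitivity (0%E : \bar R).
    rewrite -[RHS]z; congr lebd; apply/funext => x; rewrite mxE (negPf ij) mul0r //.
  rewrite -[LHS]oppe0 -z; congr (- lebd _)%E; apply/funext => x.
  by rewrite mxE (negPf ij) /= mul0r.
have := (proj2 steinT) f G S.
have -> : (fun w => (\sum_i Yv w ord0 i * f (Yv w) ord0 i)%:E) = EFin \o (fun w => Y j w * h (Y j w)).
  apply/funext => w /=; congr EFin; rewrite (bigD1 j) //= big1 => [|i ij].
    by rewrite addr0 !mxE eqxx.
  by rewrite [f _ _ _]mxE (negPf ij) mulr0.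
have -> : (fun w => (\sum_i \sum_k T (Yv w) i k * G (Yv w) i k)%:E) = EFin \o (fun w => T (Yv w) j j * h' (Y j w)).
  apply/funext => w /=; congr EFin; rewrite (bigD1 j) //= [X in _ + X]big1 => [|i ij].
    rewrite addr0 (bigD1 j) //= big1 => [|k kj]; first by rewrite addr0 !mxE !eqxx.
    by rewrite [G _ _ _]mxE (negPf kj) andbF mulr0.
  by apply: big1 => k _; rewrite [G _ _ _]mxE (negPf ij) mulr0.
by rewrite /Ex /Rintegral => ->.
Qed.

End stein.

(** * Smoothing the absolute value and the clipping function *)

Section smooth_abs.
Context {R : realType}.

(** Clipping is half a difference of two absolute values ([clip_abs]), so a continuously
    differentiable, 1-Lipschitz version of [|a|] yields one of [clip]. *)
Definition sabs (e a : R) : R := Num.sqrt (a ^+ 2 + e).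

Lemma sabs_arg_gt0 (e a : R) : 0 < e -> 0 < a ^+ 2 + e.
Proof. by move=> e0; have := sqr_ge0 a; lra. Qed.

Lemma sabs_gt0 (e a : R) : 0 < e -> 0 < sabs e a.
Proof. by move=> e0; rewrite sqrtr_gt0 sabs_arg_gt0. Qed.

Lemma sabs_sqr (e a : R) : 0 < e -> sabs e a ^+ 2 = a ^+ 2 + e.
Proof. by move=> e0; rewrite sqr_sqrtr // ltW // sabs_arg_gt0. Qed.

Lemma sabs_ge (e a : R) : 0 < e -> `|a| <= sabs e a.
Proof.
move=> e0; rewrite -sqrtr_sqr ler_sqrt; first by lra.
by rewrite ltW // sabs_arg_gt0.
Qed.

Lemma sabs_lip (e a b : R) : 0 < e -> `|sabs e a - sabs e b| <= `|a - b|.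
Proof.
move=> e0; have A := sabs_gt0 a e0; have B := sabs_gt0 b e0.
have AB : 0 < sabs e a + sabs e b by lra.
rewrite -(ler_pM2r AB) -[X in _ * X <= _](gtr0_norm AB) -normrM.
have -> : (sabs e a - sabs e b) * (sabs e a + sabs e b) = (a - b) * (a + b).
  transitivity (sabs e a ^+ 2 - sabs e b ^+ 2); first by ring.
  by rewrite !sabs_sqr //; ring.
rewrite normrM; apply: ler_wpM2l => //.
apply: le_trans (ler_normD _ _) _; apply: lerD; exact: sabs_ge.
Qed.

Lemma is_derive_exprn (n : nat) (t : R) :
  is_derive t (1 : R) (fun t : R => t ^+ n.+1) (n.+1%:R * t ^+ n).
Proof.
have := @is_deriveX _ _ (@id R) n.+1 t 1 1 (is_derive_id _ _).
by rewrite exprfctE => /is_derive_eq; apply; rewrite /= /GRing.scale /= mulr1.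
Qed.

Lemma is_derive_sabs (e a : R) : 0 < e -> is_derive a (1 : R) (sabs e) (a / sabs e a).
Proof.
move=> e0.
have d1 : is_derive a (1 : R) (fun a : R => a ^+ 2 + e) (2 * a).
  have dX : is_derive a (1 : R) (fun a : R => a ^+ 2) (2 * a).
    have -> : 2 * a = 2%:R * a ^+ 1 by rewrite expr1.
    exact: is_derive_exprn.
  by have := is_deriveD dX (is_derive_cst e a 1); rewrite addr0.
have d2 := @is_derive1_sqrt R (a ^+ 2 + e) (sabs_arg_gt0 a e0).
have := @is_derive1_comp _ Num.sqrt (fun a : R => a ^+ 2 + e) a _ _ d2 d1.
move=> /is_derive_eq; apply; rewrite -/(sabs e a).
have := sabs_gt0 a e0 => s0; field; lra.
Qed.

Lemma sabs_cvg (a : R) : sabs n.+1%:R^-1 a @[n --> \oo] --> `|a|.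
Proof.
rewrite -sqrtr_sqr; apply: continuous_cvg; first exact: sqrt_continuous.
rewrite -[X in _ --> X]addr0; apply: cvgD; first exact: cvg_cst.
exact: cvg_harmonic.
Qed.

Lemma dsabs_cvg (a : R) : a / sabs n.+1%:R^-1 a @[n --> \oo] --> Num.sg a.
Proof.
have [->|a0] := eqVneq a 0.
  by rewrite sgr0; under eq_fun do rewrite mul0r; exact: cvg_cst.
have -> : Num.sg a = a / `|a|.
  by rewrite {2}[a]numEsg mulfK // normr_eq0.
apply: cvgMr; apply: cvgV; first by rewrite normr_eq0.
exact: sabs_cvg.
Qed.

Lemma clip_abs (lam x : R) : 0 <= lam -> clip lam x = (`|x + lam| - `|x - lam|) / 2.
Proof.
move=> l0; rewrite /clip.
have [h1|h1] := leP x lam; have [h2|h2] := leP 0 (x + lam).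
- by rewrite (ger0_norm h2) (ler0_norm (x := x - lam)) ?subr_le0 //; case: leP => h3; lra.
- by rewrite (ltr0_norm h2) (ler0_norm (x := x - lam)) ?subr_le0 //; case: leP => h3; lra.
- by rewrite (ger0_norm h2) (gtr0_norm (x := x - lam)) ?subr_gt0 //; case: leP => h3; lra.
- lra.
Qed.

(** The derivative of [clip_abs]. The points [|x| = lam] are excluded because the left side can be
    1/2 there. *)
Lemma sg_clip (lam x : R) : 0 <= lam -> `|x| != lam ->
  (Num.sg (x + lam) - Num.sg (x - lam)) / 2 = (`|x| <= lam)%R%:R.
Proof.
move=> l0 xl; have [h|h] := leP `|x| lam.
  have {}h : `|x| < lam by rewrite lt_neqAle xl h.
  move: h; rewrite ltr_norml => /andP[h1 h2].
  have -> : Num.sg (x + lam) = 1 by rewrite gtr0_sg //; lra.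
  have -> : Num.sg (x - lam) = -1 by rewrite ltr0_sg //; lra.
  by rewrite /=; lra.
have [x0|x0] := leP 0 x.
  rewrite ger0_norm // in h.
  have -> : Num.sg (x + lam) = 1 by rewrite gtr0_sg //; lra.
  have -> : Num.sg (x - lam) = 1 by rewrite gtr0_sg //; lra.
  by rewrite /=; lra.
rewrite ltr0_norm // in h.
have -> : Num.sg (x + lam) = -1 by rewrite ltr0_sg //; lra.
have -> : Num.sg (x - lam) = -1 by rewrite ltr0_sg //; lra.
by rewrite /=; lra.
Qed.

End smooth_abs.

(** * Variance bound and Stein identity for clipping, one coordinate at a time *)

Section stein_one_dim.
Context {R : realType} {dO : measure_display} {O : measurableType dO} (P : probability O R).
Local Notation intg f := (P.-integrable setT (EFin \o (f : O -> R))).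
Local Notation Ex := (Ex P).
Variables (y tau : O -> R) (s2 L C : R).
Hypothesis my : measurable_fun setT y.
Hypothesis mtau : measurable_fun setT tau.
Hypothesis tauL : forall w, `|s2 - tau w| <= L.
Hypothesis C0 : 0 < C.
Hypothesis iexp : intg (fun w => expR (y w ^+ 2 / (2 * C))).
Hypothesis stein : forall h h' : R -> R, (forall t, is_derive t (1 : R) h (h' t)) -> continuous h' ->
  intg (fun w => h (y w) ^+ 2) -> intg (fun w => h' (y w) ^+ 2) ->
  Ex (fun w => y w * h (y w)) = Ex (fun w => tau w * h' (y w)).

Lemma intg_even (k : nat) : intg (fun w => y w ^+ (2 * k)).
Proof.
apply: (intg_le _ (intgZ (k`!%:R * (2 * C) ^+ k) iexp)); first exact: measurable_funX.
by move=> w; rewrite ger0_norm ?even_moment_le // exprM exprn_ge0 // sqr_ge0.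
Qed.

Lemma intg_tau (f : O -> R) : measurable_fun setT f -> intg f -> intg (fun w => tau w * f w).
Proof.
move=> mf i; apply: (intg_le _ (intgZ (`|s2| + L) (intg_norm i))); first exact: measurable_funM.
move=> w; rewrite normrM; apply: ler_wpM2r => //.
have := tauL w; have : `|tau w| <= `|s2| + `|s2 - tau w|; last by lra.
by rewrite -{1}[tau w](subKr s2) ; apply: ler_normB.
Qed.

(** Upper and lower bounds on the moment of order [2k] both carry [k!], so the ratio
    [((s2 - L) / (2C))^k] stays below the fixed exponential moment. If the ratio exceeded 1,
    Bernoulli's inequality would make it unbounded; the size of the exponential moment is
    irrelevant, which is how [a] disappears. *)
Lemma stein_variance_bound : s2 <= 2 * C + L.
Proof.
pose m k := Ex (fun w => y w ^+ (2 * k)).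
have m_ge0 k : 0 <= m k by apply: Ex_ge0 => w; rewrite exprM exprn_ge0 // sqr_ge0.
rewrite leNgt; apply/negP => hs.
have c0 := C0.
have sL : 0 <= s2 - L by lra.
have rec k : (s2 - L) * k.+1%:R * m k <= m k.+1.
  pose h (t : R) := t ^+ (2 * k).+1; pose h' (t : R) := (2 * k).+1%:R * t ^+ (2 * k).
  have dh t : is_derive t (1 : R) h (h' t).
    exact: is_derive_exprn.
  have ch' : continuous h'.
    move=> t; apply: (@continuousM _ _ (cst (2 * k).+1%:R) (fun t : R => t ^+ (2 * k))); first exact: cst_continuous.
    exact: exprn_continuous.
  have i1 : intg (fun w => h (y w) ^+ 2).
    by rewrite /h; under eq_fun do rewrite -exprM mulnC; exact: intg_even.
  have i2 : intg (fun w => h' (y w) ^+ 2).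
    rewrite (_ : (fun w => _) = fun w => (2 * k).+1%:R ^+ 2 * y w ^+ (2 * (2 * k))).
      by apply: intgZ; exact: intg_even.
    by apply/funext => w; rewrite /h' exprMn -exprM [(2 * k * 2)%N]mulnC.
  have := stein dh ch' i1 i2; rewrite /h /h' => E.
  have -> : m k.+1 = Ex (fun w => tau w * ((2 * k).+1%:R * y w ^+ (2 * k))).
    rewrite -E; apply: eq_Ex => w; rewrite -exprS; congr (_ ^+ _).
    by rewrite mulnS.
  have -> : (s2 - L) * k.+1%:R * m k = Ex (fun w => (s2 - L) * k.+1%:R * y w ^+ (2 * k)).
    by rewrite ExZ //; exact: intg_even.
  apply: le_Ex.
  - by apply: intgZ; exact: intg_even.
  - apply: intg_tau; last by apply: intgZ; exact: intg_even.
    by apply: measurable_funM; [exact: measurable_cst|exact: measurable_funX].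
  - move=> w; rewrite mulrA; apply: ler_wpM2r; first by rewrite exprM exprn_ge0 // sqr_ge0.
    have t1 : s2 - L <= tau w by have := tauL w; rewrite ler_norml => /andP[]; lra.
    (* [2k + 1] is lowered to [k + 1] so that the recursion produces the same factorial as the upper
       bound. *)
    apply: (@le_trans _ _ ((s2 - L) * (2 * k).+1%:R)).
      apply: ler_wpM2l => //.
      by rewrite ler_nat ltnS leq_pmull.
    by apply: ler_wpM2r.
have low k : (s2 - L) ^+ k * k`!%:R <= m k.
  elim: k => [|k IH].
    by rewrite expr0 mul1r /m; under eq_Ex do rewrite muln0 expr0; rewrite Ex_cst.
  apply: le_trans (rec k); rewrite exprS factS natrM.
  have -> : (s2 - L) * (s2 - L) ^+ k * (k.+1%:R * k`!%:R) = (s2 - L) * k.+1%:R * ((s2 - L) ^+ k * k`!%:R) by ring.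
  by apply: ler_wpM2l => //; exact: mulr_ge0.
pose K := Ex (fun w => expR (y w ^+ 2 / (2 * C))).
have up k : m k <= k`!%:R * (2 * C) ^+ k * K.
  rewrite /K -ExZ //; apply: le_Ex; [exact: intg_even|exact: intgZ|].
  by move=> w; exact: even_moment_le.
pose q := (s2 - L) / (2 * C) - 1.
have q0 : 0 < q by rewrite subr_gt0 ltr_pdivlMr ?mul1r; lra.
have bern k : 1 + k%:R * q <= (1 + q) ^+ k.
  elim: k => [|k IH]; first by rewrite mul0r addr0 expr0.
  rewrite exprS -natr1.
  apply: (@le_trans _ _ ((1 + q) * (1 + k%:R * q))); last by apply: ler_wpM2l => //; lra.
  have : 0 <= k%:R * (q * q) by rewrite mulr_ge0 // mulr_ge0 // ltW.
  by lra.
have qK k : (1 + q) ^+ k <= K.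
  have cc : 0 < (2 * C) ^+ k by apply: exprn_gt0; lra.
  rewrite /q addrC subrK expr_div_n ler_pdivrMr //.
  have f0 : 0 < k`!%:R :> R by rewrite ltr0n fact_gt0.
  rewrite -(ler_pM2r f0); apply: le_trans (low k) _; apply: le_trans (up k) _.
  by rewrite le_eqVlt; apply/orP; left; apply/eqP; ring.
have := le_trans (bern (Num.truncn (K / q)).+1) (qK _).
have := truncnS_gt (K / q); rewrite ltr_pdivrMr // => h1 h2; lra.
Qed.

Lemma stein_id : intg (fun w => y w ^+ 2) -> Ex (fun w => y w ^+ 2) = Ex tau.
Proof.
move=> i2.
have := @stein id (fun=> 1) (fun t => is_derive_id _ _) (@cst_continuous _ _ _ ) i2.
under eq_Ex do rewrite -expr2.
move=> ->; last by under eq_fun do rewrite expr1n; exact: intg_cst.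
by apply: eq_Ex => w; rewrite mulr1.
Qed.

Hypothesis atomless : forall c : R, P [set w | y w = c] = 0%E.

(** The smoothed clips are bounded by [lam] with derivatives bounded by 1, so both sides of their
    Stein identities converge by domination. *)
Lemma stein_clip (th lam : R) : 0 <= lam -> 0 <= L ->
  Ex (fun w => y w * clip lam (th + y w)) = Ex (fun w => tau w * (`|th + y w| <= lam)%R%:R).
Proof.
move=> l0 L0.
pose e n : R := n.+1%:R^-1.
have e0 n : 0 < e n by rewrite invr_gt0.
pose h n t := (sabs (e n) (th + t + lam) - sabs (e n) (th + t - lam)) / 2.
pose h' n t := ((th + t + lam) / sabs (e n) (th + t + lam) - (th + t - lam) / sabs (e n) (th + t - lam)) / 2.
have dsh n c t : is_derive t (1 : R) (fun t => sabs (e n) (th + t + c)) ((th + t + c) / sabs (e n) (th + t + c)).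
  have d1 : is_derive t (1 : R) (fun t : R => th + t + c) 1.
    have := is_deriveD (is_deriveD (is_derive_cst th t 1) (is_derive_id t 1)) (is_derive_cst c t 1).
    by rewrite addr0 add0r.
  have := @is_derive1_comp _ (sabs (e n)) (fun t : R => th + t + c) t _ _ (is_derive_sabs _ (e0 n)) d1.
  by rewrite mulr1.
have dh n t : is_derive t (1 : R) (h n) (h' n t).
  have dB := is_deriveB (dsh n lam t) (dsh n (- lam) t).
  have -> : h n = 2^-1 *: ((fun t => sabs (e n) (th + t + lam)) - (fun t => sabs (e n) (th + t - lam))).
    by apply/funext => u; rewrite /h mulrC.
  have -> : h' n t = 2^-1 *: ((th + t + lam) / sabs (e n) (th + t + lam) - (th + t - lam) / sabs (e n) (th + t - lam)).
    by rewrite /h' mulrC.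
  exact: is_deriveZ.
have csabs n c : continuous (fun t => sabs (e n) (th + t + c)).
  exact: is_derive_continuous (dsh n c).
have clin c : continuous (fun t : R => th + t + c).
  move=> t; apply: cvgD; last exact: cvg_cst.
  by apply: cvgD; [exact: cvg_cst|exact: cvg_id].
have cds n c : continuous (fun t => (th + t + c) / sabs (e n) (th + t + c)).
  move=> t; apply: cvgM; first exact: clin.
  by apply: cvgV; [rewrite gt_eqF // sabs_gt0|exact: csabs].
have ch' n : continuous (h' n).
  by move=> t; apply: cvgMl; apply: cvgB; exact: cds.
have hl n t : `|h n t| <= lam.
  rewrite /h normrM [`|2^-1|]gtr0_norm ?invr_gt0 // ler_pdivrMr //.
  apply: le_trans (sabs_lip _ _ (e0 n)) _.
  by rewrite (_ : _ - _ = lam * 2); [rewrite ger0_norm // mulr_ge0|ring].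
have ds1 n a : `|a / sabs (e n) a| <= 1.
  rewrite normrM normfV (gtr0_norm (sabs_gt0 a (e0 n))) ler_pdivrMr ?sabs_gt0 // mul1r.
  exact: sabs_ge.
have h'1 n t : `|h' n t| <= 1.
  rewrite /h' normrM [`|2^-1|]gtr0_norm ?invr_gt0 // ler_pdivrMr // mul1r.
  apply: le_trans (ler_normB _ _) _.
  by have := ds1 n (th + t + lam); have := ds1 n (th + t - lam); lra.
have mh n : measurable_fun setT (fun w => h n (y w)).
  apply: measurableT_comp => //; apply: continuous_measurable_fun.
  exact: is_derive_continuous (dh n).
have mh' n : measurable_fun setT (fun w => h' n (y w)).
  by apply: measurableT_comp => //; apply: continuous_measurable_fun; exact: ch'.
have E n : Ex (fun w => y w * h n (y w)) = Ex (fun w => tau w * h' n (y w)).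
  apply: stein => //.
    apply: (@intg_bounded _ _ _ P _ (lam ^+ 2)); first exact: measurable_funX.
    by move=> w; rewrite normrX; apply: lerXn2r; rewrite ?nnegrE.
  apply: (@intg_bounded _ _ _ P _ (1 ^+ 2)); first exact: measurable_funX.
  by move=> w; rewrite normrX; apply: lerXn2r; rewrite ?nnegrE.
have iy : intg y.
  by apply: intg_sqr => //; have := intg_even 1; rewrite muln1.
have H1 : Ex (fun w => y w * h n (y w)) @[n --> \oo] --> Ex (fun w => y w * clip lam (th + y w)).
  apply: (proj2 (Ex_dct _ _ (intgZ lam (intg_norm iy)) _ _)).
  - by move=> n; exact: measurable_funM.
  - apply: measurable_funM => //; apply: (measurableT_comp (measurable_clip lam)).
    by apply: measurable_funD => //; exact: measurable_cst.
  - by move=> n w; rewrite normrM mulrC; apply: ler_wpM2r => //; exact: hl.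
  - apply: aeW => w; apply: cvgMr; rewrite clip_abs //.
    by apply: cvgMl; apply: cvgB; exact: sabs_cvg.
have H2 : Ex (fun w => tau w * h' n (y w)) @[n --> \oo] --> Ex (fun w => tau w * (`|th + y w| <= lam)%R%:R).
  have mX : measurable_fun setT (fun w => `|th + y w|).
    by apply: measurableT_comp => //; apply: measurable_funD => //; exact: measurable_cst.
  have mI : measurable_fun setT (fun w => (`|th + y w| <= lam)%R%:R : R).
    rewrite (_ : (fun w => _) = fun w => 1 - (lam < `|th + y w|)%R%:R); last first.
      by apply/funext => w; case: leP => _; rewrite /= ?subr0 ?subrr.
    by apply: measurable_funB; [exact: measurable_cst|exact: measurable_ind_gt].
  apply: (proj2 (Ex_dct _ _ (intg_cst P (`|s2| + L)) _ _)).
  - by move=> n; exact: measurable_funM.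
  - exact: measurable_funM.
  - move=> n w; rewrite normrM.
    have := tauL w; have : `|tau w| <= `|s2| + `|s2 - tau w|.
      by rewrite -{1}[tau w](subKr s2) ; apply: ler_normB.
    have := h'1 n (y w); have := normr_ge0 (tau w); nra.
  (* The derivatives tend to the indicator away from [|th + y| = lam], two values of [y] that are
     null since the law has no atoms. *)
  - exists ([set w | y w = lam - th] `|` [set w | y w = - lam - th]); split.
    + by apply: measurableU; rewrite -[X in measurable X]setTI; apply: (my measurableT (measurable_set1 _)).
    + have mm c : measurable [set w | y w = c].
        by rewrite -[X in measurable X]setTI; apply: (my measurableT (measurable_set1 _)).
      apply/eqP; rewrite eq_le measure_ge0 andbT.
      apply: le_trans (measureU2 _ _ _) _; [exact: mm|exact: mm|].
      rewrite [X in (X + _)%E]atomless [X in (_ + X)%E]atomless; by rewrite adde0.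
    + move=> w /= Hw; apply: contrapT => /not_orP[n1 n2]; apply: Hw.
      have xl : `|th + y w| != lam.
        apply/eqP; have [x0|x0] := leP 0 (th + y w).
          by rewrite ger0_norm // => xl; apply: n1; lra.
        by rewrite ltr0_norm // => xl; apply: n2; lra.
      apply: cvgMr; rewrite -(sg_clip l0 xl).
      by apply: cvgMl; apply: cvgB; exact: dsabs_cvg.
move: H1; rewrite (_ : (fun n => Ex _) = fun n => Ex (fun w => tau w * h' n (y w))).
  by move=> H1; exact: (cvg_unique _ H1 H2).
by apply/funext => n; exact: E.
Qed.

End stein_one_dim.

(** * The oracle inequality *)

Section soft_thresholding.
Context {R : realType}.

Lemma soft_clip (lam x : R) : 0 <= lam ->
  Num.sg x * Num.max (`|x| - lam) 0 = x - clip lam x.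
Proof.
move=> l0; rewrite /clip; have [x0|x0|->] := ltgtP x 0.
- rewrite ltr0_sg // ltr0_norm //; have [h|h] := leP x lam; last lra.
  by have [h1|h1] := leP (- x - lam) 0; have [h2|h2] := leP (- lam) x; lra.
- rewrite gtr0_sg // gtr0_norm //.
  have [h1|h1] := leP (x - lam) 0; have [h|h] := leP x lam; try lra.
    by have [h2|h2] := leP (- lam) x; lra.
  by have [h2|h2] := leP (- lam) lam; lra.
- rewrite sgr0 mul0r; have [h|h] := leP 0 lam; last lra.
  by have [h2|h2] := leP (- lam) 0; lra.
Qed.

Lemma clip_sqr (lam x : R) : 0 <= lam -> clip lam x ^+ 2 = Num.min (x ^+ 2) (lam ^+ 2).
Proof.
move=> l0; rewrite /clip; have [h|h] := leP x lam.
  have [h1|h1] := leP (- lam) x; last first.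
    by rewrite sqrrN; symmetry; apply/min_idPr; nra.
  by symmetry; apply/min_idPl; nra.
have [h1|h1] := leP (- lam) lam; last lra.
by symmetry; apply/min_idPr; nra.
Qed.

Lemma clip_norm (lam x : R) : 0 <= lam -> `|clip lam x| <= lam.
Proof. by move=> l0; have := @clip_lip R 0 lam x (lexx _) l0; rewrite clip0 !subr0. Qed.

(** Thresholding moves [x] by at most [lam], so it stays above [A + 1] in absolute value, at
    distance at least 1 from [th]. This is the origin of the shift [A + 1] in [M]. *)
Lemma residual_gt1 (lam x th A : R) : 0 <= lam -> `|th| <= A -> lam + A + 1 < `|x| ->
  1 <= (x - clip lam x - th) ^+ 2.
Proof.
move=> l0 tA lx; have := clip_norm x l0 => cl.
have h : 1 <= `|x - clip lam x - th|.
  have := lerB_dist x (clip lam x); have := lerB_dist (x - clip lam x) th; lra.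
by rewrite -(real_normK (num_real (x - clip lam x - th))); nra.
Qed.

End soft_thresholding.

Section oracle.
Context {R : realType} {d : nat} {dO : measure_display} {O : measurableType dO} (P : probability O R).
Local Notation intg f := (P.-integrable setT (EFin \o (f : O -> R))).
Local Notation Ex := (Ex P).
Local Notation ind b := ((nat_of_bool b)%:R : R).
Variables (theta : 'rV[R]_d) (Y tau : 'I_d -> O -> R) (sigma L C A m Lam : R) (K : nat).
Let th i := theta ord0 i.
Hypothesis d_gt0 : (0 < d)%N.
Hypothesis dK : (d <= 2 ^ K)%N.
Hypothesis mY : forall i, measurable_fun setT (Y i).
Hypothesis indY : forall i j, i != j -> forall A B : set R, measurable A -> measurable B ->
     P (Y i @^-1` A `&` Y j @^-1` B) = (P (Y i @^-1` A) * P (Y j @^-1` B))%E.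
Hypothesis atomless : forall i (c : R), P [set w | Y i w = c] = 0%E.
Hypothesis iY2 : forall i, intg (fun w => Y i w ^+ 2).
Hypothesis EY2 : forall i, Ex (fun w => Y i w ^+ 2) = sigma ^+ 2.
Hypothesis mtau : forall i, measurable_fun setT (tau i).
Hypothesis tauL : forall i w, `|sigma ^+ 2 - tau i w| <= L.
Hypothesis C0 : 0 < C.
Hypothesis iexp : forall i, intg (fun w => expR (Y i w ^+ 2 / (2 * C))).
Hypothesis stein : forall i (h h' : R -> R), (forall t, is_derive t (1 : R) h (h' t)) -> continuous h' ->
  intg (fun w => h (Y i w) ^+ 2) -> intg (fun w => h' (Y i w) ^+ 2) ->
  Ex (fun w => Y i w * h (Y i w)) = Ex (fun w => tau i w * h' (Y i w)).
Hypothesis thA : forall i, `|th i| <= A.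
Hypothesis Lam0 : 0 <= Lam.

Definition tailp i (t : R) := Ex (fun w => ind (t < `|th i + Y i w|)%R).

Hypothesis m_ge0 : 0 <= m.
Hypothesis m_lt : 2 * m < 1.
Hypothesis Lm : forall i lam, 0 <= lam <= Lam -> L * tailp i lam <= m * tailp i (lam + A + 1).

Let X w : 'rV[R]_d := theta + \row_i Y i w.

Let XE w i : X w ord0 i = th i + Y i w.
Proof. by rewrite !mxE. Qed.

Definition loss lam w : R := \sum_i (Y i w - clip lam (th i + Y i w)) ^+ 2.

Lemma lossE lam w : 0 <= lam -> sqnorm (soft lam (X w) - theta) = loss lam w.
Proof.
move=> l0; apply: eq_bigr => i _; rewrite [in LHS]mxE [soft _ _ _ _]mxE XE soft_clip //.
by rewrite [(- theta) _ _]mxE -/(th i); congr (_ ^+ 2); ring.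
Qed.

(** The squares [clip^2 = min (X^2, lam^2)] cancel. Only the cross terms and the count depend on the
    threshold in a random way. *)
Lemma SURE_lossE lam w : 0 <= lam ->
  loss lam w - SURE sigma lam (X w) = \sum_i (Y i w ^+ 2 - 2 * (Y i w * clip lam (th i + Y i w))
    + sigma ^+ 2 - 2 * sigma ^+ 2 * ind (lam < `|th i + Y i w|)%R).
Proof.
move=> l0; rewrite /SURE.
have -> : #|[set i : 'I_d | `|X w ord0 i| <= lam]|%:R = \sum_i (1 - ind (lam < `|th i + Y i w|)%R).
  rewrite -sum1_card natr_sum big_mkcond /=; apply: eq_bigr => i _.
  have -> : (i \in in_set [set i : 'I_d | `|X w ord0 i| <= lam]) = (`|th i + Y i w| <= lam).
    by rewrite -XE; exact: asboolb.
  by case: (leP `|th i + Y i w|) => _ /=; rewrite ?subr0 ?subrr.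
rewrite -[d%:R]/(d%:R : R) -[d in d%:R]card_ord -sum1_card natr_sum mulr_suml mulr_sumr.
rewrite /loss -!big_split /= -sumrB -sumrB; apply: eq_bigr => i _.
by rewrite XE -clip_sqr //; ring.
Qed.

Let mX i : measurable_fun setT (fun w => th i + Y i w).
Proof. by apply: measurable_funD => //; exact: measurable_cst. Qed.

Let mN i : measurable_fun setT (fun w => `|th i + Y i w|).
Proof. by apply: measurableT_comp => //; exact: mX. Qed.

Let mI i t : measurable_fun setT (fun w => ind (t < `|th i + Y i w|)%R).
Proof. by apply: measurable_ind_gt; exact: mN. Qed.

Let iI i t : intg (fun w => ind (t < `|th i + Y i w|)%R).
Proof. exact: intg_ind. Qed.

Let L0 : 0 <= L.
Proof.
have [i _] : exists i : 'I_d, true by exists (Ordinal d_gt0).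
have [w _] : exists w : O, true by exists point.
exact: le_trans (normr_ge0 _) (tauL i w).
Qed.

Definition clip_mean i lam := Ex (fun w => Y i w * clip lam (th i + Y i w)).

(** Clipping gives [E[tau 1(|X| <= lam)]], and the identity function gives [E tau = sigma^2].
    Subtracting moves the indicator to [|X| > lam]; a direct comparison with [sigma^2] would only
    give [L * P(|X| <= lam)]. *)
Lemma stein_bias i lam : 0 <= lam ->
  `|sigma ^+ 2 * (1 - tailp i lam) - clip_mean i lam| <= L * tailp i lam.
Proof.
move=> l0.
have itau : intg (tau i).
  have : intg (fun w => tau i w * 1).
    by apply: (intg_tau (mtau i) (tauL i)); [exact: measurable_cst|exact: intg_cst].
  by under eq_fun do rewrite mulr1.
have itauI : intg (fun w => tau i w * ind (lam < `|th i + Y i w|)%R).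
  exact: (intg_tau (mtau i) (tauL i) (mI i lam) (iI i lam)).
have E1 : clip_mean i lam = sigma ^+ 2 - Ex (fun w => tau i w * ind (lam < `|th i + Y i w|)%R).
  rewrite /clip_mean (stein_clip (mY i) (mtau i) (tauL i) C0 (iexp i) (@stein i) (atomless i) (th i) l0 L0).
  rewrite -(EY2 i) (stein_id (@stein i) (iY2 i)) -ExB //.
  apply: eq_Ex => w; case: (leP `|th i + Y i w|) => _ /=; ring.
have -> : sigma ^+ 2 * (1 - tailp i lam) - clip_mean i lam =
    - Ex (fun w => (sigma ^+ 2 - tau i w) * ind (lam < `|th i + Y i w|)%R).
  rewrite (eq_Ex P (g := fun w => sigma ^+ 2 * ind (lam < `|th i + Y i w|)%R - tau i w * ind (lam < `|th i + Y i w|)%R)); last first.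
    by move=> w; ring.
  by rewrite ExB ?ExZ // ?E1 -/(tailp i lam); [ring|exact: intgZ].
rewrite normrN /tailp -ExZ //; apply: Ex_abs_le.
- apply: (intg_le _ (intgZ L (iI i lam))).
    by apply: measurable_funM => //; apply: measurable_funB => //; exact: measurable_cst.
  by move=> w; rewrite normrM [X in _ * X]ger0_norm // ler_wpM2r.
- exact: intgZ.
- by move=> w; rewrite normrM [X in _ * X]ger0_norm // ler_wpM2r.
Qed.

Lemma count_le_loss lam w : 0 <= lam ->
  \sum_i ind (lam + A + 1 < `|th i + Y i w|)%R <= loss lam w.
Proof.
move=> l0; apply: ler_sum => i _; case: ltP => [h|_] /=; last exact: sqr_ge0.
have := residual_gt1 l0 (thA i) h.
by rewrite (_ : th i + Y i w - clip lam (th i + Y i w) - th i = Y i w - clip lam (th i + Y i w)); [|ring].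
Qed.

Lemma measurable_loss (lh : O -> R) : measurable_fun setT lh -> measurable_fun setT (fun w => loss (lh w) w).
Proof.
move=> mlh; apply: measurable_sum => i; apply: measurable_funX; apply: measurable_funB => //.
apply: measurable_maxr; first exact: measurableT_comp.
by apply: measurable_minr.
Qed.

Lemma intg_loss (lh : O -> R) : measurable_fun setT lh -> (forall w, 0 <= lh w <= Lam) ->
  intg (fun w => loss (lh w) w).
Proof.
move=> mlh lhI.
have ib : intg (fun w => \sum_i (2 * Y i w ^+ 2 + 2 * Lam ^+ 2)).
  by apply: intg_sum => i _; apply: intgD; [exact: intgZ|exact: intg_cst].
apply: (intg_le (measurable_loss mlh) ib) => w.
rewrite ger0_norm; last by apply: sumr_ge0 => i _; exact: sqr_ge0.
apply: ler_sum => i _; have /andP[h0 h1] := lhI w.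
have := clip_norm (th i + Y i w) h0; move: (clip _ _) => c cl.
have cL : c ^+ 2 <= Lam ^+ 2.
  by rewrite -(real_normK (num_real c)); apply: lerXn2r; rewrite ?nnegrE //; lra.
have := sqr_ge0 (Y i w + c); lra.
Qed.

(** Here [m] stands for [L M]. Up to the common sum of [Y_i^2 - sigma^2], loss and SURE differ at
    each threshold by at most [2 D1 + 2 sigma^2 D2 + 2 m (loss + D2)]. Using this at [lh] and at
    [lam] doubles the noise, and [m < 1/2] puts [4 m D2] below [4 D2]. *)
Lemma oracle_pointwise :
  exists D1 D2 : O -> R, [/\ intg D1, intg D2, Ex D1 <= 3 * Lam * `|sigma| * Num.sqrt d%:R,
    Ex D2 <= K.+1%:R * Num.sqrt d%:R + 1 &
    forall w lam lh, 0 <= lam <= Lam -> 0 <= lh <= Lam ->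
      SURE sigma lh (X w) <= SURE sigma lam (X w) ->
      (1 - 2 * m) * loss lh w <= (1 + 2 * m) * loss lam w + 4 * D1 w + (4 * sigma ^+ 2 + 4) * D2 w].
Proof.
have A0 : 0 <= A by apply: le_trans (thA (Ordinal d_gt0)).
have [D1 [iD1 ED1 HD1]] := @clip_deviation R dO O P d Y mY indY th `|sigma| Lam d_gt0 Lam0 (normr_ge0 _) iY2
  (fun i => ltac:(by rewrite EY2 real_normK // num_real)).
have mZ i : measurable_fun setT (fun y : R => `|th i + y|).
  by apply: measurableT_comp => //; apply: measurable_funD => //; exact: measurable_cst.
have at2 i (c : R) : 0 <= c -> P [set w | `|th i + Y i w| = c] = 0%E.
  move=> c0.
  have mm b : measurable [set w | Y i w = b].
    by rewrite -[X in measurable X]setTI; apply: (mY i measurableT (measurable_set1 _)).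
  have -> : [set w | `|th i + Y i w| = c] = [set w | Y i w = c - th i] `|` [set w | Y i w = - c - th i].
    apply/seteqP; split => [w /= h|w /= [->|->]].
    - have [x0|x0] := leP 0 (th i + Y i w).
        by left; rewrite ger0_norm // in h; lra.
      by right; rewrite ltr0_norm // in h; lra.
    - by rewrite (_ : th i + _ = c) ?ger0_norm //; ring.
    - by rewrite (_ : th i + _ = - c) ?normrN ?ger0_norm //; ring.
  apply/eqP; rewrite eq_le measure_ge0 andbT.
  apply: le_trans (measureU2 _ _ _) _; [exact: mm|exact: mm|].
  by rewrite [X in (X + _)%E]atomless [X in (_ + X)%E]atomless adde0.
(* The range reaches [Lam + A + 1] because counts are compared at [t] and at [t + A + 1]. *)
have [D2 [iD2 ED2 HD2]] := @uniform_tail_deviation R dO O P d Y mY indY (fun i y => `|th i + y|) mZ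
  (fun i y => normr_ge0 _) at2 K (Lam + A + 1) d_gt0 dK.
exists D1, D2; split => // w lam lh /andP[l0 lL] /andP[h0 hL] HS.
have m0 := m_ge0; have m1 := m_lt; have LA := Lam0.
have key t : 0 <= t <= Lam ->
   `|loss t w - SURE sigma t (X w) - \sum_i (Y i w ^+ 2 - sigma ^+ 2)| <=
   2 * D1 w + 2 * sigma ^+ 2 * D2 w + 2 * (m * (loss t w + D2 w)).
  move=> /andP[t0 tL]; rewrite SURE_lossE // -sumrB.
  have h1 := HD1 w t ltac:(by rewrite t0 tL).
  have h2 := HD2 w t ltac:(by rewrite t0 /=; lra).
  have h3 := HD2 w (t + A + 1) ltac:(by apply/andP; split; lra).
  set S1 := \sum_i _ in h1; set S2 := \sum_i _ in h2; set S3 := \sum_i _ in h3.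
  pose b i := sigma ^+ 2 * (1 - tailp i t) - clip_mean i t.
  have bL : `|\sum_i b i| <= m * (loss t w + D2 w).
    apply: le_trans (ler_norm_sum _ _ _) _.
    apply: (@le_trans _ _ (\sum_i m * tailp i (t + A + 1))).
      apply: ler_sum => i _; apply: le_trans (stein_bias i t0) _.
      by apply: Lm; rewrite t0 tL.
    rewrite -mulr_sumr; apply: ler_wpM2l => //.
    (* The expected count is exchanged for the actual one, at cost [D2], so that the loss of this
       very outcome can absorb it. *)
    have : \sum_i tailp i (t + A + 1) = \sum_i ind (t + A + 1 < `|th i + Y i w|)%R - S3.
      by rewrite /S3 sumrB subKr.
    have := count_le_loss w t0; move: h3; rewrite ler_norml => /andP[h3 _] h4 ->; lra.
  have -> : \sum_i (Y i w ^+ 2 - 2 * (Y i w * clip t (th i + Y i w)) + sigma ^+ 2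
       - 2 * sigma ^+ 2 * ind (t < `|th i + Y i w|)%R - (Y i w ^+ 2 - sigma ^+ 2)) =
     - 2 * S1 - 2 * sigma ^+ 2 * S2 + 2 * \sum_i b i.
    rewrite /S1 /S2 !mulr_sumr -sumrB -big_split /=; apply: eq_bigr => i _.
    by rewrite /b /clip_mean /tailp; ring.
  have hs : `|2 * sigma ^+ 2 * S2| <= 2 * sigma ^+ 2 * D2 w.
    by rewrite normrM ger0_norm ?ler_wpM2l // mulr_ge0 // sqr_ge0.
  move: h1 hs bL; rewrite !ler_norml => /andP[h11 h12] /andP[h21 h22] /andP[h31 h32].
  by apply/andP; split; lra.
have k1 := key lam ltac:(by rewrite l0 lL).
have k2 := key lh ltac:(by rewrite h0 hL).
have D20 : 0 <= D2 w by apply: le_trans (normr_ge0 _) (HD2 w 0 ltac:(by rewrite lexx /=; lra)).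
move: k1 k2; rewrite !ler_norml => /andP[k11 k12] /andP[k21 k22].
have mD : m * D2 w <= 2^-1 * D2 w by apply: ler_wpM2r => //; lra.
lra.
Qed.

Lemma oracle_Ex (lh : O -> R) (lam : R) : measurable_fun setT lh -> (forall w, 0 <= lh w <= Lam) ->
  (forall w, SURE sigma (lh w) (X w) <= SURE sigma lam (X w)) -> 0 <= lam <= Lam ->
  (1 - 2 * m) * Ex (fun w => loss (lh w) w) <= (1 + 2 * m) * Ex (fun w => loss lam w)
   + 12 * Lam * `|sigma| * Num.sqrt d%:R + (4 * sigma ^+ 2 + 4) * (K.+1%:R * Num.sqrt d%:R + 1).
Proof.
move=> mlh lhI HS lI.
have [D1 [D2 [iD1 iD2 E1 E2 H]]] := oracle_pointwise.
have i1 := intg_loss mlh lhI.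
have i2 := intg_loss (measurable_cst lam) (fun=> lI).
have s2 := sqr_ge0 sigma.
have : Ex (fun w => (1 - 2 * m) * loss (lh w) w) <= Ex (fun w => (1 + 2 * m) * loss lam w + 4 * D1 w + (4 * sigma ^+ 2 + 4) * D2 w).
  apply: le_Ex; first exact: intgZ.
    by apply: intgD; [apply: intgD|]; exact: intgZ.
  by move=> w; apply: H.
rewrite ExZ // !ExD ?ExZ //; try (by apply: intgZ); last by apply: intgD; exact: intgZ.
have : (4 * sigma ^+ 2 + 4) * Ex D2 <= (4 * sigma ^+ 2 + 4) * (K.+1%:R * Num.sqrt d%:R + 1).
  by apply: ler_wpM2l => //; lra.
lra.
Qed.

Lemma sigma_bound : sigma ^+ 2 <= 2 * C + L.
Proof.
exact: (stein_variance_bound (mY (Ordinal d_gt0)) (mtau _) (tauL _) C0 (iexp _) (@stein _)).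
Qed.

End oracle.

(** * Coordinates without atoms and pairwise independence *)

Section null_hyperplane.
Context {R : realType} {d : nat}.

(** When coordinate [i] is integrated, the integrand lives on a single point. *)
Lemma Iit_hyperplane (s : seq 'I_d) (i : 'I_d) (c : R) (G : 'rV[R]_d -> \bar R) :
  i \in s -> (forall x : 'rV[R]_d, x ord0 i != c -> G x = 0%E) -> Iit s G = 0%E.
Proof.
elim: s G => // j s IH G; rewrite in_cons => ijs G0 /=.
have [ij|ij] := eqVneq i j; last first.
  move: ijs; rewrite (negPf ij) /= => is_.
  rewrite integral0_eq // => t _; apply: IH => // x xc /=; apply: G0.
  by rewrite upd_neq.
have z : forall s, Iit s (fun _ : 'rV[R]_d => 0%E : \bar R) = 0%E.
  by elim=> //= k s' IHs; rewrite integral0_eq // => t _; exact: IHs.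
rewrite (_ : (fun t => _) = ((fun t => Iit s (G \o upd j t)) \_ [set c])).
  by rewrite -integral_mkcond integral_set1.
apply/funext => t; rewrite patchE; case: ifPn => // /negP tc.
rewrite -[RHS](z s); congr Iit; apply/funext => x /=; apply: G0.
by rewrite ij upd_same; apply/eqP => tc'; apply: tc; rewrite inE.
Qed.

Lemma density_atomless {dO : measure_display} {O : measurableType dO} (P : probability O R)
  (Y : 'I_d -> O -> R) (phi : 'rV[R]_d -> R) :
  has_density P (fun w => \row_i Y i w) phi -> forall i c, P [set w | Y i w = c] = 0%E.
Proof.
move=> dens i c.
have mA : rv_measurable [set x : 'rV[R]_d | [set c] (x ord0 i)].
  by apply: sub_sigma_algebra; exists i, [set c]; split.
have := dens _ mA.
have [s [_ sT HG]] := @lebd_Iit R d.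
rewrite HG (@Iit_hyperplane s i c) //; last first.
  by move=> x /eqP xc; rewrite indicE memNset ?mulr0 // => -[].
move=> <-; congr (P _); apply/seteqP; split => w /=; rewrite mxE //.
Qed.

Lemma indep_coords_pair {dO : measure_display} {O : measurableType dO} (P : probability O R)
  (Y : 'I_d -> O -> R) : indep_coords P Y ->
  forall i j, i != j -> forall A B : set R, measurable A -> measurable B ->
     P (Y i @^-1` A `&` Y j @^-1` B) = (P (Y i @^-1` A) * P (Y j @^-1` B))%E.
Proof.
move=> ind i j ij A B mA mB.
have ji : j != i by rewrite eq_sym.
pose D k := if k == i then A else if k == j then B else setT.
have mD k : measurable (D k) by rewrite /D; case: ifP => // _; case: ifP.
have := ind D mD.
rewrite (bigD1 i) //= (bigD1 j) //= big1 ?mule1; last first.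
  move=> k /andP[ki kj]; rewrite /D (negPf ki) (negPf kj) -(@probability_setT _ _ _ P).
  by congr (P _); apply/seteqP; split.
rewrite /D eqxx (negPf ji) eqxx => <-; congr (P _).
apply/seteqP; split => [w [/= wA wB] k|w /= H].
  by case: eqP => [->//|_]; case: eqP => [->|].
by split; [have := H i; rewrite eqxx|have := H j; rewrite (negPf ji) eqxx].
Qed.

End null_hyperplane.

(** * The constant and the size of the remainder *)

Section numeric.
Context {R : realType}.

(** First term: [sqrt C <= C + 1] and [|sigma| <= 2C + 1] in [12 sqrt C |sigma|], doubled since
    [sqrt l <= 2 l^(3/2)] for [l >= 1/2]. Second: [4 sigma^2 + 4 <= 8C + 8], times 16 for the
    chaining depth and the [+ 1]. *)
Definition oracle_const (c : R) : R := 24 * ((c + 1) * (2 * c + 1)) + 16 * (8 * c + 8).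

Lemma oracle_const_gt0 c : 0 < c -> 0 < oracle_const c.
Proof. by move=> c0; rewrite /oracle_const; have := mulr_gt0 c0 c0; nra. Qed.

Lemma ln2_ge : (2^-1 : R) <= ln 2.
Proof.
have : ln (2^-1 : R) <= - 2^-1.
  have -> : (2^-1 : R) = 1 + - 2^-1 by lra.
  apply: le_trans (le_ln1Dx _) _; lra.
rewrite lnV ?posrE //; lra.
Qed.

Lemma remainder_le (d : nat) (C s : R) : (1 < d)%N -> 0 < C -> 0 <= s -> s ^+ 2 <= 2 * C + 2^-1 ->
  12 * Num.sqrt (C * ln d%:R) * s * Num.sqrt d%:R +
   (4 * s ^+ 2 + 4) * ((trunc_log 2 d).+1.+1%:R * Num.sqrt d%:R + 1)
  <= oracle_const C * Num.sqrt (d%:R * ln d%:R ^+ 3).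
Proof.
move=> d1 C0 s0 s2.
have d2 : (2 : R) <= d%:R by rewrite ler_nat.
have dp : (0 : R) < d%:R by lra.
set l : R := ln d%:R.
have l2 := ln2_ge.
have ll : ln 2 <= l by rewrite /l ler_ln ?posrE.
have l0 : 0 <= l by lra.
set S : R := Num.sqrt d%:R.
have S1 : 1 <= S by rewrite -[leLHS]sqrtr1 ler_sqrt // ler1n ltnW.
set q := Num.sqrt l.
have qq : q ^+ 2 = l by rewrite sqr_sqrtr.
have q0 : 0 <= q by exact: sqrtr_ge0.
have q12 : 2^-1 <= q by rewrite leNgt; apply/negP => qlt; nra.
have sC : Num.sqrt C <= C + 1.
  have c0 := sqrtr_ge0 C; have : Num.sqrt C ^+ 2 = C by rewrite sqr_sqrtr // ltW.
  by move=> h; nra.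
have ss : s <= 2 * C + 1 by rewrite leNgt; apply/negP => h; nra.
have -> : Num.sqrt (C * l) = Num.sqrt C * q by rewrite sqrtrM // ltW.
have -> : Num.sqrt (d%:R * l ^+ 3) = S * (l * q).
  rewrite sqrtrM ?ler0n // exprS mulrC [l * _]mulrC sqrtrM ?sqr_ge0 // sqrtr_sqr ger0_norm //.
  by rewrite [in RHS]mulrC.
(* With [ln 2 >= 1/2] the logarithm in base 2 is at most [2 l], and [2 <= 4 l]. *)
have K1 : ((trunc_log 2 d).+1.+1%:R : R) <= 6 * l.
  have : (2 ^ trunc_log 2 d <= d)%N by apply: trunc_logP => //; exact: ltnW.
  rewrite -(ler_nat R) natrX => h.
  have : (trunc_log 2 d)%:R * ln 2 <= l.
    rewrite mulr_natl -lnXn //.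
    by rewrite ler_ln ?posrE // exprn_gt0.
  rewrite -(addn2 (trunc_log 2 d)) natrD => h2; set k := (trunc_log 2 d)%:R in h2 *.
  have k0 : 0 <= k :> R by rewrite ler0n.
  nra.
set z := S * (l * q).
have lq : 2^-1 * 2^-1 <= l * q by apply: ler_pM => //; lra.
have z0 : 0 <= z by rewrite /z !mulr_ge0 //; lra.
have zS : q * S <= 2 * z.
  rewrite /z; have : 0 <= q * S * (2 * l - 1) by rewrite !mulr_ge0 //; lra.
  lra.
have t1 : 12 * (Num.sqrt C * q) * s * S <= 24 * ((C + 1) * (2 * C + 1)) * z.
  have cs : Num.sqrt C * s <= (C + 1) * (2 * C + 1) by apply: ler_pM => //; exact: sqrtr_ge0.
  have : Num.sqrt C * s * (q * S) <= (C + 1) * (2 * C + 1) * (2 * z).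
    apply: ler_pM => //; first by rewrite mulr_ge0 // sqrtr_ge0.
    by rewrite mulr_ge0 //; lra.
  lra.
have t2 : (trunc_log 2 d).+1.+1%:R * S + 1 <= 16 * z.
  have a1 : (trunc_log 2 d).+1.+1%:R * S <= 12 * z.
    apply: (@le_trans _ _ (6 * l * S)); first by apply: ler_wpM2r => //; lra.
    rewrite /z; have : 0 <= S * l * (2 * q - 1) by rewrite !mulr_ge0 //; lra.
    lra.
  have a2 : 1 <= 4 * z.
    rewrite /z; have : 1 * (2^-1 * 2^-1) <= S * (l * q) by apply: ler_pM => //; lra.
    lra.
  lra.
have t3 : (4 * s ^+ 2 + 4) * ((trunc_log 2 d).+1.+1%:R * S + 1) <= (8 * C + 8) * (16 * z).
  apply: ler_pM => //; try lra.
    by have := sqr_ge0 s; lra.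
  by rewrite addr_ge0 // mulr_ge0 //; lra.
rewrite /oracle_const; lra.
Qed.

End numeric.

(** * From the assumptions on the noise vector to the oracle inequality *)

Section row_vector_oracle.
Context {R : realType} {d' : nat} {dO : measure_display} {O : measurableType dO} (P : probability O R).
Let d := d'.+1.
Local Notation intg f := (P.-integrable setT (EFin \o (f : O -> R))).
Local Notation Ex := (Ex P).
Local Notation ind b := ((nat_of_bool b)%:R : R).
Variables (theta : 'rV[R]_d) (Y : 'I_d -> O -> R) (sigma : R) (phi : 'rV[R]_d -> R).
Hypothesis mY : forall i, measurable_fun setT (Y i).
Hypothesis iY2 : forall i, intg (fun w => (Y i w ^+ 2)).
Hypothesis covY : forall i j, (\int[P]_w (Y i w * Y j w)%:E = (sigma ^+ 2 * (i == j)%:R)%:E)%E.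
Hypothesis indY : indep_coords P Y.
Hypothesis densY : has_density P (fun w => \row_i Y i w) phi.
Let Yv := fun w => \row_i Y i w.
Let X := fun w => theta + Yv w.
Variables (T : 'rV[R]_d -> 'M[R]_d) (L a C : R).
Hypothesis steinT : stein_kernel P Yv T.
Hypothesis TL : {ae P, forall w, forall i, `|sigma ^+ 2 - T (Yv w) i i| <= L}.
Hypothesis a0 : 0 < a.
Hypothesis C0 : 0 < C.
Hypothesis tails : forall t : R, 0 < t ->
  (P [set w | (t <= enorm (Yv w))%R] <= (a * expR (- (t ^+ 2) / C))%:E)%E.
Let Lam := Num.sqrt (C * ln d%:R).
Let I := [set lam : R | 0 <= lam <= Lam].
Let A := \big[Num.max/0]_(i < d) `|theta ord0 i|.
Let M := ereal_sup [set r | exists lam (i : 'I_d), I lam /\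
               r = ratioE (fine (P [set w | (lam < `|X w ord0 i|)%R]))
                          (fine (P [set w | (lam + A + 1 < `|X w ord0 i|)%R]))].
Hypothesis LM : (L%:E * M < (1 / 2)%:E)%E.

(** An almost sure property holds at some outcome because [P] is not zero, and a coordinate exists
    because the dimension is a successor. *)
Lemma kernel_bound_ge0 : 0 <= L.
Proof.
have P0 : (0 < P setT)%E by rewrite probability_setT.
have pf := ae_properfilter_algebraOfSetsType P0.
have [w Hw] := filter_ex TL.
exact: le_trans (normr_ge0 _) (Hw ord0).
Qed.

Let mabs i : measurable_fun setT (fun w => `|theta ord0 i + Y i w|).
Proof. by apply: measurableT_comp => //; apply: measurable_funD. Qed.

Let intg_ind_abs i t : intg (fun w => ind (t < `|theta ord0 i + Y i w|)%R).
Proof.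
apply: (@intg_bounded _ _ _ _ _ 1); last by move=> w; rewrite ger0_norm ?ler0n // lern1 leq_b1.
exact: measurable_ind_gt.
Qed.

Let XE w i : X w ord0 i = theta ord0 i + Y i w.
Proof. by rewrite /X /Yv !mxE. Qed.

Lemma tailpE i t : tailp P theta Y i t = fine (P [set w | (t < `|X w ord0 i|)%R]).
Proof.
have mX : measurable_fun setT (fun w => `|theta ord0 i + Y i w|).
  by apply: measurableT_comp => //; apply: measurable_funD.
have mA : measurable [set w | (t < `|X w ord0 i|)%R].
  have := mX measurableT `]t, +oo[%classic (measurable_itv _).
  rewrite setTI; congr measurable; apply/seteqP; split=> w /=; rewrite in_itv /= andbT XE //.
rewrite /tailp -/(prob P _) -(prob_indic P mA); apply: eq_Ex => w.
by rewrite indicE -XE; congr (_ %:R); congr nat_of_bool; symmetry; exact: asboolb.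
Qed.

Lemma ratio_ge1 (num den : R) : 0 <= den -> den <= num -> (1%:E <= ratioE num den)%E.
Proof.
move=> den0 dn; rewrite /ratioE; case: eqP => [_|/eqP dz]; first exact: leey.
have dp : 0 < den by rewrite lt_neqAle eq_sym dz.
by rewrite lee_fin ler_pdivlMr // mul1r.
Qed.

Let A0 : 0 <= A. Proof. exact: bigmax_ge_id. Qed.

Let Lam0 : 0 <= Lam. Proof. exact: sqrtr_ge0. Qed.

Let thA i : `|theta ord0 i| <= A.
Proof. by rewrite /A (bigD1 i) //= le_max lexx. Qed.

Let tailp_ge0 i t : 0 <= tailp P theta Y i t.
Proof. by apply: Ex_ge0 => w; rewrite ler0n. Qed.

Let tailp_le i t : 0 <= t -> tailp P theta Y i (t + A + 1) <= tailp P theta Y i t.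
Proof.
move=> t0; apply: le_Ex => [||w].
- apply: intg_ind_abs.
- apply: intg_ind_abs.
rewrite ler_nat; case: (ltP (t + A + 1)) => //= h.
suff -> : (t < `|theta ord0 i + Y i w|) by [].
by apply: le_lt_trans h; have := A0; lra.
Qed.

(** If [L > 0], then [L M < 1/2] forces [M] to be finite, which excludes vanishing denominators and
    lets the ratios be cleared. Since the probability in the denominator is the smaller one,
    [M >= 1], so [L <= 1/2]. *)
Lemma bias_factor : exists m : R, [/\ 0 <= m, 2 * m < 1, (L%:E * M = m%:E)%E, L <= 2^-1 &
  forall i lam, 0 <= lam <= Lam -> L * tailp P theta Y i lam <= m * tailp P theta Y i (lam + A + 1)].
Proof.
have := kernel_bound_ge0; rewrite le_eqVlt => /predU1P[L0|L0].
  (* For [L = 0] the supremum [M] may be infinite; its product with 0 is 0. *)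
  exists 0; rewrite -L0 mul0e mulr0; split => //.
  by move=> i lam _; rewrite !mul0r.
have M1 : (1%:E <= M)%E.
  apply: le_trans (ratio_ge1 (tailp_ge0 ord0 (0 + A + 1)) (tailp_le ord0 (lexx 0))) _.
  apply: ereal_sup_ubound; exists 0, ord0; split; first by rewrite /I /= lexx Lam0.
  by rewrite !tailpE.
have ub i lam : 0 <= lam <= Lam -> (ratioE (tailp P theta Y i lam) (tailp P theta Y i (lam + A + 1)) <= M)%E.
  by move=> h; apply: ereal_sup_ubound; exists lam, i; split => //; rewrite !tailpE.
move: M1 ub LM; case: M => [r| |]; last by [].
  rewrite lee_fin => r1 ub; rewrite -EFinM lte_fin => Lr.
  have LLr : L <= L * r by rewrite ler_peMr // ltW.
  exists (L * r); split => //; try lra.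
  move=> i lam h; have := ub i lam h; rewrite /ratioE; case: eqP => // /eqP dz.
  have dp : 0 < tailp P theta Y i (lam + A + 1) by rewrite lt_neqAle eq_sym dz tailp_ge0.
  by rewrite lee_fin ler_pdivrMr // => q; rewrite -mulrA; apply: ler_wpM2l => //; exact: ltW.
by move=> _ _; rewrite gt0_muley // lte_fin.
Qed.

(** With [|Y_i| <= ||Y||], dividing the square by [2C] instead of [C] gives the tail [a e^(-2s)]
    that [exp_moment] asks for. *)
Lemma exp_square_integrable i : intg (fun w => expR (Y i w ^+ 2 / (2 * C))).
Proof.
have C2 : 0 < 2 * C by rewrite mulr_gt0.
apply: (@exp_moment _ _ _ P (fun w => Y i w ^+ 2 / (2 * C)) a).
- by apply: measurable_funM => //; exact: measurable_funX.
- by move=> w; rewrite divr_ge0 ?sqr_ge0 // ltW.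
- exact: ltW.
move=> s s0.
have t0 : 0 < Num.sqrt (2 * C * s) by rewrite sqrtr_gt0 mulr_gt0.
have ge0 : 0 <= 2 * C * s by apply: ltW; rewrite mulr_gt0.
have := tails t0; rewrite sqr_sqrtr //.
have -> : - (2 * C * s) / C = - 2 * s.
  by field; exact: lt0r_neq0.
apply: le_trans; apply: le_measure; rewrite ?inE.
- have := measurable_funX 2 (mY i); move=> /(measurable_funM (@measurable_cst _ _ _ _ setT (2 * C)^-1)).
  move=> /(_ measurableT `[s, +oo[%classic (measurable_itv _)).
  rewrite setTI; congr measurable; apply/seteqP; split=> w /=; rewrite in_itv /= andbT mulrC //.
- have mYv : measurable_fun setT (Yv : O -> Vsp R d).
    by apply: measurable_fun_rV => j; under eq_fun do rewrite mxE; exact: mY.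
  have := measurableT_comp (@measurable_enorm R d) mYv.
  move=> /(_ measurableT `[Num.sqrt (2 * C * s), +oo[%classic (measurable_itv _)).
  rewrite setTI; congr measurable; apply/seteqP; split=> w /=; rewrite in_itv /= andbT //.
move=> w /=; rewrite ler_pdivlMr // => h.
have := enorm_box (lexx (enorm (Yv w))) i; rewrite mxE; apply: le_trans.
by rewrite -sqrtr_sqr ler_sqrt ?sqr_ge0 // mulrC.
Qed.

Lemma oracle_inequality_pos (lamhat : O -> R) : measurable_fun setT lamhat ->
  (forall w, I (lamhat w) /\
       forall lam, I lam -> SURE sigma (lamhat w) (X w) <= SURE sigma lam (X w)) ->
    ((1%:E - 2%:E * (L%:E * M)) * \int[P]_w (sqnorm (soft (lamhat w) (X w) - theta))%:E
     <= (1%:E + 2%:E * (L%:E * M)) *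
          ereal_inf [set \int[P]_w (sqnorm (soft lam (X w) - theta))%:E | lam in I]
        + (oracle_const C * Num.sqrt (d%:R * ln d%:R ^+ 3))%:E)%E.
Proof.
move=> mlh Hlh; have [m [m0 m1 LMm L2 Lm]] := bias_factor; rewrite LMm.
(* Truncating the diagonal changes it on a null set only and makes the bound hold at every
   outcome. *)
pose tau i w := Num.max (sigma ^+ 2 - L) (Num.min (T (Yv w) i i) (sigma ^+ 2 + L)).
have L0 := kernel_bound_ge0.
have mYv : measurable_fun setT (Yv : O -> Vsp R d).
  by apply: measurable_fun_rV => j; under eq_fun do rewrite mxE; exact: mY.
have mT i : measurable_fun setT (fun w => T (Yv w) i i).
  have /rv_measurable_funE mTi := (proj1 steinT) i i.
  exact: (measurableT_comp mTi mYv).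
have mtau i : measurable_fun setT (tau i).
  by apply: measurable_maxr => //; apply: measurable_minr.
have tauL i w : `|sigma ^+ 2 - tau i w| <= L.
  rewrite /tau ler_norml; case: (leP (T (Yv w) i i) (sigma ^+ 2 + L)) => h1.
    by case: (leP (sigma ^+ 2 - L) (T (Yv w) i i)) => h2; apply/andP; split; lra.
  by case: (leP (sigma ^+ 2 - L) (sigma ^+ 2 + L)) => h2; apply/andP; split; lra.
have aetau i : {ae P, forall w, T (Yv w) i i = tau i w}.
  apply: filterS TL => w /(_ i); rewrite ler_norml => /andP[h1 h2].
  by rewrite /tau min_l ?max_r //; lra.
have EY2 i : Ex (fun w => Y i w ^+ 2) = sigma ^+ 2.
  have := covY i i; rewrite eqxx mulr1 /= => cv; apply: EFin_inj; rewrite -cv -ExE //.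
have st i (h h' : R -> R) : (forall t, is_derive t (1 : R) h (h' t)) -> continuous h' ->
  intg (fun w => h (Y i w) ^+ 2) -> intg (fun w => h' (Y i w) ^+ 2) ->
  Ex (fun w => Y i w * h (Y i w)) = Ex (fun w => tau i w * h' (Y i w)).
  move=> dh ch' ih ih'; rewrite (stein_coord steinT dh ch' ih ih') /Ex /Rintegral; congr fine.
  have mh' := measurableT_comp (continuous_measurable_fun ch') (mY i).
  apply: ae_eq_integral => //.
  - by apply/measurable_EFinP; apply: measurable_funM.
  - by apply/measurable_EFinP; apply: measurable_funM.
  by apply: filterS (aetau i) => w /= -> _.
have iexp := exp_square_integrable.
have dK : (d <= 2 ^ (trunc_log 2 d).+1)%N by apply: ltnW; exact: trunc_log_ltn.
have ato := density_atomless densY.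
have pair := indep_coords_pair indY.
have lossX (lam : R) w : 0 <= lam -> sqnorm (soft lam (X w) - theta) = loss theta Y lam w.
  exact: lossE.
have iloss (lh : O -> R) : measurable_fun setT lh -> (forall w, 0 <= lh w <= Lam) -> intg (fun w => loss theta Y (lh w) w).
  exact: (@intg_loss R d dO O P theta Y Lam).
have lhI w : 0 <= lamhat w <= Lam := (Hlh w).1.
have lh0 w : 0 <= lamhat w by have /andP[] := lhI w.
have -> : (\int[P]_w (sqnorm (soft (lamhat w) (X w) - theta))%:E)%E = (Ex (fun w => loss theta Y (lamhat w) w))%:E.
  by rewrite -ExE; [apply: eq_integral => w _; rewrite lossX|exact: iloss].
have lamE lam : I lam -> (\int[P]_w (sqnorm (soft lam (X w) - theta))%:E)%E = (Ex (fun w => loss theta Y lam w))%:E.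
  move=> Ilam; rewrite -ExE; last by apply: (iloss (fun=> lam)) => //; exact: measurable_cst.
  by apply: eq_integral => w _; rewrite lossX //; have /andP[] := Ilam.
set e := Ex _; set rem := oracle_const C * _.
have e0 : 0 <= e by apply: Ex_ge0 => w; apply: sumr_ge0 => i _; exact: sqr_ge0.
have rem0 : 0 <= rem by rewrite mulr_ge0 ?sqrtr_ge0 // ltW // oracle_const_gt0.
have main lam : I lam -> (1 - 2 * m) * e <= (1 + 2 * m) * Ex (fun w => loss theta Y lam w) + rem.
  move=> Ilam; have [d1|d1] := ltnP 1 d.
    have orc := @oracle_Ex R d dO O P theta Y tau sigma L C A m Lam (trunc_log 2 d).+1
      (ltn0Sn _) dK mY pair ato iY2 EY2 mtau tauL C0 iexp st thA Lam0 m0 m1 Lm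
      lamhat lam mlh lhI (fun w => (Hlh w).2 lam Ilam) Ilam.
    apply: le_trans orc _; rewrite -/e -addrA lerD2l.
    have s2 : `|sigma| ^+ 2 <= 2 * C + 2^-1.
      rewrite real_normK ?num_real //.
      have := @sigma_bound R d dO O P Y tau sigma L C (ltn0Sn _) mY mtau tauL C0 iexp st; lra.
    have := remainder_le d1 C0 (normr_ge0 sigma) s2; rewrite real_normK ?num_real //.
  (* In dimension 1, [ln d = 0]: the interval is the single point 0 and both losses coincide. *)
  have d1E : d = 1%N by apply/eqP; rewrite eqn_leq d1.
  have Lz : Lam = 0 by rewrite /Lam d1E ln1 mulr0 sqrtr0.
  have z l : 0 <= l <= Lam -> l = 0 by rewrite Lz => /andP[? ?]; lra.
  have -> : Ex (fun w => loss theta Y lam w) = e.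
    by apply: eq_Ex => w; rewrite (z lam Ilam) (z _ (lhI w)).
  have := mulr_ge0 m0 e0; lra.
have N0 : 0 < 1 + 2 * m by lra.
(* Solving the inequality for the risk at [lam] gives a finite lower bound of the infimum, whether
   or not the infimum is attained. *)
have inf_ge : ((((1 - 2 * m) * e - rem) / (1 + 2 * m))%:E <=
  ereal_inf [set \int[P]_w (sqnorm (soft lam (X w) - theta))%:E | lam in I])%E.
  apply: le_ereal_inf_tmp => _ [lam Ilam <-]; rewrite lamE // lee_fin ler_pdivrMr //.
  by have := main lam Ilam; lra.
rewrite (_ : (1%:E - 2%:E * m%:E)%E = (1 - 2 * m)%:E) // (_ : (1%:E + 2%:E * m%:E)%E = (1 + 2 * m)%:E) //.
rewrite -EFinM.
apply: (@le_trans _ _ ((1 + 2 * m)%:E * (((1 - 2 * m) * e - rem) / (1 + 2 * m))%:E + rem%:E)%E).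
  rewrite -!EFinM -EFinD lee_fin [_ * (_ / _)]mulrC divfK ?gt_eqF //; lra.
by apply: leeD2r; apply: lee_wpmul2l => //; rewrite lee_fin ltW.
Qed.

End row_vector_oracle.

(** In dimension 0 both risks are 0; otherwise this is the preceding case. *)
Lemma oracle_inequality (R : realType) (d : nat) (dO : measure_display) (O : measurableType dO)
    (P : probability O R) (theta : 'rV[R]_d) (Y : 'I_d -> O -> R)
    (sigma : R) (phi : 'rV[R]_d -> R) :
  (forall i, measurable_fun setT (Y i)) ->
  (forall i, P.-integrable setT (fun w => (Y i w ^+ 2)%:E)) ->
  (forall i j, (\int[P]_w (Y i w * Y j w)%:E = (sigma ^+ 2 * (i == j)%:R)%:E)%E) ->
  indep_coords P Y ->
  has_density P (fun w => \row_i Y i w) phi ->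
  let Yv := fun w => \row_i Y i w in
  let X := fun w => theta + Yv w in
  forall (T : 'rV[R]_d -> 'M[R]_d) (L a C : R),
    stein_kernel P Yv T ->
    {ae P, forall w, forall i, `|sigma ^+ 2 - T (Yv w) i i| <= L} ->
    0 < a -> 0 < C ->
    (forall t : R, 0 < t -> (P [set w | (t <= enorm (Yv w))%R] <= (a * expR (- (t ^+ 2) / C))%:E)%E) ->
    let I := [set lam : R | 0 <= lam <= Num.sqrt (C * ln d%:R)] in
    let A := \big[Num.max/0]_(i < d) `|theta ord0 i| in
    let M := ereal_sup [set r | exists lam (i : 'I_d), I lam /\
               r = ratioE (fine (P [set w | (lam < `|X w ord0 i|)%R]))
                          (fine (P [set w | (lam + A + 1 < `|X w ord0 i|)%R]))] in
    (L%:E * M < (1 / 2)%:E)%E ->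
    forall lamhat : O -> R, measurable_fun setT lamhat ->
    (forall w, I (lamhat w) /\
       forall lam, I lam -> SURE sigma (lamhat w) (X w) <= SURE sigma lam (X w)) ->
    ((1%:E - 2%:E * (L%:E * M)) * \int[P]_w (sqnorm (soft (lamhat w) (X w) - theta))%:E
     <= (1%:E + 2%:E * (L%:E * M)) *
          ereal_inf [set \int[P]_w (sqnorm (soft lam (X w) - theta))%:E | lam in I]
        + (oracle_const C * Num.sqrt (d%:R * ln d%:R ^+ 3))%:E)%E.
Proof.
case: d theta Y phi => [|d] theta Y phi mY iY2 covY indY dens Yv X T L a C stT TL a0 C0 tl I A M LM lh mlh Hlh;
  last exact: (oracle_inequality_pos mY iY2 covY indY dens stT TL a0 C0 tl LM mlh Hlh).
have z (f : O -> 'rV[R]_0) : (\int[P]_w (sqnorm (f w))%:E = 0)%E.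
  by rewrite integral0_eq // => w _; rewrite /sqnorm big_ord0.
have -> : [set \int[P]_w (sqnorm (soft lam (X w) - theta))%:E | lam in I]%E = [set 0%E].
  apply/seteqP; split => [_ [lam _ <-]|_ ->] /=; first exact: z.
  by exists 0; [rewrite /I /= lexx sqrtr_ge0|exact: z].
by rewrite ereal_inf1 z !mule0 add0e lee_fin mulr_ge0 ?sqrtr_ge0 // ltW // oracle_const_gt0.
Qed.

(** * Strongly log-concave densities *)

Section convex_continuous.
Context {R : realType} {d : nat}.
Variable phi : 'rV[R]_d -> R.
Hypothesis cvx : forall (x y : 'rV[R]_d) (t : R), 0 <= t <= 1 ->
  phi (t *: x + (1 - t) *: y) <= t * phi x + (1 - t) * phi y.

(** Free one coordinate at a time: a point of the cube is a convex combination of its projections on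
    the faces [x_i + 1] and [x_i - 1], where the induction hypothesis applies. *)
Lemma convex_bounded_cube (x : 'rV[R]_d) :
  exists B : R, forall y : 'rV[R]_d, (forall i, `|y ord0 i - x ord0 i| <= 1) -> phi y <= B.
Proof.
suff H (s : seq 'I_d) (z : 'rV[R]_d) : exists B : R, forall y : 'rV[R]_d,
    (forall i, i \notin s -> y ord0 i = z ord0 i) ->
    (forall i, i \in s -> `|y ord0 i - x ord0 i| <= 1) -> phi y <= B.
  have [B HB] := H (enum 'I_d) x; exists B => y Hy; apply: HB => i; first by rewrite mem_enum.
  by move=> _; exact: Hy.
elim: s z => [|i s IH] z.
  exists (phi z) => y Hy _; suff -> : y = z by [].
  by apply/rowP => k; rewrite Hy.
have [B1 H1] := IH (upd i (x ord0 i + 1) z); have [B2 H2] := IH (upd i (x ord0 i - 1) z).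
exists (Num.max B1 B2) => y Hy Hs.
have : `|y ord0 i - x ord0 i| <= 1 by apply: Hs; rewrite mem_head.
rewrite ler_norml => /andP[l1 l2].
pose t := (y ord0 i - x ord0 i + 1) / 2.
have t01 : 0 <= t <= 1 by apply/andP; rewrite /t; split; lra.
have yE : y = t *: upd i (x ord0 i + 1) y + (1 - t) *: upd i (x ord0 i - 1) y.
  apply/rowP => k; rewrite !mxE; case: eqP => [->|_]; last by ring.
  by rewrite /t; field.
have Hn (c : R) : `|c| <= 1 -> (forall k, k \notin s -> upd i (x ord0 i + c) y ord0 k = upd i (x ord0 i + c) z ord0 k) /\
   (forall k, k \in s -> `|upd i (x ord0 i + c) y ord0 k - x ord0 k| <= 1).
  move=> c1; split => k ks.
    have [->|ki] := eqVneq k i; first by rewrite !upd_same.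
    by rewrite !upd_neq // Hy // in_cons negb_or ki.
  have [->|ki] := eqVneq k i; first by rewrite upd_same addrAC subrr add0r.
  by rewrite upd_neq // Hs // in_cons ks orbT.
have [a1 a2] := Hn 1 (ltac:(by rewrite normr1)).
have [b1 b2] := Hn (-1) (ltac:(by rewrite normrN1)).
have := cvx (upd i (x ord0 i + 1) y) (upd i (x ord0 i - 1) y) t01; rewrite -yE => h.
have := H1 _ a1 a2; have := H2 _ b1 b2; move: t01 => /andP[t0 t1].
set p1 := phi (upd _ _ _) in h *; set p2 := phi (upd _ (_ - _) _) in h * => q2 q1.
have m1 : B1 <= Num.max B1 B2 by rewrite le_max lexx.
have m2 : B2 <= Num.max B1 B2 by rewrite le_max lexx orbT.
have : t * p1 <= t * Num.max B1 B2 by apply: ler_wpM2l => //; lra.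
have : (1 - t) * p2 <= (1 - t) * Num.max B1 B2 by apply: ler_wpM2l; lra.
lra.
Qed.

(** Write [y = x + e h] with [h] in the unit cube. Convexity between [x] and [x + h] bounds
    [phi y - phi x] above by [e (B - phi x)]; writing [x] as a combination of [y] and [x - h] gives
    the same bound from below. *)
Lemma convex_continuous : continuous phi.
Proof.
move=> x; have [B HB] := convex_bounded_cube x.
pose D := `|B - phi x| + 1.
have D0 : 0 < D by rewrite /D ltr_wpDl.
have key (e : R) (y : 'rV[R]_d) : 0 < e -> e <= 1 -> (forall i, `|y ord0 i - x ord0 i| <= e) -> `|phi y - phi x| <= e * D.
  move=> e0 e1 Hy.
  pose h := e^-1 *: (y - x).
  have hE : y - x = e *: h by rewrite scalerA divff ?scale1r // gt_eqF.
  have hb i : `|h ord0 i| <= 1.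
    rewrite !mxE normrM normfV (gtr0_norm e0) mulrC ler_pdivrMr // mul1r.
    exact: Hy.
  have B1 : phi (x + h) <= B by apply: HB => i; rewrite !mxE; have := hb i; rewrite !mxE; apply: le_trans; rewrite [x ord0 i + _]addrC addrK.
  have B2 : phi (x - h) <= B.
    by apply: HB => i; rewrite !mxE; have := hb i; rewrite !mxE; apply: le_trans; rewrite addrAC subrr add0r normrN.
  have u : phi y <= e * phi (x + h) + (1 - e) * phi x.
    have -> : y = e *: (x + h) + (1 - e) *: x.
      by rewrite scalerDr -hE scalerBl scale1r addrC addrA subrK addrC subrK.
    by apply: cvx; apply/andP; split; lra.
  have s0 : 0 < 1 + e by lra.
  have l : phi x <= (1 + e)^-1 * phi y + (1 - (1 + e)^-1) * phi (x - h).
    have s1 : (1 + e)^-1 <= 1 by rewrite invf_le1 //; lra.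
    have {1}-> : x = (1 + e)^-1 *: y + (1 - (1 + e)^-1) *: (x - h).
      have yE : y = x + e *: h by rewrite -hE addrC subrK.
      rewrite {1}yE; apply/rowP => i; rewrite !mxE; field.
      by apply/andP; split; apply: lt0r_neq0.
    by apply: cvx; apply/andP; split => //; rewrite invr_ge0 ltW.
  have l' : (1 + e) * phi x <= phi y + e * phi (x - h).
    have := ler_wpM2l (ltW s0) l; rewrite mulrDr !mulrA divff ?gt_eqF // mul1r.
    by rewrite mulrBr mulr1 divff ?gt_eqF // [1 + e - 1]addrAC subrr add0r.
  have DB : B - phi x <= D by rewrite /D; have := ler_norm (B - phi x); lra.
  have : e * (B - phi x) <= e * D by apply: ler_wpM2l => //; lra.
  have : e * phi (x + h) <= e * B by apply: ler_wpM2l => //; lra.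
  have : e * phi (x - h) <= e * B by apply: ler_wpM2l => //; lra.
  rewrite ler_norml => *; apply/andP; split; lra.
apply: (@cvgrPdist_le _ _ _ (nbhs x) _ phi (phi x)).2 => eps eps0.
pose e := Num.min 1 (eps / D).
have e0 : 0 < e by rewrite /e lt_min ltr01 divr_gt0.
have e1 : e <= 1 by rewrite /e ge_min lexx.
have eD : e * D <= eps by rewrite -ler_pdivlMr // /e ge_min lexx orbT.
apply/nbhs_ballP; exists e => //= y xy.
rewrite distrC; apply: le_trans (key e y e0 e1 _) eD => i.
by have [_ /(_ ord0 i)] := xy; rewrite -ball_normE /= distrC => /ltW.
Qed.

End convex_continuous.

Section strongly_convex.
Context {R : realType} {d : nat}.

Lemma sqnorm_ge0 (x : 'rV[R]_d) : 0 <= sqnorm x.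
Proof. by apply: sumr_ge0 => i _; exact: sqr_ge0. Qed.

Lemma strongly_convex_convex (phi : 'rV[R]_d -> R) : strongly_convex phi ->
  forall (x y : 'rV[R]_d) (t : R), 0 <= t <= 1 ->
  phi (t *: x + (1 - t) *: y) <= t * phi x + (1 - t) * phi y.
Proof.
move=> [k [k0 H]] x y t t01; apply: le_trans (H x y t t01) _.
have /andP[t0 t1] := t01.
have : 0 <= k / 2 * t * (1 - t) * sqnorm (x - y).
  by rewrite !mulr_ge0 ?sqnorm_ge0 ?invr_ge0 ?ler0n //; lra.
lra.
Qed.

Lemma strongly_convex_continuous (phi : 'rV[R]_d -> R) : strongly_convex phi -> continuous phi.
Proof. by move=> /strongly_convex_convex; exact: convex_continuous. Qed.

Lemma enorm_sqr (x : 'rV[R]_d) : enorm x ^+ 2 = sqnorm x.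
Proof. by rewrite sqr_sqrtr // sqnorm_ge0. Qed.

Lemma sqnormZ (c : R) (x : 'rV[R]_d) : sqnorm (c *: x) = c ^+ 2 * sqnorm x.
Proof. by rewrite /sqnorm mulr_sumr; apply: eq_bigr => i _; rewrite mxE exprMn. Qed.

(** For [r = |x| > 1], strong convexity on the segment from 0 to [x], read at the unit vector
    [x / r], gives [phi x >= k/2 r^2] minus a linear term. Half of the quadratic term absorbs the
    linear one, which leaves [k / 4]. *)
Lemma strongly_convex_quadratic (phi : 'rV[R]_d -> R) : strongly_convex phi ->
  exists k c : R, 0 < k /\ forall x, k * sqnorm x - c <= phi x.
Proof.
move=> sc; have cvx := strongly_convex_convex sc; have [k [k0 H]] := sc.
have [B HB] := convex_bounded_cube cvx 0.
(* Midpoint convexity for [y] and [-y] turns the upper bound on the cube into a lower bound on the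
   unit ball. *)
have lo (y : 'rV[R]_d) : enorm y <= 1 -> 2 * phi 0 - B <= phi y.
  move=> y1; have yb := enorm_box y1.
  have h : phi (- y) <= B by apply: HB => i; rewrite !mxE subr0 normrN; exact: yb.
  have := cvx y (- y) 2^-1; rewrite [2^-1 *: y + _](_ : _ = 0); last first.
    by apply/rowP => i; rewrite !mxE; field.
  have : 0 <= (2^-1 : R) <= 1 by apply/andP; split; lra.
  move=> h1 /(_ h1); lra.
pose K := `|B - phi 0 + k / 2|.
pose c := `|phi 0| + `|2 * phi 0 - B| + K ^+ 2 / k + k / 4.
exists (k / 4), c; split => [|x]; first by rewrite divr_gt0.
have Kk : 0 <= K ^+ 2 / k by rewrite divr_ge0 ?sqr_ge0 // ltW.
have p0 : - `|phi 0| <= phi 0 by have := ler_norm (- phi 0); rewrite normrN; lra.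
have p1 : - `|2 * phi 0 - B| <= 2 * phi 0 - B by have := ler_norm (- (2 * phi 0 - B)); rewrite normrN; lra.
have n0 := normr_ge0 (phi 0); have n1 := normr_ge0 (2 * phi 0 - B).
have e0 : 0 <= enorm x by exact: sqrtr_ge0.
rewrite -enorm_sqr; have [x1|x1] := leP (enorm x) 1.
  have := lo x x1; rewrite /c => lox.
  have : enorm x ^+ 2 <= 1 by rewrite expr_le1.
  move=> q; have : k / 4 * enorm x ^+ 2 <= k / 4 * 1 by apply: ler_wpM2l => //; lra.
  lra.
set r := enorm x in e0 x1 *.
have r0 : 0 < r by lra.
have rV : 0 <= r^-1 <= 1 by apply/andP; split; [rewrite invr_ge0|rewrite invf_le1 ?ltW].
have lx : 2 * phi 0 - B <= phi (r^-1 *: x).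
  apply: lo; rewrite /enorm sqnormZ -enorm_sqr -/r -exprMn mulVf ?gt_eqF // expr1n sqrtr1 //.
have := H x 0 r^-1 rV; rewrite scaler0 addr0 subr0 -enorm_sqr -/r => h.
have h2 : r * phi (r^-1 *: x) <= phi x + (r - 1) * phi 0 - k / 2 * (r - 1) * r.
  have := ler_wpM2l (ltW r0) h; congr (_ <= _); field; exact: lt0r_neq0.
have h3 : r * (2 * phi 0 - B) <= r * phi (r^-1 *: x) by apply: ler_wpM2l => //; lra.
have KB : (B - phi 0 + k / 2) * r <= K * r by apply: ler_wpM2r => //; exact: ler_norm.
have am : K * r <= k / 4 * r ^+ 2 + K ^+ 2 / k.
  have : 0 <= (k / 2 * r - K) ^+ 2 / k by rewrite divr_ge0 ?sqr_ge0 // ltW.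
  suff -> : (k / 2 * r - K) ^+ 2 / k = k / 4 * r ^+ 2 + K ^+ 2 / k - K * r by lra.
  by field; exact: lt0r_neq0.
rewrite /c; lra.
Qed.

End strongly_convex.

(** * Integration against a density *)

Section density_change.
Context {dT : measure_display} {T : measurableType dT} {R : realType}.
Variables (mu nu : {measure set T -> \bar R}) (r : T -> R).
Hypothesis mr : measurable_fun setT r.
Hypothesis r0 : forall x, 0 <= r x.
Hypothesis nuE : forall A, measurable A -> nu A = (\int[mu]_(x in A) (r x)%:E)%E.
Import HBNNSimple.
Local Open Scope ereal_scope.

(** Increasing simple functions approximate [f]; by monotone convergence on both sides it is enough
    to treat them, and on their level sets the identity is [nuE]. *)
Lemma density_change_ge0 (f : T -> \bar R) : measurable_fun setT f -> (forall x, 0 <= f x) ->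
  \int[nu]_x f x = \int[mu]_x (f x * (r x)%:E).
Proof.
move=> mf f0; apply/esym.
have mE := @measurableT _ T.
pose h := nnsfun_approx mE mf.
have -> : \int[nu]_x f x = lim (\int[nu]_x (EFin \o h n) x @[n --> \oo]).
  have fE x : f x = lim ((EFin \o h n) x @[n --> \oo]).
    by apply/esym/cvg_lim => //; exact: cvg_nnsfun_approx.
  under eq_integral => x _ do rewrite fE.
  apply: monotone_convergence => //.
  - by move=> n; apply/measurable_EFinP.
  - by move=> n x _ //=; rewrite lee_fin.
  - by move=> x _ a b ab; rewrite lee_fin; exact/lefP/nd_nnsfun_approx.
have -> : \int[mu]_x (f x * (r x)%:E) =
    lim (\int[mu]_x ((h n x)%:E * (r x)%:E) @[n --> \oo]).
  have fg x : f x * (r x)%:E = lim ((h n x)%:E * (r x)%:E @[n --> \oo]).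
    by apply/esym/cvg_lim => //; apply: cvgeZr => //; exact: cvg_nnsfun_approx.
  under eq_integral => x _ do rewrite fg.
  apply: monotone_convergence => [//| | |].
  - by move=> n; apply/emeasurable_funM; exact/measurable_EFinP.
  - by move=> n x _ /=; rewrite mule_ge0 ?lee_fin.
  - by move=> x _ a b ab/=; rewrite lee_wpmul2r ?lee_fin //; exact/lefP/nd_nnsfun_approx.
suff suf n : \int[mu]_x ((h n x)%:E * (r x)%:E) = \int[nu]_x (EFin \o h n) x.
  by under eq_fun do rewrite suf.
transitivity (\int[nu]_x
   (\sum_(y \in range (h n)) (y * \1_(h n @^-1` [set y]) x)%:E)); last first.
  by apply: eq_integral => t tE; rewrite /= fimfunE -fsumEFin.
have indich m s : measurable_fun setT (fun x => (s * \1_(h m @^-1` [set s]) x)%:E).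
  by apply: (measurable_comp measurableT) => //; exact: measurable_funM.
rewrite ge0_integral_fsum//; last by move=> m y Ey; exact: nnfun_muleindic_ge0.
transitivity (\int[mu]_x (\sum_(y \in range (h n))
    (y * \1_(h n @^-1` [set y]) x)%:E * (r x)%:E)).
  under [RHS]eq_integral => x xE.
    rewrite -ge0_mule_fsuml => [|y]; last exact: nnfun_muleindic_ge0.
    rewrite fsumEFin // -(fimfunE _ x); over.
  by [].
rewrite ge0_integral_fsum//; last 2 first.
  - by move=> y; apply: emeasurable_funM => //; exact/measurable_EFinP.
  - by move=> m y Ey; rewrite mule_ge0 ?lee_fin // -lee_fin nnfun_muleindic_ge0.
apply: eq_fsbigr => s rhn.
under [RHS]eq_integral do rewrite EFinM.
rewrite integralZl_indic_nnsfun => //.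
under eq_integral do rewrite EFinM -muleA.
rewrite ge0_integralZl//.
- under eq_integral do rewrite muleC.
  rewrite (eq_integral ((EFin \o r) \_ (h n @^-1` [set s]))); last first.
    by move=> x xE; rewrite epatch_indic.
  by rewrite -integral_mkcondr setTI -nuE// integral_indic// setIT.
- by apply: emeasurable_funM; exact/measurable_EFinP.
- by move=> x _; rewrite mule_ge0 ?lee_fin.
- by move: rhn; rewrite inE => -[x _ <-]; rewrite lee_fin.
Qed.

Lemma density_change_integrable (f : T -> R) : measurable_fun setT f ->
  nu.-integrable setT (EFin \o f) <-> mu.-integrable setT (EFin \o (fun x => f x * r x)%R).
Proof.
move=> mf; have mf' : measurable_fun setT (fun x => (f x * r x)%R) by exact: measurable_funM.
have E : \int[nu]_x `|(f x)%:E| = \int[mu]_x `|(f x * r x)%:E|.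
  rewrite density_change_ge0 //; last by do 2 apply: measurableT_comp => //.
  by apply: eq_integral => x _; rewrite EFinM abseM; congr (_ * _); rewrite gee0_abs ?lee_fin.
split => /integrableP[m fin]; apply/integrableP; split.
- exact/measurable_EFinP.
- by rewrite /= -E.
- exact/measurable_EFinP.
- by rewrite /= E.
Qed.

Lemma density_change_integral (f : T -> R) : measurable_fun setT f ->
  \int[nu]_x (f x)%:E = \int[mu]_x (f x * r x)%:E.
Proof.
move=> mf; rewrite integralE [RHS]integralE; congr (_ - _).
  rewrite density_change_ge0 //; last by apply: measurable_funepos; exact/measurable_EFinP.
  apply: eq_integral => x _; rewrite !funeposE -!EFin_max -EFinM; congr _%:E.
  by rewrite maxr_pMl // mul0r.
rewrite density_change_ge0 //; last by apply: measurable_funeneg; exact/measurable_EFinP.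
apply: eq_integral => x _; rewrite !funenegE -!EFinN -!EFin_max -EFinM; congr _%:E.
by rewrite maxr_pMl // mul0r mulNr.
Qed.

End density_change.

(** * Integrals of products and Gaussian integrals *)

Section product_integral.
Context {R : realType} {d : nat}.
Local Notation V := (Vsp R d).
Local Notation leb := (@lebesgue_measure R).

Lemma Iit_ge0Z (s : seq 'I_d) (c : R) (h : V -> \bar R) : 0 <= c -> measurable_fun setT h ->
  (forall x, 0 <= h x)%E -> Iit s (fun x => c%:E * h x)%E = (c%:E * Iit s h)%E.
Proof.
move=> c0; elim: s h => //= i s IH h mh h0.
have mi t : measurable_fun setT (h \o upd i t : V -> \bar R).
  by apply: measurableT_comp => //; exact: measurable_upd.
transitivity (\int[leb]_t (c%:E * Iit s (h \o upd i t)))%E.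
  by apply: eq_integral => t _; exact: (IH (h \o upd i t) (mi t) (fun x => h0 _)).
rewrite ge0_integralZl //.
- apply: (@measurable_Iit _ _ s _ _ (fun p => h (upd i p.1 p.2))).
  exact: (measurableT_comp mh (measurable_updp i)).
- by move=> t _; apply: Iit_ge0 => x; exact: h0.
Qed.

Lemma Iit_prod (s : seq 'I_d) (g : 'I_d -> R -> R) : uniq s ->
  (forall i, measurable_fun setT (g i)) -> (forall i t, 0 <= g i t) ->
  Iit s (fun x => (\prod_(i <- s) g i (x ord0 i))%:E) = (\big[*%E/1%E]_(i <- s) \int[leb]_t (g i t)%:E)%E.
Proof.
move=> us mg g0; elim: s us => [_|i s IH /= /andP[is_ us]]; first by rewrite /= !big_nil.
rewrite big_cons -IH //.
have mh : measurable_fun setT (fun x : V => (\prod_(k <- s) g k (x ord0 k))%:E).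
  apply/measurable_EFinP; apply: (@measurable_prod _ _ _ _ _ _ (fun k (x : V) => g k (x ord0 k))) => k _.
  by apply: measurableT_comp => //; exact: measurable_coord.
have h0 x : (0 <= (\prod_(k <- s) g k (x ord0 k))%:E)%E by rewrite lee_fin prodr_ge0.
transitivity (\int[leb]_t ((g i t)%:E * Iit s (fun x => (\prod_(k <- s) g k (x ord0 k))%:E)))%E.
  apply: eq_integral => t _; rewrite -(@Iit_ge0Z _ (g i t)) //; congr Iit.
  apply/funext => x /=; rewrite big_cons upd_same EFinM; congr (_ * _%:E)%E.
  apply: eq_big_seq => k ks; rewrite upd_neq //; apply: contraNneq is_ => <- //.
have mgi := mg i.
rewrite ge0_integralZr //; [exact/measurable_EFinP|by move=> t _; rewrite lee_fin|exact: Iit_ge0].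
Qed.

Lemma lebV_prod (g : 'I_d -> R -> R) :
  (forall i, measurable_fun setT (g i)) -> (forall i t, 0 <= g i t) ->
  (\int[lebV]_x (\prod_i g i ((x : 'rV[R]_d) ord0 i))%:E = \big[*%E/1%E]_i \int[leb]_t (g i t)%:E)%E.
Proof.
move=> mg g0; rewrite -lebd_ge0E; last first.
- by move=> x; rewrite lee_fin prodr_ge0.
- apply/measurable_EFinP; apply: (@measurable_prod _ _ _ _ _ _ (fun k (x : V) => g k (x ord0 k))) => k _.
  by apply: measurableT_comp => //; exact: measurable_coord.
have [s [us sT ->]] := @lebd_Iit R d.
have ps : perm_eq (index_enum 'I_d) s.
  by apply: uniq_perm => //; [exact: index_enum_uniq|move=> i; rewrite mem_index_enum sT].
rewrite (perm_big s) //= -Iit_prod //; congr Iit; apply/funext => x.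
by rewrite (perm_big s).
Qed.

Lemma measurable_gauss (k : R) : measurable_fun setT (fun t : R => expR (- (k * t ^+ 2))).
Proof.
apply: continuous_measurable_fun => t; apply: continuous_comp; last exact: continuous_expR.
by apply: continuousN; apply: continuousM; [exact: cst_continuous|exact: exprn_continuous].
Qed.

(** This is the normal density of variance [1 / (2k)] up to a positive factor; were the integral
    infinite, the density would not integrate to 1. *)
Lemma gauss_integral_lty (k : R) : 0 < k -> (\int[leb]_t (expR (- (k * t ^+ 2)))%:E < +oo)%E.
Proof.
move=> k0; pose s := Num.sqrt ((2 * k)^-1).
have s20 : 0 < (2 * k)^-1 by rewrite invr_gt0 mulr_gt0.
have s0 : s != 0 by rewrite gt_eqF // sqrtr_gt0.
have s2 : s ^+ 2 = (2 * k)^-1 by rewrite sqr_sqrtr // ltW.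
have := integrable_lty measurableT (integrable_normal_pdf 0 s).
have := integral_normal_pdf (0 : R) s.
under eq_integral => x _ do rewrite normal_pdfE //.
rewrite (_ : (fun x => _) = fun t => ((normal_peak s)%:E * (expR (- (k * t ^+ 2)))%:E)%E); last first.
  apply/funext => t; rewrite /= -EFinM; congr (_ * expR _)%:E.
  rewrite subr0 s2 -mulr_natl; field; exact: lt0r_neq0.
rewrite ge0_integralZl //; last 2 first.
- by have mG := measurable_gauss k; exact/measurable_EFinP.
- by rewrite lee_fin normal_peak_ge0.
move=> H _; rewrite ltey; apply/negP => /eqP I; move: H.
by rewrite I gt0_muley // lte_fin normal_peak_gt0.
Qed.

Lemma sqnorm_gauss_lty (k : R) : 0 < k ->
  (\int[lebV]_x (expR (- (k * sqnorm (x : 'rV[R]_d))))%:E < +oo)%E.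
Proof.
move=> k0.
under eq_integral => x _ do rewrite /sqnorm mulr_sumr -sumrN expR_sum.
rewrite (@lebV_prod (fun _ t => expR (- (k * t ^+ 2)))) //; last by move=> _; exact: measurable_gauss.
have := gauss_integral_lty k0; set I := (\int[leb]_t _)%E => Ioo.
have I0 : (0 <= I)%E by apply: integral_ge0 => t _; rewrite lee_fin expR_ge0.
suff : (\big[*%E/1%E]_(i < d) I \is a fin_num)%E by rewrite ltey => /fin_numP[].
by apply: (big_ind (fun x : \bar R => x \is a fin_num)) => // [x y|_ _]; [exact: fin_numM|rewrite ge0_fin_numE].
Qed.

End product_integral.

Section log_concave_law.
Context {R : realType} {d : nat} {dO : measure_display} {O : measurableType dO} (P : probability O R).
Local Notation V := (Vsp R d).
Variables (Y : 'I_d -> O -> R) (phi : 'rV[R]_d -> R).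
Hypothesis mY : forall i, measurable_fun setT (Y i).
Hypothesis sc : strongly_convex phi.
Hypothesis dens : has_density P (fun w => \row_i Y i w) phi.
Let Yv : O -> V := fun w => \row_i Y i w.
Definition rho (x : V) : R := expR (- phi x).

Lemma measurable_row : measurable_fun setT Yv.
Proof. by apply: measurable_fun_rV => j; under eq_fun do rewrite mxE; exact: mY. Qed.

Lemma rho_gt0 x : 0 < rho x. Proof. exact: expR_gt0. Qed.

Lemma continuous_rho : continuous (rho : 'rV[R]_d -> R).
Proof.
move=> x; apply: continuous_comp; last exact: continuous_expR.
by apply: (@continuousN _ R^o); exact: strongly_convex_continuous.
Qed.

Lemma measurable_rho : measurable_fun setT rho.
Proof. by apply: continuous_measurable_rV; exact: continuous_rho. Qed.

Lemma law_set (A : set V) : measurable A ->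
  P (Yv @^-1` A) = (\int[lebV]_(x in A) (rho x)%:E)%E.
Proof.
move=> mA; rewrite (dens mA) lebd_ge0E.
- rewrite [RHS]integral_mkcond; apply: eq_integral => x _.
  by rewrite patchE indicE; case: ifP => _; rewrite ?mulr1 ?mulr0.
- by apply/measurable_EFinP; apply: measurable_funM; [exact: measurable_rho|exact: measurable_indic].
- by move=> x; rewrite lee_fin mulr_ge0 // ltW // rho_gt0.
Qed.

Let law := pushm P measurable_row.

Lemma law_integrable (f : V -> R) : measurable_fun setT f ->
  P.-integrable setT (EFin \o (fun w => f (Yv w))) ->
  lebV.-integrable setT (EFin \o (fun x => f x * rho x)).
Proof.
move=> mf fi; apply/(@density_change_integrable _ _ _ lebV law) => //.
- exact: measurable_rho.
- by move=> x; rewrite ltW // rho_gt0.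
- by move=> A mA; exact: law_set.
apply/integrableP; split; first exact/measurable_EFinP.
rewrite ge0_integral_pushforward //; first by have /integrableP[] := fi.
  exact: measurable_row.
by do 2 apply: measurableT_comp => //.
Qed.

Lemma law_integral (f : V -> R) : measurable_fun setT f ->
  (\int[P]_w (f (Yv w))%:E = \int[lebV]_x (f x * rho x)%:E)%E.
Proof.
move=> mf; rewrite -(@density_change_integral _ _ _ lebV law rho measurable_rho) //; last 2 first.
- by move=> x; rewrite ltW // rho_gt0.
- by move=> A mA; exact: law_set.
rewrite [LHS]integralE [RHS]integralE; congr (_ - _)%E; rewrite ge0_integral_pushforward //.
- by rewrite preimage_setT; apply: eq_integral => w _; rewrite /= !funeposE.
- exact: measurable_row.
- by apply: measurable_funepos; exact/measurable_EFinP.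
- by rewrite preimage_setT; apply: eq_integral => w _; rewrite /= !funenegE.
- exact: measurable_row.
- by apply: measurable_funeneg; exact/measurable_EFinP.
Qed.

(** The density is at most [e^c e^(-k|x|^2)]. Half of the exponent is kept to make the integral
    finite; the other half is at most [-k t^2 / 2] where [|x| >= t], so [C = 2 / k]. The [+ 1] only
    makes [a] positive. *)
Lemma gaussian_tails : exists a C : R, 0 < a /\ 0 < C /\
  forall t : R, 0 < t -> (P [set w | (t <= enorm (Yv w))%R] <= (a * expR (- (t ^+ 2) / C))%:E)%E.
Proof.
have [k [c [k0 kc]]] := strongly_convex_quadratic sc.
have k20 : 0 < k / 2 by rewrite divr_gt0.
have := sqnorm_gauss_lty (d := d) k20; set I := (\int[lebV]_x _)%E => Ioo.
have I0 : (0 <= I)%E by apply: integral_ge0 => x _; rewrite lee_fin expR_ge0.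
have Ifin : I = (fine I)%:E by rewrite fineK // ge0_fin_numE.
exists (expR c * fine I + 1), (2 / k); split; last split => [|t t0].
- by rewrite ltr_wpDl // mulr_ge0 ?expR_ge0 // fine_ge0.
- by rewrite divr_gt0.
have mE := @measurable_enorm R d.
have mA : measurable [set x : V | t <= enorm x].
  have := mE measurableT `[t, +oo[%classic (measurable_itv _).
  by rewrite setTI; congr measurable; apply/seteqP; split=> x /=; rewrite in_itv /= andbT.
rewrite (_ : [set w | _] = Yv @^-1` [set x : V | t <= enorm x]) // law_set //.
apply: (@le_trans _ _ ((expR c * expR (- (t ^+ 2) / (2 / k)))%:E * I)%E); last first.
  move: Ifin; set J := fine I => ->; rewrite -EFinM lee_fin; have := expR_ge0 (- (t ^+ 2) / (2 / k)); lra.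
have mG : measurable_fun setT (fun x : V => expR (- (k / 2 * sqnorm x))).
  by apply: measurableT_comp => //; apply: measurableT_comp => //; apply: measurable_funM => //; exact: measurable_sqnorm.
have mG' : measurable_fun setT (fun x : V => (expR (- (k / 2 * sqnorm x)))%:E) by exact/measurable_EFinP.
have mR : measurable_fun setT (EFin \o rho) by apply/measurable_EFinP; exact: measurable_rho.
rewrite integral_mkcond /I -ge0_integralZl //.
apply: ge0_le_integral => //.
- by move=> x _; rewrite patchE; case: ifP => // _; rewrite lee_fin ltW // rho_gt0.
- exact: ((measurable_restrictT (EFin \o rho) mA).1 (measurable_funTS mR)).
- by apply: emeasurable_funM => //; exact: measurable_cst.
move=> x _; rewrite patchE; case: ifPn => [|_]; last by rewrite -EFinM lee_fin !mulr_ge0 ?expR_ge0.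
rewrite inE /= => tx; rewrite -EFinM lee_fin /rho -!expRD ler_expR.
have := kc x; have : t ^+ 2 <= sqnorm x.
  by rewrite -enorm_sqr lerXn2r // ?nnegrE ?sqrtr_ge0 // ltW.
have -> : - (t ^+ 2) / (2 / k) = - (k / 2 * t ^+ 2) by field; exact: lt0r_neq0.
move=> h1 h2; have := ler_wpM2l (ltW k20) h1; lra.
Qed.

End log_concave_law.

(** * Factorisation of the density along a coordinate *)

Section factorisation.
Context {R : realType} {d : nat} {dO : measure_display} {O : measurableType dO} (P : probability O R).
Local Notation V := (Vsp R d).
Variables (Y : 'I_d -> O -> R) (phi : 'rV[R]_d -> R).
Hypothesis mY : forall i, measurable_fun setT (Y i).
Hypothesis sc : strongly_convex phi.
Hypothesis dens : has_density P (fun w => \row_i Y i w) phi.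
Hypothesis indY : indep_coords P Y.
Let Yv : O -> V := fun w => \row_i Y i w.
Local Notation rho := (rho phi).

(** A product of intervals, so that independence factors its probability. *)
Definition cube (z : 'rV[R]_d) (e : R) : set V := [set x : V | forall i, `|x ord0 i - z ord0 i| < e].

Lemma measurable_cube z e : measurable (cube z e).
Proof.
have H := @measurable_cyl R d (enum 'I_d) (fun i => [set t | `|t - z ord0 i| < e]).
have -> : cube z e = [set x : V | forall i, i \in enum 'I_d -> `|x ord0 i - z ord0 i| < e].
  by apply/seteqP; split=> x /= h i; [move=> _; exact: h|apply: h; rewrite mem_enum].
apply: H => i; have := measurable_ball (z ord0 i) e; congr measurable.
by apply/seteqP; split=> t /=; rewrite -ball_normE /= distrC.
Qed.

Lemma lebV_cube z e : 0 < e -> lebV (cube z e) = ((e *+ 2) ^+ d)%:E.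
Proof.
move=> e0; have := @integral_indic _ _ _ (@lebV R d) setT measurableT _ (measurable_cube z e).
rewrite setIT => <-.
transitivity (\int[lebV]_x (\prod_i \1_(ball (z ord0 i) e) ((x : 'rV[R]_d) ord0 i))%:E)%E.
  apply: eq_integral => x _; congr _%:E; rewrite indicE; case: (boolP (x \in cube z e)).
    rewrite inE => h; rewrite big1 // => i _; rewrite indicE mem_set // -ball_normE /= distrC; exact: h.
  move=> /negP h; have [i hi] : exists i, ~ (`|x ord0 i - z ord0 i| < e).
    by apply/not_existsP => hh; apply: h; rewrite inE => i; apply: contrapT; exact: hh.
  by rewrite (bigD1 i) //= indicE memNset ?mul0r // -ball_normE /= distrC.
rewrite (@lebV_prod _ _ (fun i t => \1_(ball (z ord0 i) e) t)) //; last first.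
  by move=> i; apply: measurable_indic; exact: measurable_ball.
have -> : ((e *+ 2) ^+ d)%:E = (\big[*%E/1%E]_(i < d) (e *+ 2)%:E)%E.
  by rewrite -(big_morph EFin (@EFinM R) (erefl _)) prodr_const card_ord.
apply: eq_bigr => i _; rewrite integral_indic ?setIT //; last exact: measurable_ball.
exact: (lebesgue_measure_ball (z ord0 i) (ltW e0)).
Qed.

Let cubeP z e := fine (P (Yv @^-1` cube z e)).

Lemma cube_prob_fin z e : P (Yv @^-1` cube z e) = (cubeP z e)%:E.
Proof.
rewrite /cubeP fineK // fin_num_measure //.
by have := measurable_row mY measurableT (measurable_cube z e); rewrite setTI.
Qed.

Lemma cube_prob_close z e del : 0 < e -> (forall x, cube z e x -> `|rho x - rho z| <= del) ->
  `|cubeP z e / (e *+ 2) ^+ d - rho z| <= del.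
Proof.
move=> e0 H.
have z0 : cube z e z by move=> i; rewrite subrr normr0.
have del0 : 0 <= del by apply: le_trans (H z z0).
have v0 : 0 < (e *+ 2) ^+ d by rewrite exprn_gt0 // pmulrn_lgt0.
have mC := measurable_cube z e.
have mR : measurable_fun (cube z e) (EFin \o rho).
  by apply/measurable_EFinP; apply: measurable_funTS; exact: measurable_rho.
have E : (cubeP z e)%:E = (\int[lebV]_(x in cube z e) (rho x)%:E)%E.
  by rewrite -cube_prob_fin (law_set sc dens).
have cst c : (\int[lebV]_(x in cube z e) c%:E = (c * (e *+ 2) ^+ d)%:E)%E.
  rewrite (@integral_cst _ _ _ lebV _ mC) -[X in (_ * X)%E]/(lebV (cube z e)) lebV_cube //.
have r0 x : (0 <= (rho x)%:E)%E by rewrite lee_fin ltW // rho_gt0.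
have up : cubeP z e <= (rho z + del) * (e *+ 2) ^+ d.
  rewrite -lee_fin E -cst; apply: ge0_le_integral => //.
  move=> x cx; rewrite lee_fin; have := H x cx; rewrite ler_norml => /andP[]; lra.
have lo : (rho z - del) * (e *+ 2) ^+ d <= cubeP z e.
  have [h|h] := leP (rho z - del) 0.
    apply: (@le_trans _ _ 0); first by rewrite mulr_le0_ge0 // ltW.
    by rewrite fine_ge0.
  rewrite -lee_fin E -cst; apply: ge0_le_integral => //.
  - by move=> x _; rewrite lee_fin ltW.
  move=> x cx; rewrite lee_fin; have := H x cx; rewrite ler_norml => /andP[]; lra.
rewrite ler_norml; apply/andP; split.
  by rewrite lerBrDl addrC ler_pdivlMr //; have := lo; lra.
by rewrite lerBlDl ler_pdivrMr // addrC; have := up; lra.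
Qed.

Lemma cube_prob_cvg z : cubeP z n.+1%:R^-1 / (n.+1%:R^-1 *+ 2) ^+ d @[n --> \oo] --> rho z.
Proof.
apply/cvgrPdist_le => del del0.
have := (@cvgrPdist_le _ _ _ (nbhs z) _ rho (rho z)).1 (@continuous_rho _ _ _ sc z) _ del0.
move=> /(_ _)/nbhs_rVP[e e0 He].
have := @near_infty_natSinv_lt R (PosNum e0); apply: filterS => n /= ne.
rewrite distrC; apply: cube_prob_close; first by rewrite invr_gt0.
move=> x cx; rewrite distrC; apply: He => i; rewrite distrC; apply: lt_trans ne; exact: cx.
Qed.

Lemma cube_prob_prod z e : cubeP z e = \prod_i fine (P (Y i @^-1` [set t | `|t - z ord0 i| < e])).
Proof.
have mB i : measurable [set t | `|t - z ord0 i| < e].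
  have := measurable_ball (z ord0 i) e; congr measurable.
  by apply/seteqP; split=> t /=; rewrite -ball_normE /= distrC.
apply: EFin_inj; rewrite -cube_prob_fin.
rewrite (big_morph EFin (@EFinM R) (erefl _)) /=.
transitivity (\big[*%E/1%E]_(i < d) P [set w | [set t : R | (`|t - z ord0 i| < e)%R] (Y i w)])%E.
  rewrite -(indY mB); congr (P _); apply/seteqP; split=> w /= h i; have := h i; rewrite ?mxE //.
apply: eq_bigr => i _; rewrite fineK // fin_num_measure //.
by have := @mY i measurableT _ (mB i); rewrite setTI.
Qed.

(** For small cubes the identity between probabilities is exact, since the factor of coordinate [j]
    separates from the others. Dividing by volumes and using the continuity of [rho] gives it at
    every point, not just almost everywhere. *)
Lemma rho_exchange j t s (x y : 'rV[R]_d) :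
  rho (upd j t x) * rho (upd j s y) = rho (upd j s x) * rho (upd j t y).
Proof.
have H a b : (cubeP a n.+1%:R^-1 / (n.+1%:R^-1 *+ 2) ^+ d) * (cubeP b n.+1%:R^-1 / (n.+1%:R^-1 *+ 2) ^+ d)
   @[n --> \oo] --> rho a * rho b by apply: cvgM; exact: cube_prob_cvg.
have := H (upd j t x) (upd j s y); have := H (upd j s x) (upd j t y).
rewrite (_ : (fun n => _) = (fun n => (cubeP (upd j t x) n.+1%:R^-1 / (n.+1%:R^-1 *+ 2) ^+ d) *
   (cubeP (upd j s y) n.+1%:R^-1 / (n.+1%:R^-1 *+ 2) ^+ d))); last first.
  apply/funext => n; move: (n.+1%:R^-1) => e; rewrite !cube_prob_prod.
  have E u (z : 'rV[R]_d) : \prod_i fine (P (Y i @^-1` [set t0 | `|t0 - upd j u z ord0 i| < e])) =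
     fine (P (Y j @^-1` [set t0 | `|t0 - u| < e])) *
     \prod_(i < d | i != j) fine (P (Y i @^-1` [set t0 | `|t0 - z ord0 i| < e])).
    rewrite (bigD1 j) //= upd_same; congr (_ * _).
    by apply: eq_bigr => i ij; rewrite upd_neq.
  by rewrite !E; ring.
by move=> h1 h2; exact: (cvg_unique _ h2 h1).
Qed.

Definition line_density j (t : R) : R := rho (upd j t 0).
(** Constant along the lines of direction [j]. Neither factor is normalised; the quotient fixes the
    scale so that the product is [rho]. *)
Definition rest_density j (x : 'rV[R]_d) : R := rho (upd j 0 x) / rho (upd j 0 0).

Lemma rho_factor j t x : rho (upd j t x) = line_density j t * rest_density j x.
Proof.
rewrite /line_density /rest_density mulrA [rho _ * rho _]mulrC -rho_exchange mulfK //.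
by rewrite gt_eqF // rho_gt0.
Qed.

End factorisation.

(** * One-dimensional Stein kernels *)

Section primitive_kernel.
Context {R : realType}.
Local Notation leb := (@lebesgue_measure R).
Local Notation ind b := ((nat_of_bool b)%:R : R).

(* [\int K u t g t dt] is the primitive [\int_0^u g] for u of either sign. *)
Definition pker (u t : R) : R := ind (0 <= t < u)%R - ind (u <= t < 0)%R.

Definition prim (g : R -> R) (u : R) : R := (\int[leb]_t (pker u t * g t))%R.

(** For [w u = u p u] this is the numerator of the Stein kernel. For a mean-zero [w] it is also
    minus the primitive of [w] vanishing at both infinities. *)
Definition upper_tail (w : R -> R) (t : R) : R := (\int[leb]_u (w u * ind (t < u)%R))%R.

Lemma measurable_bool_ind dT (T : measurableType dT) (b : T -> bool) : measurable_fun setT b ->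
  measurable_fun setT (fun x => ind (b x)).
Proof.
move=> mb; rewrite (_ : (fun x => _) = \1_[set x | b x]).
  by apply: measurable_indic; have := mb measurableT [set true] I; rewrite setTI; congr measurable.
by apply/funext => x; rewrite indicE; congr (_ %:R); congr nat_of_bool; symmetry; exact: asboolb.
Qed.

Lemma measurable_pker : measurable_fun setT (fun p : R * R => pker p.1 p.2).
Proof.
apply: measurable_funB; apply: measurable_bool_ind; apply: measurable_and.
- apply: measurable_fun_ler; [exact: measurable_cst|exact: measurable_snd].
- apply: measurable_fun_ltr; [exact: measurable_snd|exact: measurable_fst].
- apply: measurable_fun_ler; [exact: measurable_fst|exact: measurable_snd].
- apply: measurable_fun_ltr; [exact: measurable_snd|exact: measurable_cst].
Qed.

Lemma pker_le1 u t : `|pker u t| <= 1.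
Proof.
rewrite /pker; case: (boolP (0 <= t < u)) => [/andP[h1 h2]|_]; case: (boolP (u <= t < 0)) => [/andP[h3 h4]|_] /=.
- by exfalso; lra.
- by rewrite subr0 normr1.
- by rewrite sub0r normrN normr1.
- by rewrite subrr normr0.
Qed.

Lemma pker_pos t u : 0 <= t -> pker u t = ind (t < u)%R.
Proof.
move=> t0; rewrite /pker t0 /=; suff -> : (u <= t < 0) = false by rewrite subr0.
by apply/negP => /andP[_ h]; lra.
Qed.

Lemma pker_neg t u : t < 0 -> pker u t = ind (t < u)%R - 1.
Proof.
move=> t0; rewrite /pker leNgt t0 /= sub0r andbT leNgt.
by case: (t < u) => /=; rewrite ?subrr ?oppr0 // sub0r.
Qed.

Lemma integrable_mul_bounded (w c : R -> R) (B : R) : leb.-integrable setT (EFin \o w) ->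
  measurable_fun setT c -> (forall u, `|c u| <= B) ->
  leb.-integrable setT (EFin \o (fun u => w u * c u)).
Proof.
move=> iw mc cB.
have mw : measurable_fun setT w by apply/measurable_EFinP; exact: measurable_int iw.
apply: (@le_integrable _ _ _ leb setT measurableT _ (EFin \o (fun u => B * `|w u|))).
- by apply/measurable_EFinP; apply: measurable_funM.
- move=> u _; rewrite /= lee_fin normrM [`|B * _|]ger0_norm ?mulr_ge0 //.
    by rewrite mulrC ler_wpM2r.
  exact: le_trans (cB u).
- rewrite (_ : EFin \o _ = (fun u => B%:E * (EFin \o (fun u => `|w u|)%R) u)%E) //.
  apply: integrableZl => //.
  by have := integrable_abse iw; apply: eq_integrable.
Qed.

(** As functions of [u], [pker u t] and the indicator of [t < u] differ by a constant, which a
    mean-zero [w] does not see. *)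
Lemma upper_tail_pker (w : R -> R) t : leb.-integrable setT (EFin \o w) ->
  (\int[leb]_u (w u)%:E = 0)%E ->
  (\int[leb]_u (w u * pker u t)%:E = (upper_tail w t)%:E)%E.
Proof.
move=> iw w0.
have mi : measurable_fun setT (fun u => ind (t < u)%R).
  by apply: measurable_bool_ind; apply: measurable_fun_ltr => //; exact: measurable_cst.
have ii : leb.-integrable setT (EFin \o (fun u => w u * ind (t < u)%R)).
  by apply: (integrable_mul_bounded (B := 1)) => // u; case: (t < u); rewrite /= ?normr1 ?normr0.
have -> : ((upper_tail w t)%:E = \int[leb]_u (w u * ind (t < u)%R)%:E)%E.
  by rewrite /upper_tail /Rintegral fineK //; exact: integrable_fin_num.
have [t0|t0] := leP 0 t; first by apply: eq_integral => u _; rewrite pker_pos.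
transitivity (\int[leb]_u ((w u * ind (t < u)%R)%:E - (w u)%:E))%E.
  by apply: eq_integral => u _; rewrite pker_neg // mulrBr mulr1 EFinB.
by rewrite integralB // w0 sube0.
Qed.

(** Integration by parts in which neither function is differentiated: write [prim g] as an integral
    against [pker] and exchange the order. *)
Lemma primitive_fubini (w g : R -> R) : leb.-integrable setT (EFin \o w) ->
  (\int[leb]_u (w u)%:E = 0)%E -> measurable_fun setT g ->
  (forall u, leb.-integrable setT (EFin \o (fun t => pker u t * g t))) ->
  (\int[leb]_t \int[leb]_u `|(w u * pker u t * g t)%:E| < +oo)%E ->
  (\int[leb]_u (w u * prim g u)%:E = \int[leb]_t (upper_tail w t * g t)%:E)%E.
Proof.
move=> iw w0 mg ig fin.
have mw : measurable_fun setT w by apply/measurable_EFinP; exact: measurable_int iw.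
pose f (p : R * R) := (w p.1 * pker p.1 p.2 * g p.2)%:E.
have mf : measurable_fun setT f.
  apply/measurable_EFinP; apply: measurable_funM; first apply: measurable_funM.
  - by apply: measurableT_comp => //; exact: measurable_fst.
  - exact: measurable_pker.
  - by apply: measurableT_comp => //; exact: measurable_snd.
have fi : (leb \x leb)%E.-integrable setT f by apply/integrable21ltyP.
have := Fubini fi; rewrite /f /=.
have -> : (\int[leb]_x \int[leb]_y (w x * pker x y * g y)%:E = \int[leb]_u (w u * prim g u)%:E)%E.
  apply: eq_integral => u _; rewrite EFinM /prim /Rintegral fineK; last exact: (integrable_fin_num measurableT (ig u)).
  rewrite -(integralZl measurableT (ig u)).
  by apply: eq_integral => t _; rewrite -EFinM mulrA.
move=> ->; apply: eq_integral => t _.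
have iwk : leb.-integrable setT (EFin \o (fun u => w u * pker u t)).
  apply: (integrable_mul_bounded (B := 1)) => //; last by move=> u; exact: pker_le1.
  exact: (measurableT_comp measurable_pker (pair2_measurable _)).
rewrite EFinM -(upper_tail_pker t iw w0) muleC -integralZl //.
by apply: eq_integral => u _; rewrite -EFinM mulrC.
Qed.

End primitive_kernel.

Section line_stein.
Context {R : realType}.
Local Notation leb := (@lebesgue_measure R).
Variables (psi : R -> R) (kappa R0 : R).
Hypothesis kappa0 : 0 < kappa.
Hypothesis sc1 : forall u v s : R, 0 <= s <= 1 ->
  psi (s * u + (1 - s) * v) <= s * psi u + (1 - s) * psi v - kappa / 2 * s * (1 - s) * (u - v) ^+ 2.
Hypothesis R00 : 0 < R0.
Hypothesis psi0 : forall t, R0 <= `|t| -> psi 0 <= psi t.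
Let p t := expR (- psi t).
Let w u := u * p u.
Hypothesis iw : leb.-integrable setT (EFin \o w).
Hypothesis w0 : (\int[leb]_u (w u)%:E = 0)%E.

(** Strong convexity on the segment from 0 to [u], at its point [t], with [psi 0 <= psi t], gives
    [psi u >= psi t + kappa/2 u (u - t)]. The bound [u (u - t) >= (u^2 - t^2) / 2] produces an
    exponent whose product with [u] has an explicit primitive. *)
Lemma log_concave_decay (t u : R) : psi 0 <= psi t -> (0 < t <= u) || (u <= t < 0) ->
  p u <= p t * expR (- (kappa / 4 * (u ^+ 2 - t ^+ 2))).
Proof.
move=> h tu; rewrite /p -expRD ler_expR.
have u0 : u != 0.
  by case/orP: tu => /andP[? ?]; [rewrite gt_eqF //|rewrite lt_eqF //]; lra.
have s01 : 0 <= t / u <= 1.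
  case/orP: tu => /andP[? ?].
    by apply/andP; split; [apply: divr_ge0|rewrite ler_pdivrMr ?mul1r]; lra.
  by apply/andP; split; [rewrite -mulrNN -invrN; apply: divr_ge0|rewrite ler_ndivrMr ?mul1r]; lra.
have s0 : 0 < t / u.
  rewrite lt_neqAle (andP s01).1 andbT eq_sym mulf_neq0 ?invr_eq0 //.
  by case/orP: tu => /andP[? ?]; [rewrite gt_eqF //|rewrite lt_eqF //]; lra.
have := sc1 u 0 s01; rewrite mulr0 addr0 subr0 divfK // => c.
have c2 : (t / u) * psi t <= (t / u) * (psi u - kappa / 2 * (1 - t / u) * u ^+ 2).
  have /andP[_ s1] := s01.
  have := ler_wpM2l (_ : 0 <= 1 - t / u) h; rewrite subr_ge0 => /(_ s1); lra.
have {}c2 : psi t <= psi u - kappa / 2 * (1 - t / u) * u ^+ 2 by rewrite -(ler_pM2l s0).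
have e : (1 - t / u) * u ^+ 2 = u ^+ 2 - t * u by field.
have k4 : 0 <= kappa / 4 * (u - t) ^+ 2 by rewrite mulr_ge0 ?sqr_ge0 // divr_ge0 // ltW.
move: c2; rewrite -mulrA e; lra.
Qed.

(** The value does not depend on [a]: this makes the Stein ratio bounded at infinity. *)
Lemma gaussian_tail_integral (a : R) : 0 < a ->
  (\int[leb]_(u in `[a, +oo[) (u * expR (- (kappa / 4 * (u ^+ 2 - a ^+ 2))))%:E = (2 / kappa)%:E)%E.
Proof.
move=> a0; pose F u := - (2 / kappa) * expR (- (kappa / 4 * (u ^+ 2 - a ^+ 2))).
have dF x : is_derive x (1 : R) F (x * expR (- (kappa / 4 * (x ^+ 2 - a ^+ 2)))).
  have dX : is_derive x (1 : R) (fun u : R => u ^+ 2) (2 * x).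
    have -> : 2 * x = 2%:R * x ^+ 1 by rewrite expr1.
    exact: is_derive_exprn.
  have dq := is_deriveZ (- (kappa / 4)) (is_deriveB dX (is_derive_cst (a ^+ 2) x 1)).
  have dE := is_derive_expR (- (kappa / 4) *: (x ^+ 2 - a ^+ 2)).
  have := is_deriveZ (- (2 / kappa)) (@is_derive1_comp _ expR _ x _ _ dE dq).
  rewrite (_ : - (2 / kappa) \*: _ = F); last by apply/funext => u; rewrite /F /= /GRing.scale /= /GRing.scale /=; congr (_ * expR _); rewrite mulNr.
  move=> /is_derive_eq; apply; rewrite /GRing.scale /= /GRing.scale /= mulNr subr0.
  rewrite [in expR _]mulNr; set e := expR _; field; exact: lt0r_neq0.
have cf : continuous (fun u : R => u * expR (- (kappa / 4 * (u ^+ 2 - a ^+ 2)))).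
  move=> x; apply: (@continuousM _ _ (fun u : R => u)); first exact: cvg_id.
  apply: continuous_comp; last exact: continuous_expR.
  apply: continuousN; apply: continuousM; first exact: cst_continuous.
  by apply: continuousB; [exact: exprn_continuous|exact: cst_continuous].
rewrite (@ge0_continuous_FTC2y _ _ F a 0).
- by rewrite sub0e -EFinN /F subrr mulr0 oppr0 expR0 mulr1 opprK.
- by move=> x ax; rewrite mulr_ge0 ?expR_ge0 //; lra.
- exact: continuous_subspaceT.
- rewrite -(mulr0 (- (2 / kappa))); apply: cvgMr.
  apply: (@cvg_comp _ _ _ (fun u : R => kappa / 4 * (u ^+ 2 - a ^+ 2)) (fun y => expR (- y)) _ +oo%R); last exact: cvgr_expR.
  apply/cvgryPge => B; near=> u.
  have u1 : 1 <= u by near: u; apply: nbhs_pinfty_ge; exact: num_real.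
  have uB : a ^+ 2 + `|B| / (kappa / 4) <= u by near: u; apply: nbhs_pinfty_ge; exact: num_real.
  have k4 : 0 < kappa / 4 by rewrite divr_gt0.
  have : u <= u ^+ 2 by rewrite expr2 ler_peMr //; lra.
  have Bn := ler_norm B => uu; have : `|B| <= kappa / 4 * (u ^+ 2 - a ^+ 2) by rewrite -ler_pdivrMl // mulrC; lra.
  lra.
- by move=> x _; have [] := dF x.
- by apply: cvg_at_right_filter; apply: (is_derive_continuous dF).
- by move=> x _; rewrite derive1E; have [] := dF x.
Unshelve. all: by end_near.
Qed.

Lemma gaussian_tail_integralN (t : R) : t < 0 ->
  (\int[leb]_(u in `]-oo, t]) (- u * expR (- (kappa / 4 * (u ^+ 2 - t ^+ 2))))%:E = (2 / kappa)%:E)%E.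
Proof.
move=> t0; have := @ge0_integration_by_substitutionNy R (fun u => - u * expR (- (kappa / 4 * (u ^+ 2 - t ^+ 2)))) (- t).
rewrite opprK => -> /=.
- rewrite -(@gaussian_tail_integral (- t)); last by rewrite oppr_gt0.
  by apply: eq_integral => u _; rewrite /= opprK sqrrN [(- t) ^+ 2]sqrrN.
- apply: continuous_subspaceT => x; apply: continuousM; first exact: continuousN.
  apply: continuous_comp; last exact: continuous_expR.
  apply: continuousN; apply: continuousM; first exact: cst_continuous.
  by apply: continuousB; [exact: exprn_continuous|exact: cst_continuous].
- by move=> x; rewrite in_itv /= => xt; rewrite mulr_ge0 ?expR_ge0 //; lra.
Qed.

Let mw : measurable_fun setT w. Proof. by apply/measurable_EFinP; exact: measurable_int iw. Qed.

Let mwk t : measurable_fun setT (fun u => w u * pker u t).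
Proof. by apply: measurable_funM => //; exact: (measurableT_comp measurable_pker (pair2_measurable _)). Qed.

Lemma stein_numerator_ge0 u t : 0 <= w u * pker u t.
Proof.
rewrite /w; have p0 : 0 <= p u by exact: expR_ge0.
have [t0|t0] := leP 0 t.
  by rewrite pker_pos //; case: ltP => tu /=; rewrite ?mulr0 // mulr1 mulr_ge0 //; lra.
rewrite pker_neg //; case: ltP => tu /=; rewrite ?subrr ?mulr0 // sub0r mulrN1 -mulNr mulr_ge0 //; lra.
Qed.

(** Far from 0, the decay lemma compares the numerator with [p t] and leaves [2 / kappa]. For
    [|t| < R0], the numerator is at most the first absolute moment, and convexity between [-R0] and
    [R0] keeps [p] above [e^(-b)]. *)
Lemma stein_ratio_bounded : exists L : R, 0 <= L /\ forall t, 0 <= upper_tail w t <= L * p t.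
Proof.
pose M1 := fine (\int[leb]_u `|(w u)%:E|)%E.
have M1E : (\int[leb]_u `|(w u)%:E| = M1%:E)%E.
  rewrite /M1 fineK // ge0_fin_numE; last by apply: integral_ge0.
  by have /integrableP[] := iw.
have M10 : 0 <= M1 by rewrite fine_ge0 // integral_ge0.
pose b := Num.max (psi R0) (psi (- R0)).
exists (2 / kappa + M1 * expR b); split.
  by apply: addr_ge0; [rewrite divr_ge0 // ltW|rewrite mulr_ge0 ?expR_ge0].
move=> t; have E := upper_tail_pker t iw w0.
have p0 : 0 < p t by exact: expR_gt0.
apply/andP; split.
  rewrite -lee_fin -E; apply: integral_ge0 => u _; rewrite lee_fin; exact: stein_numerator_ge0.
have k2 : 0 <= 2 / kappa by rewrite divr_ge0 // ltW.
have Mb : 0 <= M1 * expR b by rewrite mulr_ge0 ?expR_ge0.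
have [ht|ht] := leP R0 `|t|; last first.
  have h1 : upper_tail w t <= M1.
    rewrite -lee_fin -E -M1E; apply: ge0_le_integral => //.
    - by move=> u _; rewrite lee_fin; exact: stein_numerator_ge0.
    - by have m := mwk t; exact/measurable_EFinP.
    - by do 2 apply: measurableT_comp => //.
    move=> u _; rewrite lee_fin; apply: le_trans (ler_norm _) _; rewrite normrM.
    by have := ler_wpM2l (normr_ge0 (w u)) (pker_le1 u t); rewrite mulr1.
  have h2 : psi t <= b.
    move: ht; rewrite ltr_norml => /andP[t1 t2].
    pose s := (t + R0) / (2 * R0).
    have sE : s * (2 * R0) = t + R0 by rewrite /s divfK // gt_eqF // mulr_gt0.
    have s01 : 0 <= s <= 1.
      by apply/andP; rewrite /s; split; [apply: divr_ge0|rewrite ler_pdivrMr ?mul1r]; lra.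
    have tE : t = s * R0 + (1 - s) * (- R0) by have := sE; lra.
    have /andP[s0 s1] := s01.
    have := sc1 R0 (- R0) s01; rewrite -tE.
    have q : 0 <= kappa / 2 * s * (1 - s) * (R0 - - R0) ^+ 2.
      have k20 : 0 <= kappa / 2 by rewrite divr_ge0 // ltW.
      have s2 : 0 <= 1 - s by lra.
      exact: (mulr_ge0 (mulr_ge0 (mulr_ge0 k20 s0) s2) (sqr_ge0 _)).
    have b1 : s * psi R0 <= s * b by apply: ler_wpM2l => //; rewrite /b le_max lexx.
    have b2 : (1 - s) * psi (- R0) <= (1 - s) * b by apply: ler_wpM2l; rewrite ?/b ?le_max ?lexx ?orbT //; lra.
    lra.
  have h3 : 1 <= expR b * p t by rewrite /p -expRD -[leLHS]expR0 ler_expR; lra.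
  have := ler_wpM2l M10 h3; have := mulr_ge0 k2 (ltW p0); lra.
suff h : upper_tail w t <= p t * (2 / kappa) by have := mulr_ge0 Mb (ltW p0); lra.
have pt := psi0 ht.
rewrite -lee_fin -E EFinM.
have mG a : measurable_fun setT (fun u : R => expR (- (kappa / 4 * (u ^+ 2 - a ^+ 2)))).
  apply: continuous_measurable_fun => x.
  apply: continuous_comp; last exact: continuous_expR.
  apply: continuousN; apply: continuousM; first exact: cst_continuous.
  by apply: continuousB; [exact: exprn_continuous|exact: cst_continuous].
have [t0|t0] := leP 0 t.
  have {}t0 : 0 < t by apply: lt_le_trans R00 _; rewrite -(ger0_norm t0).
  rewrite -(gaussian_tail_integral t0) -ge0_integralZl //; last 3 first.
  - by apply/measurable_EFinP; apply: measurable_funTS; apply: measurable_funM => //; exact: mG.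
  - by move=> u; rewrite /= in_itv /= andbT => tu; rewrite lee_fin mulr_ge0 ?expR_ge0 //; lra.
  - by rewrite lee_fin ltW.
  rewrite [leRHS]integral_mkcond; apply: ge0_le_integral => //.
  - by move=> u _; rewrite lee_fin; exact: stein_numerator_ge0.
  - by have m := mwk t; exact/measurable_EFinP.
  - apply/(measurable_restrictT _ _).1 => //; apply: measurable_funTS.
    apply: emeasurable_funM; first exact: measurable_cst.
    by apply/measurable_EFinP; apply: measurable_funM => //; exact: mG.
  move=> u _; rewrite pker_pos ?(ltW t0) // patchE mem_setE in_itv /= andbT.
  case: ltP => tu /=; last first.
    by rewrite mulr0; case: ifP => // tu'; rewrite -EFinM lee_fin !mulr_ge0 ?expR_ge0 ?(ltW p0) //; lra.
  rewrite (ltW tu) mulr1 -EFinM lee_fin /w mulrCA ler_wpM2l //; first lra.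
  by apply: log_concave_decay => //; rewrite t0 ltW.
rewrite -(gaussian_tail_integralN t0) -ge0_integralZl //; last 3 first.
- by apply/measurable_EFinP; apply: measurable_funTS; apply: measurable_funM => //; exact: mG.
- by move=> u; rewrite /= in_itv /= => tu; rewrite lee_fin mulr_ge0 ?expR_ge0 //; lra.
- by rewrite lee_fin ltW.
rewrite [leRHS]integral_mkcond; apply: ge0_le_integral => //.
- by move=> u _; rewrite lee_fin; exact: stein_numerator_ge0.
- by have m := mwk t; exact/measurable_EFinP.
- apply/(measurable_restrictT _ _).1 => //; apply: measurable_funTS.
  apply: emeasurable_funM; first exact: measurable_cst.
  by apply/measurable_EFinP; apply: measurable_funM => //; exact: mG.
move=> u _; rewrite pker_neg // patchE mem_setE in_itv /=.
case: ltP => tu /=; first by rewrite subrr mulr0.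
rewrite sub0r mulrN1 -EFinM lee_fin /w -mulNr mulrCA ler_wpM2l //; first lra.
by apply: log_concave_decay => //; rewrite t0 tu orbT.
Qed.

End line_stein.

(** * Smooth bumps *)

Section smooth_functions.
Context {R : realType}.

(* The factors [x^-1 ^+ n] make the family closed under differentiation. *)
Definition flat (n : nat) (x : R) : R := if 0 < x then x^-1 ^+ n * expR (- x^-1) else 0.

(** From [e^y >= y^(n+2) / (n+2)!] at [y = 1/x]. A quadratic bound at 0 makes the difference
    quotient there vanish. *)
Lemma flat_bound n x : `|flat n x| <= (n.+2)`!%:R * x ^+ 2.
Proof.
rewrite /flat; case: ltP => x0; last by rewrite normr0 mulr_ge0 ?sqr_ge0.
have y0 : 0 < x^-1 by rewrite invr_gt0.
have yn0 : 0 <= x^-1 ^+ n by apply: exprn_ge0; exact: ltW.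
rewrite ger0_norm ?mulr_ge0 ?expR_ge0 // expRN ler_pdivrMr ?expR_gt0 //.
have fk : 0 < (n.+2`!)%:R :> R by rewrite ltr0n fact_gt0.
have h := expR_ge1Dxn n.+1 (ltW y0).
have {}h : x^-1 ^+ n.+2 <= (n.+2)`!%:R * expR x^-1 by rewrite -ler_pdivrMl // mulrC; lra.
have x2 : 0 < x ^+ 2 by rewrite exprn_gt0.
have E : x^-1 ^+ n = x ^+ 2 * x^-1 ^+ n.+2.
  by rewrite -[n.+2]addn2 exprD mulrCA -exprMn mulfV ?gt_eqF // expr1n mulr1.
rewrite E.
have := ler_wpM2l (ltW x2) h; congr (_ <= _); ring.
Qed.

Lemma is_derive_flat n x : is_derive x (1 : R) (flat n) (flat n.+2 x - n%:R * flat n.+1 x).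
Proof.
have [x0|x0|x0] := ltgtP x 0.
- apply: (@near_eq_is_derive _ _ _ (cst 0)); last first.
    have -> : flat n.+2 x - n%:R * flat n.+1 x = 0.
      by rewrite /flat ltNge (ltW x0) /= mulr0 subr0.
    exact: is_derive_cst.
  near=> y; rewrite /flat ltNge; suff -> : y <= 0 by [].
  by apply: ltW; near: y; exact: lt_nbhsl.
- apply: (@near_eq_is_derive _ _ _ (fun x : R => x^-1 ^+ n * expR (- x^-1))).
    by near=> y; rewrite /flat; suff -> : 0 < y by []; rewrite -oppr_lt0; near: y; apply: Nlt_nbhsl; rewrite oppr_lt0.
  rewrite /flat x0.
  have dV : is_derive x (1 : R) (fun x : R => x^-1) (- x^-1 ^+ 2).
    have := @is_deriveV _ id x 1 1 (lt0r_neq0 x0) (is_derive_id _ _).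
    by move=> /is_derive_eq; apply; rewrite /GRing.scale /= mulr1 exprVn.
  have dF (y : R) : is_derive y (1 : R) (fun y : R => y ^+ n * expR (- y))
      (y ^+ n * - expR (- y) + expR (- y) * (n%:R * y ^+ n.-1)).
    have d1 : is_derive y (1 : R) (fun y : R => y ^+ n) (n%:R * y ^+ n.-1).
      case: n => [|m]; last exact: is_derive_exprn.
      by rewrite mul0r (_ : (fun y => _) = cst 1); [exact: is_derive_cst|apply/funext => z; rewrite expr0].
    have d2 := @is_derive1_comp _ expR -%R y _ _ (is_derive_expR _) (is_deriveNid y 1).
    have := is_deriveM d1 d2; move=> /is_derive_eq; apply; rewrite /GRing.scale /=; ring.
  have := @is_derive1_comp _ (fun y : R => y ^+ n * expR (- y)) (fun x : R => x^-1) x _ _ (dF _) dV.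
  move=> /is_derive_eq; apply; move: (x^-1) => y.
  case: n {dF} => [|m] /=; first by rewrite !expr0 !mul0r; ring.
  by rewrite !exprS; ring.
- rewrite x0.
  have q : (fun h : R => h^-1 *: (flat n (h *: (1 : R) + 0) - flat n 0)) @ 0^' --> (0 : R).
    have F0 : 0 < (n.+2`!)%:R :> R by rewrite ltr0n fact_gt0.
    apply/cvgrPdist_le => e e0; near=> h.
    have h0 : h != 0 by near: h; exact: nbhs_dnbhs_neq.
    have he : `|h| <= e / (n.+2`!)%:R.
      near: h; apply: nbhs_dnbhs; have := @nbhs0_le R R _ (divr_gt0 e0 F0); apply: filterS => y //.
    rewrite sub0r normrN /GRing.scale /= mulr1 addr0 {2}/flat ltxx subr0 normrM normfV.
    rewrite mulrC ler_pdivrMr ?normr_gt0 //; apply: le_trans (flat_bound n h) _.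
    rewrite -(real_normK (num_real h)) expr2 mulrA ler_wpM2r //.
    by rewrite mulrC -ler_pdivlMr.
  have -> : flat n.+2 0 - n%:R * flat n.+1 0 = 0 by rewrite /flat ltxx mulr0 subr0.
  split; first by apply/cvg_ex; exists 0.
  exact: cvg_lim q.
Unshelve. all: by end_near.
Qed.

(** A syntactic class closed under differentiation stands in for infinitely differentiable
    functions. The last constructor admits the primitives used as test functions against the weak
    derivative. *)
Inductive smooth1 : (R -> R) -> Prop :=
| smooth_flat n : smooth1 (flat n)
| smooth_cst c : smooth1 (fun _ => c)
| smooth_add f g : smooth1 f -> smooth1 g -> smooth1 (fun x => f x + g x)
| smooth_mul f g : smooth1 f -> smooth1 g -> smooth1 (fun x => f x * g x)
| smooth_aff a b f : smooth1 f -> smooth1 (fun x => f (a * x + b))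
| smooth_prim F f : smooth1 f -> (forall x, is_derive x (1 : R) F (f x)) -> smooth1 F.

Lemma smooth_derive f : smooth1 f -> exists f', smooth1 f' /\ forall x, is_derive x (1 : R) f (f' x).
Proof.
elim=> {f} [n|c|f g sf [f' [sf' df]] sg [g' [sg' dg]]|f g sf [f' [sf' df]] sg [g' [sg' dg]]|a b f sf [f' [sf' df]]|F f sf [f' _] dF].
- exists (fun x => flat n.+2 x + (- n%:R) * flat n.+1 x); split.
    by apply: smooth_add; [|apply: smooth_mul; [exact: smooth_cst|]]; exact: smooth_flat.
  by move=> x; rewrite mulNr; exact: is_derive_flat.
- by exists (fun=> 0); split; [exact: smooth_cst|move=> x; exact: is_derive_cst].
- exists (fun x => f' x + g' x); split; first exact: smooth_add.
  by move=> x; exact: is_deriveD.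
- exists (fun x => f x * g' x + g x * f' x); split; first by apply: smooth_add; apply: smooth_mul.
  by move=> x; have := is_deriveM (df x) (dg x).
- exists (fun x => a * f' (a * x + b)); split.
    by apply: smooth_mul; [exact: smooth_cst|exact: smooth_aff].
  move=> x.
  have d1 : is_derive x (1 : R) (fun x => a * x + b) a.
    have := is_deriveD (is_deriveZ a (is_derive_id x (1 : R))) (is_derive_cst b x 1).
    by rewrite addr0 /GRing.scale /= mulr1.
  have := @is_derive1_comp _ f (fun x => a * x + b) x _ _ (df _) d1.
  by move=> /is_derive_eq; apply; rewrite mulrC.
- by exists f.
Qed.

Lemma smooth_continuous f : smooth1 f -> continuous f.
Proof. by move=> /smooth_derive[f' [_ df]]; exact: is_derive_continuous df. Qed.

(** Supported in the same interval for every [n]; the factor [n + 1] steepens the edges, so the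
    bumps tend to the indicator of the open interval. *)
Definition sbump (a b : R) (n : nat) (t : R) : R :=
  flat 0 (n.+1%:R * t + - (n.+1%:R * a)) * flat 0 (- n.+1%:R * t + n.+1%:R * b).

Lemma smooth_bump a b n : smooth1 (sbump a b n).
Proof. by apply: smooth_mul; apply: smooth_aff; exact: smooth_flat. Qed.

Lemma flat0_ge0 x : 0 <= flat 0 x.
Proof. by rewrite /flat; case: ifP => // x0; rewrite expr0 mul1r expR_ge0. Qed.

Lemma flat0_le1 x : flat 0 x <= 1.
Proof.
rewrite /flat; case: ltP => // x0; rewrite expr0 mul1r -[leRHS]expR0 ler_expR.
by rewrite oppr_le0 invr_ge0 ltW.
Qed.

Lemma sbump_ge0 a b n t : 0 <= sbump a b n t.
Proof. by rewrite mulr_ge0 ?flat0_ge0. Qed.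

Lemma sbump_le1 a b n t : sbump a b n t <= 1.
Proof. by rewrite /sbump mulr_ile1 ?flat0_ge0 ?flat0_le1. Qed.

Lemma sbumpE a b n t : sbump a b n t = flat 0 (n.+1%:R * (t - a)) * flat 0 (n.+1%:R * (b - t)).
Proof. by rewrite /sbump; congr (flat 0 _ * flat 0 _); ring. Qed.

Lemma flat0_gt0 x : 0 < x -> 0 < flat 0 x.
Proof. by move=> x0; rewrite /flat x0 expr0 mul1r expR_gt0. Qed.

Lemma flat0_npos x : x <= 0 -> flat 0 x = 0.
Proof. by move=> x0; rewrite /flat ltNge x0. Qed.

Lemma sbump_gt0 a b n t : a < t < b -> 0 < sbump a b n t.
Proof.
by move=> /andP[h1 h2]; rewrite sbumpE mulr_gt0 // flat0_gt0 // mulr_gt0 // subr_gt0.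
Qed.

Lemma sbump_out a b n t : ~~ (a < t < b) -> sbump a b n t = 0.
Proof.
rewrite negb_and -!leNgt sbumpE => /orP[] h; last rewrite mulrC.
  by rewrite flat0_npos ?mul0r // pmulr_rle0 // subr_le0.
by rewrite flat0_npos ?mul0r // pmulr_rle0 // subr_le0.
Qed.

Lemma sbump_cvg a b t : sbump a b n t @[n --> \oo] --> ((a < t < b)%R%:R : R).
Proof.
have [h|h] := boolP (a < t < b); last by under eq_fun do rewrite sbump_out //; exact: cvg_cst.
have /andP[h1 h2] := h.
have H c : 0 < c -> flat 0 (n.+1%:R * c) @[n --> \oo] --> (1 : R).
  move=> c0.
  rewrite (_ : (fun n => _) = (fun n => expR (- (n.+1%:R^-1 * c^-1)))); last first.
    by apply/funext => n; rewrite /flat mulr_gt0 // expr0 mul1r invfM.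
  rewrite -[X in _ --> X]expR0; apply: continuous_cvg; first exact: continuous_expR.
  rewrite -[X in _ --> X]oppr0; apply: cvgN; rewrite -[X in _ --> X](mul0r c^-1); apply: cvgMl.
  exact: cvg_harmonic.
rewrite -[X in _ --> X](mulr1 (1 : R)).
under eq_fun do rewrite sbumpE.
by apply: cvgM; apply: H; rewrite subr_gt0.
Qed.

End smooth_functions.

(** * Products of smooth functions of one coordinate as test functions *)

Section product_test_functions.
Context {R : realType} {d : nat}.

Lemma is_derive_coord (psi : 'rV[R]_d -> R) (k : 'I_d) (x : 'rV[R]_d) (l : R) :
  is_derive (x ord0 k) (1 : R) (fun u => psi (upd k u x)) l -> is_derive x (evec k) psi l.
Proof.
have E : (fun h : R => h^-1 *: ((fun u => psi (upd k u x)) (h *: (1:R) + x ord0 k) - (fun u => psi (upd k u x)) (x ord0 k)))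
  = (fun h => h^-1 *: (psi (h *: evec k + x) - psi x)).
  by apply/funext => h /=; rewrite /GRing.scale /= mulr1 upd_line upd_id.
case; rewrite /derivable /derive E => d1 d2; by split.
Qed.

Definition prodf (g : 'I_d -> R -> R) (x : 'rV[R]_d) : R := \prod_i g i (x ord0 i).

Lemma prodf_upd g k u x : prodf g (upd k u x) = g k u * \prod_(i < d | i != k) g i (x ord0 i).
Proof.
rewrite /prodf (bigD1 k) //= upd_same; congr (_ * _).
by apply: eq_bigr => i ik; rewrite upd_neq.
Qed.

Lemma is_derive_prodf g k (g' : R -> R) x : (forall t, is_derive t (1 : R) (g k) (g' t)) ->
  is_derive x (evec k) (prodf g) (prodf (fun i => if i == k then g' else g i) x).
Proof.
move=> dg; apply: is_derive_coord.
rewrite (_ : (fun u => _) = (fun u => (\prod_(i < d | i != k) g i (x ord0 i)) *: g k u)); last first.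
  by apply/funext => u; rewrite prodf_upd mulrC.
have := is_deriveZ (\prod_(i < d | i != k) g i (x ord0 i)) (dg (x ord0 k)).
move=> /is_derive_eq; apply; rewrite -[in RHS](upd_id k x) prodf_upd eqxx /GRing.scale /= mulrC; congr (_ * _).
by apply: eq_bigr => i ik; rewrite (negPf ik).
Qed.

Lemma continuous_prodf g : (forall i, continuous (g i)) -> continuous (prodf g).
Proof.
move=> cg; rewrite /prodf; elim: (index_enum _) => [|i s IH].
  by rewrite (_ : (fun x => _) = cst 1); [exact: cst_continuous|apply/funext => x; rewrite big_nil].
rewrite (_ : (fun x => _) = (fun x : 'rV[R]_d => g i (x ord0 i) * \prod_(j <- s) g j (x ord0 j))); last first.
  by apply/funext => x; rewrite big_cons.
move=> x; apply: (@continuousM R 'rV[R]_d (fun x => g i (x ord0 i))); last exact: IH.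
by apply: continuous_comp; [exact: continuous_coord|exact: cg].
Qed.

Lemma dpart_prodf (s : seq 'I_d) g : (forall i, smooth1 (g i)) ->
  exists h, (forall i, smooth1 (h i)) /\ dpart s (prodf g) = prodf h.
Proof.
move=> sg; elim: s => [|k s [h [sh E]]]; first by exists g.
have [f' [sf' df]] := smooth_derive (sh k).
exists (fun i => if i == k then f' else h i); split; first by move=> i; case: eqP.
rewrite /= -/(dpart s (prodf g)) E; apply/funext => x.
by have [_ ->] := is_derive_prodf x df.
Qed.

Lemma test_fun_prodf g (r : R) : (forall i, smooth1 (g i)) ->
  (forall i t, r < `|t| -> g i t = 0) -> (0 < d)%N -> test_fun (prodf g).
Proof.
move=> sg g0 d0; split.
  move=> s; have [h [sh ->]] := dpart_prodf s sg; split.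
    by apply: continuous_prodf => i; exact: smooth_continuous.
  move=> k x; have [f' [sf' df]] := smooth_derive (sh k).
  by have [] := is_derive_prodf x df.
(* If every coordinate were at most [r] in absolute value, the norm would be at most
   [sqrt d (|r| + 1) <= d (|r| + 1)]. *)
exists (d%:R * (`|r| + 1)) => x rx.
have [i hi] : exists i, r < `|x ord0 i|.
  apply/not_existsP => hh; move: rx; apply/negP; rewrite -leNgt.
  have d1 : 1 <= d%:R :> R by rewrite ler1n.
  have r0 := normr_ge0 r.
  have D0 : 0 <= d%:R * (`|r| + 1) by rewrite mulr_ge0 //; lra.
  rewrite /enorm -[leRHS]ger0_norm // -sqrtr_sqr ler_sqrt ?sqr_ge0 //.
  apply: (@le_trans _ _ (\sum_(i < d) (`|r| + 1) ^+ 2)).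
    apply: ler_sum => i _; rewrite -(real_normK (num_real (x ord0 i))).
    rewrite lerXn2r ?nnegrE ?addr_ge0 //.
    have /negP := hh i; rewrite -leNgt => xr; have := ler_norm r; lra.
  rewrite sumr_const card_ord -[leLHS]mulr_natl exprMn; apply: ler_wpM2r; first exact: sqr_ge0.
  by rewrite expr2 ler_peMr //; lra.
by rewrite /prodf (bigD1 i) //= g0 // mul0r.
Qed.

End product_test_functions.

(** * A locally integrable function orthogonal to all product bumps is null *)

Section box_zero.
Context {R : realType} {d : nat}.
Local Notation V := (Vsp R d).

Definition obox (a b : 'I_d -> R) : set V := [set x : V | forall i, a i < x ord0 i < b i].

Definition oboxes : set (set V) := [set A | exists a b, A = obox a b].

Lemma measurable_obox a b : measurable (obox a b).
Proof.
have H := @measurable_cyl R d (enum 'I_d) (fun i => [set` `]a i, b i[]).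
have -> : obox a b = [set x : V | forall i, i \in enum 'I_d -> [set` `]a i, b i[] (x ord0 i)].
  apply/seteqP; split=> x /= h i; first by move=> _; rewrite in_itv /=; exact: h.
  by have := h i; rewrite mem_enum in_itv /=; apply.
by apply: H => i; exact: measurable_itv.
Qed.

Lemma oboxI a b a' b' : obox a b `&` obox a' b' =
  obox (fun i => Num.max (a i) (a' i)) (fun i => Num.min (b i) (b' i)).
Proof.
apply/seteqP; split => [x [h h'] i|x h]; last split => i; have := h i; rewrite ?gt_max ?lt_min.
- by have := h' i => /andP[-> ->] /andP[-> ->].
- by move=> /andP[/andP[-> _] /andP[-> _]].
- by move=> /andP[/andP[_ ->] /andP[_ ->]].
Qed.

Lemma coord_bound (x : 'rV[R]_d) : exists n : nat, forall i, `|x ord0 i| < n%:R.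
Proof.
exists (Num.bound (\sum_i `|x ord0 i|)) => i.
apply: le_lt_trans (archi_boundP _); last exact: sumr_ge0.
by rewrite (bigD1 i) //= lerDl sumr_ge0.
Qed.

Lemma measurable_oboxes : @measurable _ V = <<s oboxes >>.
Proof.
apply/seteqP; split; last first.
  by apply: smallest_sub; [exact: sigma_algebra_measurable|move=> _ [a [b ->]]; exact: measurable_obox].
apply: smallest_sub; first exact: smallest_sigma_algebra.
move=> _ [i [B [mB ->]]].
suff : measurable_fun setT (fun x : g_sigma_algebraType oboxes => x ord0 i).
  by move=> /(_ measurableT B mB); rewrite setTI.
apply: (measurability _ (RGenOInfty.measurableE R)) => _ [_ [c ->] <-].
rewrite setTI.
have -> : (fun x : 'rV[R]_d => x ord0 i) @^-1` [set` `]c, +oo[] =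
  \bigcup_n obox (fun k => if k == i then c else - n%:R) (fun k => n%:R).
  apply/seteqP; split => [x /=|x [n _ /= h]]; rewrite /= in_itv /= andbT.
    move=> cx; have [n xn] := coord_bound x; exists n => // k.
    have := xn k; rewrite ltr_norml => /andP[h1 h2]; rewrite h2 andbT.
    by case: eqP => [->|].
  by have := h i; rewrite eqxx => /andP[].
by apply: bigcup_measurable => n _; apply: sub_sigma_algebra; eexists; eexists.
Qed.

(** Open boxes are stable under intersection and generate the sigma-algebra, so the Dynkin argument
    extends the vanishing to all measurable sets; the vanishing on the whole space handles
    complements. *)
Lemma integral_oboxes_eq0 (h : V -> R) : lebV.-integrable setT (EFin \o h) ->
  (\int[lebV]_x (h x)%:E = 0)%E ->
  (forall a b, \int[lebV]_(x in obox a b) (h x)%:E = 0)%E ->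
  {ae lebV, forall x, h x = 0}.
Proof.
move=> ih h0 hb.
have H (S : set V) : measurable S -> (\int[lebV]_(x in S) (h x)%:E = 0)%E.
  rewrite measurable_oboxes; apply: (@dynkin_induction _ V oboxes (fun S => \int[lebV]_(x in S) (h x)%:E = 0)%E).
  - exact: measurable_oboxes.
  - by move=> _ _ [a [b ->]] [a' [b' ->]]; rewrite oboxI; eexists; eexists.
  - exact: h0.
  - by move=> _ [a [b ->]]; exact: hb.
  - move=> U mU U0.
    have := @integral_setU_EFin _ _ _ (@lebV R d) U (~` U) h mU (measurableC mU).
    rewrite setUv h0 U0 add0e => <- //.
    + by apply/measurable_EFinP; exact: measurable_int ih.
    + by apply/disj_setPCl.
  - move=> F mF tF F0; rewrite integral_bigcup //; last first.
      by apply: integrableS ih => //; exact: bigcup_measurable.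
    by apply: eseries0 => n _ _; exact: F0.
have := @integral_ae_eq _ _ _ (@lebV R d) setT measurableT (cst 0%E) (EFin \o h) ih (measurable_cst _).
move=> /(_ _); case=> [E _ mE|N [mN N0 HN]].
  by rewrite (H E mE) integral0.
exists N; split => // x hx; apply: HN => /=.
by move=> hh; apply: hx; have [] := hh I.
Qed.

Lemma obox_box a b : exists r : R, obox a b `<=` (box r : set V).
Proof.
exists (\sum_i (`|a i| + `|b i|)) => x h i; have := h i => /andP[h1 h2].
have H : `|a i| + `|b i| <= \sum_i (`|a i| + `|b i|).
  by rewrite [leRHS](bigD1 i) //= lerDl sumr_ge0 // => k _; rewrite addr_ge0.
apply: le_trans H; have a1 := ler_norm (- a i); have b1 := ler_norm (b i).
have a0 := normr_ge0 (a i); have b0 := normr_ge0 (b i).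
rewrite normrN in a1; rewrite ler_norml; apply/andP; split; lra.
Qed.

Lemma prodf_bump_out a b n x : ~ obox a b x -> prodf (fun i => sbump (a i) (b i) n) x = 0.
Proof.
move=> h; have [i hi] : exists i, ~ (a i < x ord0 i < b i) by apply/existsNP.
by rewrite /prodf (bigD1 i) //= sbump_out ?mul0r //; apply/negP.
Qed.

Lemma prodf_bump_le1 a b n (x : V) : `|prodf (fun i => sbump (a i) (b i) n) x| <= 1.
Proof.
rewrite ger0_norm; last by apply: prodr_ge0 => i _; exact: sbump_ge0.
by apply: prodr_ile1 => i _; rewrite sbump_ge0 sbump_le1.
Qed.

Lemma prodf_bump_cvg a b (x : V) :
  prodf (fun i => sbump (a i) (b i) n) x @[n --> \oo] --> (\1_(obox a b) x : R).
Proof.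
have -> : (\1_(obox a b) x : R) = \prod_i ((a i < x ord0 i < b i)%R%:R).
  rewrite indicE; have [h|h] := boolP (x \in obox a b).
    by rewrite big1 // => i _; have /set_mem := h => /(_ i) ->.
  have [i hi] : exists i, ~ (a i < x ord0 i < b i) by apply/existsNP => hh; move: h; rewrite notin_setE.
  by rewrite (bigD1 i) //=; have /negP/negPf -> := hi; rewrite mul0r.
rewrite /prodf; elim: (index_enum _) => [|i s IH].
  by rewrite big_nil; under eq_fun do rewrite big_nil; exact: cvg_cst.
rewrite big_cons; under eq_fun do rewrite big_cons.
by apply: cvgM => //; exact: sbump_cvg.
Qed.

Lemma measurable_prodf (g : 'I_d -> R -> R) : (forall i, measurable_fun setT (g i)) ->
  measurable_fun setT (prodf g : V -> R).
Proof.
move=> mg; apply: (@measurable_prod _ _ _ _ _ _ (fun k (x : V) => g k (x ord0 k))) => k _.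
by apply: measurableT_comp => //; exact: measurable_coord.
Qed.

Lemma measurable_bump a b n : measurable_fun setT (sbump a b n : R -> R).
Proof. by apply: continuous_measurable_fun; apply: smooth_continuous; exact: smooth_bump. Qed.

Variable h : V -> R.
Hypothesis mh : measurable_fun setT h.
Hypothesis ih : forall r, lebV.-integrable (box r) (EFin \o h).
Hypothesis hbump : forall a b n, (\int[lebV]_x (h x * prodf (fun i => sbump (a i) (b i) n) x)%:E = 0)%E.

Lemma integral_obox_eq0 a b : (\int[lebV]_(x in obox a b) (h x)%:E = 0)%E.
Proof.
have [r br] := obox_box a b.
have mb := @measurable_box R d r.
pose g := (fun x : V => `|h x| * \1_(box r) x).
have ig : lebV.-integrable setT (EFin \o g).
  have := integrable_abse (ih r); rewrite integrable_mkcond //; apply: eq_integrable => // x _.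
  by rewrite patchE /g /= indicE; case: ifP => _; rewrite ?mulr1 ?mulr0.
pose f_ n (x : V) := (h x * prodf (fun i => sbump (a i) (b i) n) x)%:E.
have mf_ n : measurable_fun setT (f_ n).
  by apply/measurable_EFinP; apply: measurable_funM => //; apply: measurable_prodf => i; exact: measurable_bump.
have mf : measurable_fun setT (fun x : V => (h x * \1_(obox a b) x)%:E).
  apply/measurable_EFinP; apply: measurable_funM => //.
  by apply: measurable_indic; exact: measurable_obox.
have := @dominated_cvg _ _ _ (@lebV R d) setT measurableT f_ (fun x => (h x * \1_(obox a b) x)%:E) (EFin \o g) mf_.
move=> /(_ _ _ ig _) H.
have {}H : (fun=> 0%E : \bar R) @ \oo --> (\int[lebV]_x (h x * \1_(obox a b) x)%:E)%E.
  rewrite (_ : (fun=> 0%E) = (fun n => \int[lebV]_(x in setT) f_ n x)%E); last by apply/funext => n; rewrite hbump.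
  apply: H.
  - move=> x _; apply/fine_cvgP; split; first exact: nearW.
    by apply: cvgM; [exact: cvg_cst|exact: prodf_bump_cvg].
  - by [].
  - move=> n x _; rewrite /f_ /= lee_fin normrM; apply: ler_wpM2l => //.
    rewrite indicE; have [h1|h1] := boolP (x \in (box r : set V)); first exact: prodf_bump_le1.
    rewrite prodf_bump_out ?normr0 // => xo; move: h1; rewrite notin_setE; apply; exact: br.
have := cvg_unique _ H (cvg_cst _) => <- //.
rewrite integral_mkcond; apply: eq_integral => x _.
by rewrite patchE indicE; case: ifP => _; rewrite ?mulr1 ?mulr0.
Qed.

(** [h] is only locally integrable, so it is first cut off to the boxes of side [2N]; a box cut by a
    box is a box, and countably many null sets remain null. *)
Lemma bumps_ae_eq0 : {ae lebV, forall x, h x = 0}.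
Proof.
have aeN (N : nat) : {ae lebV, forall x, (h x * \1_(obox (fun=> - N%:R) (fun=> N%:R)) x) = 0}.
  pose B := obox (fun=> - N%:R) (fun=> N%:R).
  have mB : measurable B by exact: measurable_obox.
  have E (U : set V) : measurable U -> (\int[lebV]_(x in U) (h x * \1_B x)%:E = \int[lebV]_(x in U `&` B) (h x)%:E)%E.
    move=> mU; rewrite integral_mkcondr; apply: eq_integral => x _.
    by rewrite patchE indicE; case: ifP => _; rewrite ?mulr1 ?mulr0.
  apply: integral_oboxes_eq0.
  - have [r br] := obox_box (fun=> - N%:R) (fun=> N%:R).
    have : lebV.-integrable B (EFin \o h).
      by apply: (integrableS _ mB br (ih r)); exact: measurable_box.
    rewrite integrable_mkcond //; apply: eq_integrable => // x _.
    by rewrite patchE /= indicE; case: ifP => _; rewrite ?mulr1 ?mulr0.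
  - by rewrite E // setTI integral_obox_eq0.
  - by move=> a b; rewrite E ?oboxI ?integral_obox_eq0 //; exact: measurable_obox.
have /ae_foralln := aeN; apply: filterS => x H.
have [n xn] := coord_bound x; have := H n; rewrite indicE mem_set ?mulr1 // => i.
by have := xn i; rewrite ltr_norml.
Qed.

End box_zero.

(** * Weak derivatives on lines *)

Section local_integrability_line.
Context {R : realType}.
Local Notation leb := (@lebesgue_measure R).
Local Notation ind b := ((nat_of_bool b)%:R : R).

Lemma segment_lty (c : R) : (leb [set` `[(- c)%R, c]] < +oo)%E.
Proof.
have h : leb `[- c, c]%classic = _ := lebesgue_measure_itv `[- c, c].
by rewrite h /=; case: ifP => // _; rewrite -EFinB ltry.
Qed.

Definition line_loc_int (g : R -> R) := measurable_fun setT g /\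
  forall N : nat, leb.-integrable setT (EFin \o (fun t => g t * ind (`|t| <= N%:R)%R)).

Lemma measurable_ind_le (c : R) : measurable_fun setT (fun t : R => ind (`|t| <= c)%R).
Proof. by apply: measurable_bool_ind; apply: measurable_fun_ler => //; exact: measurable_cst. Qed.

Lemma line_loc_int_mul (g c : R -> R) (B : R) (N : nat) : line_loc_int g ->
  measurable_fun setT c -> (forall t, `|c t| <= B) -> (forall t, N%:R < `|t| -> c t = 0) ->
  leb.-integrable setT (EFin \o (fun t => g t * c t)).
Proof.
move=> [mg ig] mc cB c0; have := integrable_mul_bounded (ig N) mc cB.
apply: eq_integrable => // t _ /=; congr _%:E; case: (leP `|t| N%:R) => tN /=; first by rewrite mulr1.
by rewrite mulr0 mul0r c0 // mulr0.
Qed.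

Lemma pker_out (u t : R) : `|u| < `|t| -> pker u t = 0.
Proof.
rewrite /pker => ut.
have -> : (0 <= t < u) = false.
  apply/negP => /andP[h1 h2]; move: ut; rewrite !ger0_norm //; lra.
have -> : (u <= t < 0) = false.
  apply/negP => /andP[h1 h2]; move: ut; rewrite !ltr0_norm //; lra.
by rewrite subr0.
Qed.

Lemma measurable_pker_r u : measurable_fun setT (fun t => pker u t : R).
Proof. exact: (measurableT_comp measurable_pker (pair1_measurable u)). Qed.

Lemma integrable_pker (g : R -> R) u : line_loc_int g ->
  leb.-integrable setT (EFin \o (fun t => pker u t * g t)).
Proof.
move=> lg; have [N uN] : exists N : nat, `|u| < N%:R.
  by exists (Num.bound `|u|); exact: archi_boundP.
have := @line_loc_int_mul g (pker u) 1 N lg (measurable_pker_r u) (pker_le1 u) (fun t h => pker_out (lt_trans uN h)).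
by apply: eq_integrable => // t _ /=; rewrite mulrC.
Qed.

Lemma measurable_prim (g : R -> R) : measurable_fun setT g -> measurable_fun setT (prim g).
Proof.
move=> mg; rewrite /prim /Rintegral; apply: measurableT_comp => //.
apply: (@measurable_fun_integral R _ _ (fun p : R * R => (pker p.1 p.2 * g p.2)%:E)).
apply/measurable_EFinP; apply: measurable_funM; first exact: measurable_pker.
by apply: measurableT_comp => //; exact: measurable_snd.
Qed.

Lemma prim_bound (g : R -> R) (u : R) (N : nat) : line_loc_int g -> `|u| <= N%:R ->
  `|prim g u| <= fine (\int[leb]_t `|(g t * ind (`|t| <= N%:R)%R)%:E|)%E.
Proof.
move=> lg uN; have [mg ig] := lg; have ip := integrable_pker u lg.
have fN : (\int[leb]_t `|(g t * ind (`|t| <= N%:R)%R)%:E| \is a fin_num)%E.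
  rewrite ge0_fin_numE; last by apply: integral_ge0.
  by have /integrableP[] := ig N.
rewrite -lee_fin fineK // -abse_EFin /prim /Rintegral fineK; last exact: (integrable_fin_num measurableT ip).
apply: le_trans (le_abse_integral _ measurableT (measurable_int _ ip)) _.
apply: ge0_le_integral => //.
- by apply: measurableT_comp => //; exact: (measurable_int _ ip).
- by apply: measurableT_comp => //; exact: (measurable_int _ (ig N)).
move=> t _; rewrite /= lee_fin !normrM; case: (leP `|t| N%:R) => tN /=.
  by rewrite normr1 mulr1 ler_piMl //; exact: pker_le1.
by rewrite pker_out ?normr0 ?mul0r ?mulr0 //; exact: le_lt_trans tN.
Qed.

Lemma line_loc_int_prim (g : R -> R) : line_loc_int g -> line_loc_int (prim g).
Proof.
move=> lg; have mp := measurable_prim (proj1 lg); split => // N.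
apply: (@integrable_bounded_supp _ _ _ leb `[- N%:R, N%:R]%classic _
  (fine (\int[leb]_t `|(g t * ind (`|t| <= N%:R)%R)%:E|)%E)) => //.
- exact: segment_lty.
- by apply: measurable_funM => //; exact: measurable_ind_le.
- move=> t /=; rewrite in_itv /= => /negP; rewrite -ler_norml => /negPf -> /=; rewrite mulr0 //.
- move=> t; rewrite /= in_itv /= -ler_norml => tN; rewrite tN mulr1; exact: prim_bound.
Qed.

Lemma line_loc_intB (f g : R -> R) : line_loc_int f -> line_loc_int g -> line_loc_int (fun t => f t - g t).
Proof.
move=> [mf jf] [mg ig]; split; first exact: measurable_funB.
move=> N; have := integrableB measurableT (jf N) (ig N).
by apply: eq_integrable => // t _ /=; rewrite mulrBl.
Qed.

Section by_parts.
Variables (g a : R -> R) (N : nat) (K : R).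
Hypothesis lg : line_loc_int g.
Hypothesis ma : measurable_fun setT a.
Hypothesis aK : forall t, `|a t| <= K.
Hypothesis aN : forall t, N%:R < `|t| -> a t = 0.

Lemma integrable_compact : leb.-integrable setT (EFin \o a).
Proof.
apply: (@integrable_bounded_supp _ _ _ leb `[- N%:R, N%:R]%classic _ K) => //.
- exact: segment_lty.
- by move=> t /=; rewrite in_itv /= => /negP; rewrite -ler_norml -ltNge; exact: aN.
Qed.

(** [pker u t] is nonzero only for [|t| <= |u|], so on the support of [a] the double integral is
    dominated by the mass of [|a|] times that of [|g|] on [[-N, N]]. *)
Lemma primitive_by_parts : (\int[leb]_u (a u)%:E = 0)%E ->
  (\int[leb]_u (a u * prim g u)%:E = \int[leb]_t (upper_tail a t * g t)%:E)%E.
Proof.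
move=> a0; have ia := integrable_compact; have [mg ig] := lg.
apply: primitive_fubini => //; first by move=> u; exact: integrable_pker.
pose I := (\int[leb]_u `|(a u)%:E|)%E.
have Ifin : I \is a fin_num.
  rewrite ge0_fin_numE; last by apply: integral_ge0.
  by have /integrableP[] := ia.
apply: (@le_lt_trans _ _ (\int[leb]_t (I * `|(g t * ind (`|t| <= N%:R)%R)%:E|))%E).
  apply: ge0_le_integral => //.
  - by move=> t _; apply: integral_ge0.
  - apply: (@measurable_fun_integral R _ _ (fun p : R * R => `|(a p.2 * pker p.2 p.1 * g p.1)%:E|)%E).
    apply: measurableT_comp => //; apply/measurable_EFinP; apply: measurable_funM; first apply: measurable_funM.
    + by apply: measurableT_comp => //; exact: measurable_snd.
    + exact: (measurableT_comp measurable_pker (@measurable_swap _ _ _ _)).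
    + by apply: measurableT_comp => //; exact: measurable_fst.
  - apply: emeasurable_funM; first exact: measurable_cst.
    by apply: measurableT_comp => //; exact: (measurable_int _ (ig N)).
  move=> t _; case: (leP `|t| N%:R) => tN /=; last first.
    rewrite integral0_eq ?mulr0 ?normr0 ?mule0 // => u _.
    have [uN|uN] := leP `|u| N%:R; last by rewrite aN // !mul0r normr0.
    by rewrite pker_out ?mulr0 ?mul0r ?normr0 //; exact: le_lt_trans tN.
  rewrite mulr1 /I -ge0_integralZr //; last by apply: measurableT_comp => //; exact: measurable_int ia.
  apply: ge0_le_integral => //.
  - apply/measurable_EFinP; apply: measurableT_comp => //; apply: measurable_funM; last exact: measurable_cst.
    by apply: measurable_funM => //; exact: (measurableT_comp measurable_pker (pair2_measurable _)).
  - apply: emeasurable_funM; last exact: measurable_cst.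
    by apply: measurableT_comp => //; exact: measurable_int ia.
  move=> u _; rewrite abse_EFin -EFinM lee_fin !normrM ler_wpM2r // ler_piMr //; exact: pker_le1.
rewrite ge0_integralZl //.
- apply: lte_mul_pinfty => //; first exact: integral_ge0.
  by have /integrableP[] := ig N.
- by apply: measurableT_comp => //; exact: (measurable_int _ (ig N)).
- exact: integral_ge0.
Qed.

(** As the total integral is 0, minus the upper tail is the primitive from minus infinity; by the
    same token it vanishes beyond the support on either side. *)
Lemma lower_primitiveE t : (\int[leb]_u (a u)%:E = 0)%E ->
  (\int[leb]_(u in [set` Interval -oo%O (BRight t)]) a u)%R = - upper_tail a t.
Proof.
move=> a0; have ia := integrable_compact.
have mi : measurable_fun setT (fun u => ind (t < u)%R).
  by apply: measurable_bool_ind; apply: measurable_fun_ltr => //; exact: measurable_cst.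
have i1 : leb.-integrable setT (EFin \o (fun u => a u * ind (t < u)%R)).
  by apply: (integrable_mul_bounded (B := 1)) => // u; case: (t < u); rewrite /= ?normr1 ?normr0.
have z : (\int[leb]_u a u)%R = 0 by rewrite /Rintegral a0.
rewrite /upper_tail -[RHS]add0r -[X in X - _]z -RintegralB // Rintegral_mkcond.
congr Rintegral; apply/funext => u; rewrite patchE mem_setE in_itv /=.
by case: leP => h /=; rewrite ?mulr0 ?subr0 // mulr1 subrr.
Qed.

Lemma is_derive_upper_tail t : (\int[leb]_u (a u)%:E = 0)%E -> continuous a ->
  is_derive t (1 : R) (fun t => - upper_tail a t) (a t).
Proof.
move=> a0 ca; have ia := integrable_compact.
have tt : t < t + 1 by lra.
have iu : leb.-integrable [set` Interval -oo%O (BRight (t + 1))] (EFin \o a).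
  exact: (integrableS measurableT _ _ ia).
have [] := @continuous_FTC1 R a (BInfty R true) t (t + 1) tt iu (ltNyr t) (ca t).
rewrite (_ : (fun x => _) = (fun t => - upper_tail a t)); last by apply/funext => x; exact: lower_primitiveE.
by rewrite derive1E => d1 d2; split.
Qed.

Lemma upper_tail_out t : (\int[leb]_u (a u)%:E = 0)%E -> N%:R < `|t| -> upper_tail a t = 0.
Proof.
move=> a0 tN; have z : (\int[leb]_u a u)%R = 0 by rewrite /Rintegral a0.
have [t0|t0] := leP 0 t.
  rewrite /upper_tail (_ : (fun u => _) = cst 0) ?Rintegral_cst // ?mul0r //.
  apply/funext => u; case: ltP => tu /=; last by rewrite mulr0.
  by rewrite aN ?mul0r // ger0_norm; [rewrite ger0_norm // in tN; lra|lra].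
rewrite -z /upper_tail; congr Rintegral; apply/funext => u; case: ltP => tu /=; first by rewrite mulr1.
by rewrite mulr0 aN // ltr0_norm; [rewrite ltr0_norm // in tN; lra|lra].
Qed.

Lemma upper_tail_bound t : `|upper_tail a t| <= fine (\int[leb]_u `|(a u)%:E|)%E.
Proof.
have ia := integrable_compact.
have mi : measurable_fun setT (fun u => ind (t < u)%R).
  by apply: measurable_bool_ind; apply: measurable_fun_ltr => //; exact: measurable_cst.
have i1 : leb.-integrable setT (EFin \o (fun u => a u * ind (t < u)%R)).
  by apply: (integrable_mul_bounded (B := 1)) => // u; case: (t < u); rewrite /= ?normr1 ?normr0.
have fN : (\int[leb]_u `|(a u)%:E| \is a fin_num)%E.
  rewrite ge0_fin_numE; last by apply: integral_ge0.
  by have /integrableP[] := ia.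
rewrite -lee_fin fineK // -abse_EFin /upper_tail /Rintegral fineK; last exact: (integrable_fin_num measurableT i1).
apply: le_trans (le_abse_integral _ measurableT (measurable_int _ i1)) _.
apply: ge0_le_integral => //.
- by apply: measurableT_comp => //; exact: (measurable_int _ i1).
- by apply: measurableT_comp => //; exact: (measurable_int _ ia).
by move=> u _; rewrite /= lee_fin normrM; case: (t < u) => /=; rewrite ?normr1 ?normr0 ?mulr1 ?mulr0.
Qed.

(** The right side is the weak-derivative pairing for the test function [- upper_tail a], whose
    derivative is [a]. *)
Lemma line_residual_by_parts (f : R -> R) : line_loc_int f -> (\int[leb]_u (a u)%:E = 0)%E -> continuous a ->
  (\int[leb]_u ((f u - prim g u) * a u))%R = (\int[leb]_u (f u * a u + g u * (- upper_tail a u)))%R.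
Proof.
move=> lf a0 ca; have lp := line_loc_int_prim lg.
have i1 := line_loc_int_mul lf ma aK aN.
have i2 := line_loc_int_mul lp ma aK aN.
have mt : measurable_fun setT (upper_tail a).
  have : continuous (fun t => - upper_tail a t).
    by apply: is_derive_continuous => t; exact: is_derive_upper_tail.
  move=> /continuous_measurable_fun h; have := measurableT_comp (@oppr_measurable R setT) h.
  by apply: eq_measurable_fun => t _ /=; rewrite opprK.
have i3 := line_loc_int_mul lg mt upper_tail_bound (fun t => upper_tail_out a0 (t := t)).
have bp := primitive_by_parts a0.
have bp' : (\int[leb]_u (prim g u * a u))%R = (\int[leb]_u (g u * upper_tail a u))%R.
  rewrite /Rintegral; congr fine.
  transitivity (\int[leb]_u (a u * prim g u)%:E)%E; first by apply: eq_integral => u _; rewrite mulrC.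
  by rewrite bp; apply: eq_integral => u _; rewrite mulrC.
transitivity ((\int[leb]_u (f u * a u))%R - (\int[leb]_u (g u * upper_tail a u))%R).
  by rewrite -bp' -RintegralB //; congr Rintegral; apply/funext => u; rewrite mulrBl.
by rewrite -RintegralB //; congr Rintegral; apply/funext => u; rewrite mulrN.
Qed.

End by_parts.

End local_integrability_line.

(** * Local integrability of slices *)

Section slices.
Context {R : realType} {d : nat}.
Local Notation V := (Vsp R d).
Local Notation leb := (@lebesgue_measure R).
Local Notation ind b := ((nat_of_bool b)%:R : R).

Definition vec_loc_int (F : V -> R) := measurable_fun setT F /\
  forall r : R, lebV.-integrable (box r) (EFin \o F).

Lemma vec_loc_int_indic (F : V -> R) r : vec_loc_int F ->
  lebV.-integrable setT (EFin \o (fun x => F x * \1_(box r) x)).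
Proof.
move=> [_ /(_ r)]; rewrite integrable_mkcond; last exact: measurable_box.
apply: eq_integrable => // x _; rewrite patchE /= indicE.
by case: ifP => _; rewrite ?mulr1 ?mulr0.
Qed.

Lemma box_upd (j : 'I_d) (t r : R) (x : V) : 0 <= r ->
  (\1_(box r) (upd j t x) : R) = ind (`|t| <= r)%R * \1_(box r) (upd j 0 x).
Proof.
move=> r0; rewrite !indicE; case: (leP `|t| r) => tr /=; rewrite ?mul1r ?mul0r.
  congr (_ %:R); congr nat_of_bool; apply/idP/idP => /set_mem h; apply/mem_set => i; have := h i.
    by have [->|ij] := eqVneq i j; rewrite ?upd_same ?normr0 // !upd_neq.
  by have [->|ij] := eqVneq i j; rewrite ?upd_same // !upd_neq.
by rewrite memNset // => /(_ j); rewrite upd_same => /(lt_le_trans tr); rewrite ltxx.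
Qed.

Lemma ae_line_loc_int (j : 'I_d) (F : V -> R) : vec_loc_int F ->
  {ae nuV j, forall x, line_loc_int (fun t => F (upd j t x))}.
Proof.
move=> lF; have [mF _] := lF.
have /ae_foralln : forall N : nat, {ae nuV j, forall x, leb.-integrable setT
    (fun t => (F (upd j t x) * \1_(box N%:R) (upd j t x))%:E)}.
  by move=> N; have := lebV_ae_integrable j (vec_loc_int_indic N%:R lF).
apply: filterS => x H; split; first exact: (measurableT_comp mF (measurable_upd_val j x)).
(* Enlarging the box to contain the other coordinates of [x] reduces its indicator to a condition on
   [t] alone. *)
move=> N; have [n xn] := coord_bound x; pose N' := maxn N n.
have NN : (N%:R <= N'%:R :> R) by rewrite ler_nat leq_maxl.
have nN : (n%:R <= N'%:R :> R) by rewrite ler_nat leq_maxr.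
have B1 : \1_(box N'%:R) (upd j 0 x) = 1 :> R.
  rewrite indicE mem_set // => i; have [->|ij] := eqVneq i j; first by rewrite upd_same normr0.
  by rewrite upd_neq //; apply: le_trans nN; exact: ltW.
have := integrable_mul_bounded (H N') (measurable_ind_le N%:R) (B := 1).
have i1 (u : R) : `|ind (`|u| <= N%:R)%R| <= 1 by case: (leP `|u| N%:R) => _ /=; rewrite ?normr1 ?normr0.
move=> /(_ i1); apply: eq_integrable => // t _ /=; congr _%:E.
rewrite box_upd // B1 mulr1; case: (leP `|t| N%:R) => tN /=; last by rewrite !mulr0.
by rewrite (le_trans tN NN) /= !mulr1.
Qed.

(** A local L1 norm along the line through [x]. It dominates both the primitive and the weighted
    mean of a slice, and is constant along the line, so its integral over a box is that of [|F|]
    times a length. *)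
Definition slice_norm (j : 'I_d) (F : V -> R) (N : nat) (x : V) : \bar R :=
  (\int[leb]_t `|(F (upd j t x) * ind (`|t| <= N%:R)%R)%:E|)%E.

Lemma measurable_slice_norm j F N : measurable_fun setT F -> measurable_fun setT (slice_norm j F N).
Proof.
move=> mF.
apply: (@measurable_fun_integral R _ V (fun p : V * R => `|(F (upd j p.2 p.1) * ind (`|p.2| <= N%:R)%R)%:E|)%E).
apply: measurableT_comp => //; apply/measurable_EFinP; apply: measurable_funM.
  exact: (measurableT_comp mF (measurableT_comp (measurable_updp j) (@measurable_swap _ _ _ _))).
exact: (measurableT_comp (measurable_ind_le N%:R) measurable_snd).
Qed.

Lemma slice_norm_upd j F N u x : slice_norm j F N (upd j u x) = slice_norm j F N x.
Proof. by apply: eq_integral => t _; rewrite upd_upd. Qed.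

Lemma slice_norm_ge0 j F N x : (0 <= slice_norm j F N x)%E.
Proof. exact: integral_ge0. Qed.

Lemma slice_norm_box j (F : V -> R) (N : nat) : vec_loc_int F ->
  (\int[lebV]_x (slice_norm j F N x * (\1_(box N%:R) x)%:E) < +oo)%E.
Proof.
move=> lF; have [mF _] := lF.
have mB : measurable_fun setT (fun x : V => (\1_(box N%:R) x)%:E : \bar R).
  by apply/measurable_EFinP; apply: measurable_indic; exact: measurable_box.
have mS := measurable_slice_norm j N mF.
rewrite (lebV_split_ge0 j); last 2 first.
- by apply: emeasurable_funM.
- by move=> x; rewrite mule_ge0 ?slice_norm_ge0 ?lee_fin.
pose c := leb [set` `[(- N%:R)%R, N%:R]].
have c0 : (0 <= c)%E by exact: measure_ge0.
have cfin : c \is a fin_num by rewrite ge0_fin_numE // segment_lty.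
have mi : measurable_fun setT (fun t : R => (ind (`|t| <= N%:R)%R)%:E).
  by apply/measurable_EFinP; exact: measurable_ind_le.
have cE : (\int[leb]_t (ind (`|t| <= N%:R)%R)%:E = c)%E.
  rewrite /c -[RHS]mul1e -integral_cst // integral_mkcond; apply: eq_integral => t _.
  by rewrite patchE mem_setE in_itv /= -ler_norml; case: (_ <= _).
rewrite (eq_integral (fun x => (c * (slice_norm j F N x * (\1_(box N%:R) (upd j 0 x))%:E))%E)) /=; last first.
  move=> x _.
  under eq_integral => u _ do rewrite slice_norm_upd box_upd // EFinM muleCA.
  by rewrite ge0_integralZr // ?cE // mule_ge0 ?slice_norm_ge0 // lee_fin.
have mS' : measurable_fun setT (fun x : V => slice_norm j F N x * (\1_(box N%:R) (upd j 0 x))%:E)%E.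
  by apply: emeasurable_funM => //; exact: (measurableT_comp mB (measurable_upd j 0)).
have S0 x : (0 <= slice_norm j F N x * (\1_(box N%:R) (upd j 0 x))%:E)%E.
  by rewrite mule_ge0 ?slice_norm_ge0 ?lee_fin.
rewrite ge0_integralZl //; apply: lte_mul_pinfty => //.
have /integrableP[mi' fin] := vec_loc_int_indic N%:R lF.
apply: le_lt_trans fin; rewrite (lebV_split_ge0 j) //; last by apply: measurableT_comp.
have mslice x : measurable_fun setT (fun t : R => `|(F (upd j t x) * ind (`|t| <= N%:R)%R)%:E|%E).
  apply: measurableT_comp => //; apply/measurable_EFinP; apply: measurable_funM; last exact: measurable_ind_le.
  exact: (measurableT_comp mF (measurable_upd_val j x)).
rewrite le_eqVlt; apply/orP; left; apply/eqP; apply: eq_integral => x _.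
rewrite /slice_norm -(@ge0_integralZr _ _ _ leb setT measurableT _ (mslice x)) ?lee_fin //.
apply: eq_integral => t _; by rewrite /= box_upd // -EFinM; congr _%:E; rewrite mulrA [RHS]normrM [`|\1_(_) _|]ger0_norm.
Qed.

Lemma vec_loc_int_dom j (F H : V -> R) (c : R) : vec_loc_int F -> measurable_fun setT H -> 0 <= c ->
  (forall (N : nat) x, (0 < N)%N -> box N%:R x -> (`|H x|%:E <= c%:E * slice_norm j F N x)%E) ->
  vec_loc_int H.
Proof.
move=> lF mH c0 HF; have [mF _] := lF; split => // r.
pose N := (Num.bound r).+1.
have rN : box r `<=` (box N%:R : set V).
  move=> x bx i; apply: le_trans (bx i) _; apply: le_trans (ltW (Num.Theory.archi_boundP _)) _.
    by apply: le_trans (bx i).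
  by rewrite ler_nat.
apply: (integrableS (measurable_box N%:R) (measurable_box r) rN).
apply/integrableP; split; first by apply/measurable_EFinP; exact: measurable_funTS.
have mS := measurable_slice_norm j N mF.
apply: (@le_lt_trans _ _ (c%:E * \int[lebV]_x (slice_norm j F N x * (\1_(box N%:R) x)%:E))%E); last first.
  by apply: lte_mul_pinfty; rewrite ?lee_fin //; exact: slice_norm_box.
have mB : measurable_fun setT (fun x : V => (\1_(box N%:R) x)%:E : \bar R).
  by apply/measurable_EFinP; apply: measurable_indic; exact: measurable_box.
have S0 (x : V) : (0 <= slice_norm j F N x * (\1_(box N%:R) x)%:E)%E.
  by rewrite mule_ge0 ?slice_norm_ge0 ?lee_fin.
rewrite integral_mkcond -ge0_integralZl //; last by apply: emeasurable_funM.
apply: ge0_le_integral => //.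
- by move=> x _; rewrite patchE; case: ifP.
- apply: (measurable_restrictT (abse \o (EFin \o H)) (measurable_box N%:R)).1.
  by apply: measurable_funTS; apply: measurableT_comp => //; exact/measurable_EFinP.
- apply: emeasurable_funM; first exact: measurable_cst.
  exact: emeasurable_funM.
move=> x _; rewrite patchE indicE; case: ifPn => [/set_mem bx|_]; last by rewrite mule_ge0 ?lee_fin // mule_ge0 ?slice_norm_ge0.
by rewrite mule1; exact: HF.
Qed.

End slices.

(** * A function with a weak derivative is a primitive on almost every line *)

Section weak_primitive.
Context {R : realType} {d : nat} (j : 'I_d).
Local Notation V := (Vsp R d).
Local Notation leb := (@lebesgue_measure R).
Local Notation ind b := ((nat_of_bool b)%:R : R).
Variables f g : V -> R.
Hypothesis lf : vec_loc_int f.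
Hypothesis lg : vec_loc_int g.
Hypothesis weak : forall psi : 'rV[R]_d -> R, test_fun psi ->
  lebd (fun x => (f x * 'D_(evec j) psi x)%:E) = (- lebd (fun x => (g x * psi x)%:E))%E.

Definition line_prim (x : V) : R := prim (fun t => g (upd j t x)) (x ord0 j).

Definition residual (x : V) : R := f x - line_prim x.

Definition bump_mass : R := (\int[leb]_t sbump 0 1 0 t)%R.
Definition unit_bump (t : R) : R := bump_mass^-1 * sbump 0 1 0 t.

Definition residual_mean (x : V) : R := (\int[leb]_u (residual (upd j u x) * unit_bump u))%R.

(** An integer radius is what the one-dimensional lemmas take. *)
Lemma sbump_compact a b n : exists N : nat, forall t : R, N%:R < `|t| -> sbump a b n t = 0.
Proof.
exists (Num.bound (`|a| + `|b|)) => t tN; apply: sbump_out; apply/negP => /andP[h1 h2].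
have := lt_trans (archi_boundP (addr_ge0 (normr_ge0 a) (normr_ge0 b))) tN.
have a1 := ler_norm (- a); have b1 := ler_norm b; have a0 := normr_ge0 a; have b0 := normr_ge0 b.
rewrite normrN in a1; apply/negP; rewrite -leNgt ler_norml; apply/andP; split; lra.
Qed.

Lemma sbump_norm_le1 a b n (t : R) : `|sbump a b n t| <= 1.
Proof. by rewrite ger0_norm ?sbump_ge0 // sbump_le1. Qed.

Lemma integrable_sbump a b n : leb.-integrable setT (EFin \o (sbump a b n : R -> R)).
Proof.
have [N HN] := sbump_compact a b n.
by apply: (@integrable_compact _ _ N 1) => //; [exact: measurable_bump|exact: sbump_norm_le1].
Qed.

Lemma bump_mass_gt0 : 0 < bump_mass.
Proof.
have i0 := integrable_sbump 0 1 0.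
rewrite lt_neqAle; apply/andP; split; last by apply: Rintegral_ge0 => t _; exact: sbump_ge0.
apply/eqP => m0.
have : (\int[leb]_t `|(sbump 0 1 0 t)%:E| = 0)%E.
  under eq_integral => t _ do rewrite gee0_abs ?lee_fin ?sbump_ge0 //.
  by rewrite -[LHS]fineK; [rewrite -[fine _]/bump_mass -m0|exact: (integrable_fin_num measurableT i0)].
move/(ae_eq_integral_abs leb measurableT (measurable_int _ i0)) => -[N [mN N0 HN]].
have : (leb [set` `]0%R, 1%R[] <= leb N)%E.
  apply: le_measure; rewrite ?inE //.
  move=> t; rewrite /= in_itv /= => t01; apply: HN => /= h; have := h I.
  by move=> [] /eqP; rewrite gt_eqF // sbump_gt0.
by rewrite N0 lebesgue_measure_itv /= lte01 oppr0 adde0 lee_fin ler10.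
Qed.

Lemma measurable_unit_bump : measurable_fun setT unit_bump.
Proof. by apply: measurable_funM; [exact: measurable_cst|exact: measurable_bump]. Qed.

Lemma unit_bump_le t : `|unit_bump t| <= bump_mass^-1.
Proof.
have m0 := bump_mass_gt0.
have V0 : 0 <= bump_mass^-1 by rewrite invr_ge0 ltW.
by rewrite /unit_bump normrM (ger0_norm V0) ler_piMr // sbump_norm_le1.
Qed.

Lemma unit_bump_out t : 1 < `|t| -> unit_bump t = 0.
Proof.
move=> t1; rewrite /unit_bump sbump_out ?mulr0 //; apply/negP => /andP[h1 h2].
by move: t1; rewrite ger0_norm; lra.
Qed.

Lemma integral_unit_bump : (\int[leb]_t (unit_bump t)%:E = 1)%E.
Proof.
have i0 := integrable_sbump 0 1 0; have m0 := bump_mass_gt0.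
under eq_integral do rewrite EFinM.
rewrite integralZl // -[X in (_ * X)%E]fineK; last exact: (integrable_fin_num measurableT i0).
by rewrite -[fine _]/bump_mass -EFinM mulVf // gt_eqF.
Qed.

Lemma line_prim_upd u x : line_prim (upd j u x) = prim (fun t => g (upd j t x)) u.
Proof. by rewrite /line_prim upd_same; congr (prim _ u); apply/funext => t; rewrite upd_upd. Qed.

Lemma residual_mean_upd u x : residual_mean (upd j u x) = residual_mean x.
Proof.
rewrite /residual_mean; have -> // : (fun v => residual (upd j v (upd j u x)) * unit_bump v) = (fun v => residual (upd j v x) * unit_bump v).
by apply/funext => t; rewrite upd_upd.
Qed.

Lemma measurable_line_prim : measurable_fun setT line_prim.
Proof.
have [mg _] := lg; rewrite /line_prim /prim /Rintegral; apply: measurableT_comp => //.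
apply: (@measurable_fun_integral R _ V (fun p : V * R => (pker (p.1 ord0 j) p.2 * g (upd j p.2 p.1))%:E)).
apply/measurable_EFinP; apply: measurable_funM.
  apply: (@measurableT_comp _ _ _ _ _ _ (fun q : R * R => pker q.1 q.2) _ (fun p : V * R => ((p.1 : V) ord0 j, p.2))).
    exact: measurable_pker.
  by apply/measurable_fun_pairP; split; [exact: (measurableT_comp (measurable_coord j) measurable_fst)|exact: measurable_snd].
exact: (measurableT_comp mg (measurableT_comp (measurable_updp j) (@measurable_swap _ _ _ _))).
Qed.

Lemma abse_fine_le (z : \bar R) : (`|fine z|%:E <= `|z|)%E.
Proof. by case: z => [r| |] //=; rewrite normr0 leey. Qed.

Lemma vec_loc_int_line_prim : vec_loc_int line_prim.
Proof.
have [mg _] := lg.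
apply: (@vec_loc_int_dom _ _ j g _ 1 lg measurable_line_prim ler01) => N x _ bx.
have mi : measurable_fun setT (fun t : R => (pker (x ord0 j) t * g (upd j t x))%:E).
  apply/measurable_EFinP; apply: measurable_funM; first exact: measurable_pker_r.
  exact: (measurableT_comp mg (measurable_upd_val j x)).
apply: le_trans (abse_fine_le _) _; rewrite mul1e.
apply: le_trans (le_abse_integral leb measurableT mi) _.
apply: ge0_le_integral => //.
- exact: measurableT_comp.
- apply: measurableT_comp => //; apply/measurable_EFinP; apply: measurable_funM; last exact: measurable_ind_le.
  exact: (measurableT_comp mg (measurable_upd_val j x)).
move=> t _; rewrite lee_fin !normrM; case: (leP `|t| N%:R) => tN /=.
  by rewrite normr1 mulr1 ler_piMl //; exact: pker_le1.
by rewrite pker_out ?normr0 ?mul0r ?mulr0 //; exact: le_lt_trans (bx j) tN.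
Qed.

Lemma vec_loc_int_residual : vec_loc_int residual.
Proof.
have [mf jf] := lf; have [mp jp] := vec_loc_int_line_prim; split; first exact: measurable_funB.
by move=> r; exact: (integrableB (measurable_box r) (jf r) (jp r)).
Qed.

Lemma measurable_residual_mean : measurable_fun setT residual_mean.
Proof.
have [mr _] := vec_loc_int_residual; rewrite /residual_mean /Rintegral; apply: measurableT_comp => //.
apply: (@measurable_fun_integral R _ V (fun p : V * R => (residual (upd j p.2 p.1) * unit_bump p.2)%:E)).
apply/measurable_EFinP; apply: measurable_funM.
  exact: (measurableT_comp mr (measurableT_comp (measurable_updp j) (@measurable_swap _ _ _ _))).
exact: (measurableT_comp measurable_unit_bump measurable_snd).
Qed.

Lemma vec_loc_int_residual_mean : vec_loc_int residual_mean.
Proof.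
apply: (@vec_loc_int_dom _ _ j residual _ bump_mass^-1 vec_loc_int_residual measurable_residual_mean).
  by rewrite invr_ge0 ltW // bump_mass_gt0.
move=> N x N0 bx; have [mr _] := vec_loc_int_residual.
have V0 : 0 <= bump_mass^-1 by rewrite invr_ge0 ltW // bump_mass_gt0.
have mu : measurable_fun setT (fun t : R => residual (upd j t x)) by exact: (measurableT_comp mr (measurable_upd_val j x)).
have mi : measurable_fun setT (fun t : R => (residual (upd j t x) * unit_bump t)%:E).
  by apply/measurable_EFinP; apply: measurable_funM => //; exact: measurable_unit_bump.
have ms : measurable_fun setT (fun t : R => `|(residual (upd j t x) * ind (`|t| <= N%:R)%R)%:E|%E).
  by apply: measurableT_comp => //; apply/measurable_EFinP; apply: measurable_funM => //; exact: measurable_ind_le.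
apply: le_trans (abse_fine_le _) _.
apply: le_trans (le_abse_integral leb measurableT mi) _.
rewrite /slice_norm -ge0_integralZl //.
apply: ge0_le_integral => //.
- exact: measurableT_comp.
- by apply: emeasurable_funM => //; exact: measurable_cst.
move=> t _; rewrite abse_EFin -EFinM lee_fin normrM [X in _ <= _ * X]normrM.
move: (unit_bump_le t) (@unit_bump_out t); move: (unit_bump t) => v vle vout.
case: (leP `|t| N%:R) => tN /=.
  by rewrite normr1 mulr1 mulrC ler_wpM2r.
rewrite vout ?normr0 ?mulr0 //; apply: le_lt_trans tN.
by rewrite ler1n.
Qed.

Lemma vec_loc_int_mul (F c : V -> R) (r B : R) : vec_loc_int F -> measurable_fun setT c ->
  (forall x, `|c x| <= B) -> (forall x, ~ box r x -> c x = 0) ->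
  lebV.-integrable setT (EFin \o (fun x => F x * c x)).
Proof.
move=> lF mc cB c0; have [mF _] := lF; have iF := vec_loc_int_indic r lF.
apply: (@le_integrable _ _ _ lebV setT measurableT _ (EFin \o (fun x => B * (F x * \1_(box r) x)))).
- by apply/measurable_EFinP; apply: measurable_funM.
- move=> x _; rewrite /= lee_fin !normrM indicE; have B0 : 0 <= B by apply: le_trans (cB x).
  have [h|h] := boolP (x \in (box r : set V)).
    by rewrite normr1 mulr1 mulrC (ger0_norm B0) ler_wpM2r.
  by rewrite c0 ?normr0 ?mulr0 // => bx; move: h; rewrite notin_setE.
- by have := integrableZl measurableT B iF; apply: eq_integrable.
Qed.

Lemma weak_lebV (psi : 'rV[R]_d -> R) : test_fun psi ->
  lebV.-integrable setT (EFin \o (fun x : V => f x * 'D_(evec j) psi x + g x * psi x)) /\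
  (\int[lebV]_x (f x * 'D_(evec j) psi x + g x * psi x)%:E = 0)%E.
Proof.
move=> tpsi; have [r [r0 psi0]] := test_fun_support tpsi.
have psi'0 := derive_support j psi0.
have cpsi : continuous psi := (tpsi.1 [::]).1.
have cpsi' : continuous (fun x => 'D_(evec j) psi x) := (tpsi.1 [:: j]).1.
have bd (c : 'rV[R]_d -> R) : continuous c -> (forall x, ~ box r x -> c x = 0) -> exists B, forall x, `|c x| <= B.
  move=> cc c0; have /compact_bounded [M [_ HM]] : compact (c @` box r).
    by apply: continuous_compact; [exact: continuous_subspaceT|exact: compact_box].
  exists (`|M| + 1) => x; have [bx|bx] := pselect (box r x).
    by apply: HM; [have := ler_norm M; lra|exists x].
  by rewrite c0 // normr0 addr_ge0.
have [B1 b1] := bd _ cpsi psi0; have [B2 b2] := bd _ cpsi' psi'0.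
have i1 := vec_loc_int_mul lf (continuous_measurable_rV cpsi') b2 psi'0.
have i2 := vec_loc_int_mul lg (continuous_measurable_rV cpsi) b1 psi0.
split; first by have := integrableD measurableT i1 i2; apply: eq_integrable.
have := weak tpsi; rewrite (lebdE i1) (lebdE i2) => E.
transitivity (\int[lebV]_x ((f x * 'D_(evec j) psi x)%:E + (g x * psi x)%:E))%E; first by [].
rewrite integralD // E addeC subee //.
exact: (integrable_fin_num measurableT i2).
Qed.

Lemma ae_residual : {ae lebV, forall x, residual x = residual_mean x}.
Proof.
have lr := vec_loc_int_residual; have lm := vec_loc_int_residual_mean.
have lh : vec_loc_int (fun x => residual x - residual_mean x).
  split; first by apply: measurable_funB; [exact: lr.1|exact: lm.1].
  by move=> r; exact: (integrableB (measurable_box r) (lr.2 r) (lm.2 r)).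
suff : {ae lebV, forall x, residual x - residual_mean x = 0}.
  by apply: filterS => x /eqP; rewrite subr_eq0 => /eqP.
apply: (bumps_ae_eq0 lh.1 lh.2) => a b n.
pose S i := sbump (a i) (b i) n : R -> R.
have [N0 S0] : exists N : nat, forall i t, N%:R < `|t| -> S i t = 0.
  have H i := cid (sbump_compact (a i) (b i) n).
  exists (\max_i (sval (H i))) => i t tN; apply: (svalP (H i)); apply: le_lt_trans tN.
  by rewrite ler_nat; exact: leq_bigmax.
pose N := maxn N0 1.
have N1 : (1 : R) <= N%:R by rewrite ler1n leq_maxr.
have NN0 : (N0%:R : R) <= N%:R by rewrite ler_nat leq_maxl.
pose alpha := S j; pose m := (\int[leb]_t alpha t)%R.
pose a_ t := alpha t - m * unit_bump t.
have ial : leb.-integrable setT (EFin \o alpha) by exact: integrable_sbump.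
have mub := measurable_unit_bump.
have iub : leb.-integrable setT (EFin \o unit_bump).
  apply: (@integrable_compact _ _ 1%N bump_mass^-1) => //; first exact: unit_bump_le.
  by move=> t; exact: unit_bump_out.
have smub : smooth1 unit_bump by apply: smooth_mul; [exact: smooth_cst|exact: smooth_bump].
have sma : smooth1 a_.
  have := smooth_add (smooth_bump (a j) (b j) n) (smooth_mul (smooth_cst (- m)) smub).
  by rewrite (_ : (fun x => _) = a_) //; apply/funext => t; rewrite mulNr.
have ca := smooth_continuous sma.
have ma : measurable_fun setT a_ by exact: continuous_measurable_fun.
have aK t : `|a_ t| <= 1 + `|m| * bump_mass^-1.
  apply: le_trans (ler_normB _ _) _; apply: lerD; first exact: sbump_norm_le1.
  by rewrite normrM ler_wpM2l //; exact: unit_bump_le.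
have aN t : N%:R < `|t| -> a_ t = 0.
  move=> tN; rewrite /a_ unit_bump_out ?mulr0 ?subr0; first by apply: S0; exact: le_lt_trans NN0 tN.
  exact: le_lt_trans N1 tN.
have a0 : (\int[leb]_u (a_ u)%:E = 0)%E.
  have imb := integrableZl measurableT m iub.
  transitivity (\int[leb]_u ((alpha u)%:E - (m%:E * (unit_bump u)%:E)))%E; first by [].
  rewrite (integralB measurableT ial imb) (integralZl measurableT iub) integral_unit_bump mule1 /m /Rintegral fineK ?subee //; exact: (integrable_fin_num measurableT ial).
pose A t := - upper_tail a_ t.
have smA : smooth1 A.
  apply: (smooth_prim sma) => t; exact: (is_derive_upper_tail ma aK aN t a0 ca).
have AN t : N%:R < `|t| -> A t = 0 by move=> tN; rewrite /A (upper_tail_out aN a0 tN) oppr0.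
pose S2 i := if i == j then A else S i.
pose S1 i := if i == j then a_ else S i.
have smS i : smooth1 (S i) by exact: smooth_bump.
have tS2 : test_fun (prodf S2).
  apply: (@test_fun_prodf _ _ _ N%:R) => [i|i t tN|]; last by case: (d) j => // -[].
    by rewrite /S2; case: eqP.
  by rewrite /S2; case: eqP => _; [exact: AN|apply: S0; exact: le_lt_trans tN].
have DS2 x : 'D_(evec j) (prodf S2) x = prodf S1 x.
  have dA t : is_derive t (1 : R) (S2 j) (a_ t).
    by rewrite /S2 eqxx; exact: (is_derive_upper_tail ma aK aN t a0 ca).
  have [_ ->] := is_derive_prodf x dA.
  by congr prodf; apply/funext => i; rewrite /S1 /S2; case: eqP.
have [iW] := weak_lebV tS2.
have mS : measurable_fun setT (prodf S : V -> R) by apply: measurable_prodf => i; exact: measurable_bump.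
have iH : lebV.-integrable setT (EFin \o (fun x : V => (residual x - residual_mean x) * prodf S x)).
  have [r br] := obox_box a b.
  apply: (vec_loc_int_mul lh mS (fun x => prodf_bump_le1 a b n x) (r := r)) => x bx.
  by apply: prodf_bump_out => /br.
rewrite (lebV_split j iW) (lebV_split j iH) => <-.
have iW' := lebV_integrable_inner j iW; have iH' := lebV_integrable_inner j iH.
apply: ae_eq_integral => //.
- exact: measurable_int iH'.
- exact: measurable_int iW'.
have aef := ae_line_loc_int j lf; have aeg := ae_line_loc_int j lg.
have both := @filterI _ (almost_everywhere (nuV j)) _ _ _ aef aeg.
rewrite /ae_eq; case: both => N2 [mN2 N20 HN2]; exists N2; split => // x /= hx; apply: HN2 => -[lfx lgx]; apply: hx => _ /=.
have [xf xg] := (lfx, lgx).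
have resE u : residual (upd j u x) = f (upd j u x) - prim (fun t => g (upd j t x)) u.
  by rewrite /residual line_prim_upd.
have lres : line_loc_int (fun u => residual (upd j u x)).
  under eq_fun do rewrite resE.
  by apply: line_loc_intB => //; exact: line_loc_int_prim.
pose B := \prod_(i < d | i != j) S i (x ord0 i).
have malpha : measurable_fun setT alpha by exact: measurable_bump.
have alN t : N%:R < `|t| -> alpha t = 0 by move=> tN; apply: S0; exact: le_lt_trans tN.
have ubN t : N%:R < `|t| -> unit_bump t = 0 by move=> tN; apply: unit_bump_out; exact: le_lt_trans tN.
have i1 := line_loc_int_mul lres malpha (fun t => sbump_norm_le1 (a j) (b j) n t) alN.
have i2 := line_loc_int_mul lres mub unit_bump_le ubN.
have iC : leb.-integrable setT (EFin \o (fun u => (residual (upd j u x) - residual_mean x) * alpha u)).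
  have := integrableB measurableT i1 (integrableZl measurableT (residual_mean x) ial).
  apply: eq_integrable => // u _.
  exact: (congr1 EFin (esym (mulrBl (alpha u) (residual (upd j u x)) (residual_mean x)))).
have i3 := line_loc_int_mul xf ma aK aN.
have mA : measurable_fun setT A by apply: continuous_measurable_fun; exact: smooth_continuous.
have AB t : `|A t| <= fine (\int[leb]_u `|(a_ u)%:E|)%E by rewrite normrN; exact: (upper_tail_bound ma aK aN).
have i4 := line_loc_int_mul xg mA AB AN.
have iD : leb.-integrable setT (EFin \o (fun u => f (upd j u x) * a_ u + g (upd j u x) * A u)).
  by have := integrableD measurableT i3 i4; apply: eq_integrable.
have key : (\int[leb]_u ((residual (upd j u x) - residual_mean x) * alpha u))%R =
  (\int[leb]_u (f (upd j u x) * a_ u + g (upd j u x) * A u))%R.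
  have := line_residual_by_parts xg ma aK aN xf a0 ca; rewrite -/A => <-.
  transitivity (\int[leb]_u (residual (upd j u x) * alpha u) - residual_mean x * m)%R.
    rewrite /m -RintegralZl // -RintegralB //; last exact: (integrableZl measurableT (residual_mean x) ial).
    by congr Rintegral; apply/funext => u; rewrite mulrBl.
  transitivity (\int[leb]_u (residual (upd j u x) * a_ u))%R; last first.
    by congr Rintegral; apply/funext => u; rewrite resE.
  rewrite mulrC {1}/residual_mean -RintegralZl // -RintegralB //; last exact: (integrableZl measurableT m i2).
  by congr Rintegral; apply/funext => u; rewrite /a_; move: (unit_bump u) (alpha u) (residual _) => p q r; ring.
transitivity (\int[leb]_u (B%:E * ((residual (upd j u x) - residual_mean x) * alpha u)%:E))%E.
  apply: eq_integral => u _; rewrite -EFinM; congr _%:E.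
  by rewrite residual_mean_upd prodf_upd -/alpha -/B; ring.
transitivity (\int[leb]_u (B%:E * (f (upd j u x) * a_ u + g (upd j u x) * A u)%:E))%E; last first.
  apply: eq_integral => u _; rewrite -EFinM; congr _%:E; rewrite DS2 !prodf_upd /S1 /S2 eqxx.
  have EE (h : R -> R) : \prod_(i < d | i != j) (if i == j then h else S i) (x ord0 i) = B.
    by apply: eq_bigr => i ij; rewrite (negPf ij).
  by rewrite !EE; ring.
rewrite (integralZl measurableT iC) (integralZl measurableT iD); congr (_ * _)%E.
rewrite -[LHS]fineK; last exact: (integrable_fin_num measurableT iC).
rewrite -[RHS]fineK; last exact: (integrable_fin_num measurableT iD).
by congr _%:E.
Qed.

End weak_primitive.

(** * The diagonal Stein kernel *)

Section stein_existence.
Context {R : realType} {d : nat} {dO : measure_display} {O : measurableType dO} (P : probability O R).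
Local Notation V := (Vsp R d).
Local Notation leb := (@lebesgue_measure R).
Local Notation ind b := ((nat_of_bool b)%:R : R).
Local Notation intg f := (P.-integrable setT (EFin \o (f : O -> R))).
Local Notation Ex := (Ex P).
Variables (Y : 'I_d -> O -> R) (phi : 'rV[R]_d -> R).
Hypothesis mY : forall i, measurable_fun setT (Y i).
Hypothesis iY2 : forall i, intg (fun w => Y i w ^+ 2).
Hypothesis EY : forall i, (\int[P]_w (Y i w)%:E = 0)%E.
Hypothesis indY : indep_coords P Y.
Hypothesis sc : strongly_convex phi.
Hypothesis dens : has_density P (fun w => \row_i Y i w) phi.
Let Yv : O -> V := fun w => \row_i Y i w.
Local Notation rho := (rho phi).
Let mYv : measurable_fun setT Yv := measurable_row mY.

Lemma ae_lebV_line (j : 'I_d) (Q : V -> Prop) : {ae lebV, forall x, Q x} ->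
  {ae nuV j, forall x, {ae leb, forall t, Q (upd j t x)}}.
Proof.
move=> [N [mN N0 HN]].
have mi : measurable_fun setT (fun x : V => (\1_N x)%:E : \bar R) by apply/measurable_EFinP; exact: measurable_indic.
have : (\int[lebV]_x (\1_N x)%:E = 0)%E by rewrite integral_indic // setIT.
rewrite (lebV_split_ge0 j) // => z.
have mI : measurable_fun setT (fun x : V => \int[leb]_t (\1_N (upd j t x))%:E)%E.
  apply: (@measurable_fun_integral R _ V (fun p : V * R => (\1_N (upd j p.2 p.1))%:E)).
  exact: (measurableT_comp mi (measurableT_comp (measurable_updp j) (@measurable_swap _ _ _ _))).
have : (\int[nuV j]_x `|\int[leb]_t (\1_N (upd j t x))%:E| = 0)%E.
  by rewrite -[RHS]z; apply: eq_integral => x _; rewrite gee0_abs //; apply: integral_ge0.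
move/(ae_eq_integral_abs (nuV j) measurableT mI); apply: filterS => x /(_ I) /= x0.
have mU : measurable ((fun t => upd j t x : V) @^-1` N).
  by have := @measurable_upd_val R d j x measurableT _ mN; rewrite setTI.
exists ((fun t => upd j t x : V) @^-1` N); split => //.
- have := @integral_indic _ _ _ leb setT measurableT _ mU; rewrite setIT => <-.
  by rewrite -[RHS]x0; apply: eq_integral => t _; rewrite !indicE; congr (_ %:R)%:E.
- by move=> t /= ht; apply: HN.
Qed.

Section coordinate.
Variable j : 'I_d.
Let p (t : R) := line_density phi j t.
Let r (x : V) := rest_density phi j x.
Let w (u : R) := u * p u.

Let rhoE t x : rho (upd j t x) = p t * r x.
Proof. exact: (rho_factor mY sc dens indY j t x). Qed.

Lemma line_density_gt0 t : 0 < p t. Proof. exact: rho_gt0. Qed.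

Lemma rest_density_gt0 x : 0 < r x.
Proof. by rewrite /r /rest_density divr_gt0 // rho_gt0. Qed.

Lemma measurable_line_density : measurable_fun setT p.
Proof. exact: (measurableT_comp (measurable_rho sc) (measurable_upd_val j (0 : V))). Qed.

Lemma measurable_rest_density : measurable_fun setT r.
Proof.
apply: measurable_funM; last exact: measurable_cst.
exact: (measurableT_comp (measurable_rho sc) (measurable_upd j 0)).
Qed.

Let mp := measurable_line_density.
Let mr := measurable_rest_density.
Let mw : measurable_fun setT w. Proof. exact: measurable_funM. Qed.

Let Ir := (\int[nuV j]_x (r x)%:E)%E.

Lemma split_coord (h : R -> R) : measurable_fun setT h -> (forall t, 0 <= h t) ->
  (\int[lebV]_x (h ((x : V) ord0 j) * rho x)%:E = (\int[leb]_t (h t * p t)%:E) * Ir)%E.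
Proof.
move=> mh h0; have mhp : measurable_fun setT (fun t => h t * p t) by exact: measurable_funM.
rewrite (lebV_split_ge0 j); last 2 first.
- apply/measurable_EFinP; apply: measurable_funM; last exact: measurable_rho.
  exact: (measurableT_comp mh (measurable_coord j)).
- by move=> x; rewrite lee_fin mulr_ge0 // ltW // rho_gt0.
rewrite /Ir -ge0_integralZl //; last 3 first.
- exact/measurable_EFinP.
- by move=> x _; rewrite lee_fin ltW // rest_density_gt0.
- by apply: integral_ge0 => t _; rewrite lee_fin mulr_ge0 // ltW // line_density_gt0.
apply: eq_integral => x _.
rewrite -ge0_integralZr //; last 3 first.
- exact/measurable_EFinP.
- by move=> t _; rewrite lee_fin mulr_ge0 // ltW // line_density_gt0.
- by rewrite lee_fin ltW // rest_density_gt0.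
by apply: eq_integral => t _; rewrite upd_same rhoE mulrA EFinM.
Qed.

Lemma rest_mass : (0 < Ir)%E /\ (Ir < +oo)%E.
Proof.
have Ir0 : (0 <= Ir)%E by apply: integral_ge0 => x _; rewrite lee_fin ltW // rest_density_gt0.
have Ip0 : (0 <= \int[leb]_t (1 * p t)%:E)%E.
  by apply: integral_ge0 => t _; rewrite mul1r lee_fin ltW // line_density_gt0.
have := @split_coord (fun=> 1) (measurable_cst _) (fun=> ler01).
have := @law_integral _ _ _ _ P Y phi mY sc dens (fun=> 1) (measurable_cst _).
have -> : (\int[P]__ 1 = 1)%E by rewrite (_ : (fun=> _) = cst 1%E) // integral_cst // mul1e; exact: probability_setT.
move=> <-.
move=> E; split.
  by rewrite lt_neqAle Ir0 andbT; apply/eqP => h; move: E; rewrite -h mule0 => /eqP; rewrite onee_eq0.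
rewrite ltey; apply/eqP => h; move: (E); rewrite h gt0_muley //.
rewrite lt_neqAle Ip0 andbT; apply/eqP => h0; move: E; rewrite -h0 mul0e => /eqP; by rewrite onee_eq0.
Qed.

Lemma integrable_line_first_moment : leb.-integrable setT (EFin \o w).
Proof.
have [r0 roo] := rest_mass.
have iY := intg_sqr (mY j) (iY2 j).
have mc := @measurable_coord R d j.
have iV := law_integrable mY sc dens mc (f := fun x : V => x ord0 j).
have {}iV : lebV.-integrable setT (EFin \o (fun x : V => x ord0 j * rho x)).
  by apply: iV; apply: eq_integrable iY => // u _ /=; rewrite mxE.
apply/integrableP; split; first exact/measurable_EFinP.
have := @split_coord (fun t => `|t|) (measurableT_comp (@normr_measurable R setT) (@measurable_id _ _ setT)) (fun t => normr_ge0 t).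
have /integrableP[_ fin] := iV.
have -> : (\int[lebV]_x (`|(x : V) ord0 j| * rho x)%:E = \int[lebV]_x `|(EFin \o (fun x : V => x ord0 j * rho x)%R) x|)%E.
  by apply: eq_integral => x _; rewrite /= normrM [`|rho x|]ger0_norm // ltW // rho_gt0.
have -> : (\int[leb]_t (`|t| * p t)%:E = \int[leb]_x `|(EFin \o w) x|)%E.
  by apply: eq_integral => t _; rewrite /= normrM [`|p t|]ger0_norm // ltW // line_density_gt0.
move=> E; rewrite E in fin; move: fin; rewrite ltey => fin.
rewrite ltey; apply/eqP => hh; move: fin; rewrite hh gt0_mulye //.
Qed.

Lemma line_mean_zero : (\int[leb]_u (w u)%:E = 0)%E.
Proof.
have [r0 roo] := rest_mass; have iw := integrable_line_first_moment.
have iY := intg_sqr (mY j) (iY2 j).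
have mc := @measurable_coord R d j.
have iV : lebV.-integrable setT (EFin \o (fun x : V => x ord0 j * rho x)).
  by apply: (law_integrable mY sc dens mc); apply: eq_integrable iY => // u _ /=; rewrite mxE.
have := law_integral mY sc dens mc.
have -> : (\int[P]_w0 ((\row_i Y i w0 : V) ord0 j)%:E = 0)%E.
  by rewrite -[RHS](EY j); apply: eq_integral => u _; rewrite mxE.
have wfin := integrable_fin_num measurableT iw.
have ir : (nuV j).-integrable setT (EFin \o r).
  apply/integrableP; split; first exact/measurable_EFinP.
  rewrite (eq_integral (fun x => (r x)%:E)) // => x _; rewrite /= ger0_norm // ltW //; exact: rest_density_gt0.
have -> : (\int[lebV]_x ((x : V) ord0 j * rho x)%:E =
   \int[nuV j]_x ((fine (\int[leb]_u (w u)%:E))%:E * (r x)%:E))%E.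
  rewrite (lebV_split j iV); apply: eq_integral => x _; rewrite fineK // muleC -integralZl //.
  by apply: eq_integral => t _; rewrite /= upd_same rhoE -EFinM; congr _%:E; rewrite /w; ring.
rewrite (integralZl measurableT ir) -/Ir => /esym E.
move: E; rewrite -[Ir]fineK; last by rewrite ge0_fin_numE // ltW.
rewrite -EFinM => -[] /eqP; rewrite mulf_eq0 => /orP[/eqP h|/eqP h].
  by rewrite -[LHS]fineK // h.
have := fine_gt0; move=> /(_ _ Ir); by rewrite r0 roo h ltxx => /(_ isT).
Qed.

Lemma line_stein_bound : exists L : R, 0 <= L /\ forall t, 0 <= upper_tail w t <= L * p t.
Proof.
have [kappa [k0 H]] := sc.
have [k [c [kk0 qd]]] := strongly_convex_quadratic sc.
pose psi t := phi (upd j t 0).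
have sq (v : R) : sqnorm (upd j v 0) = v ^+ 2 :> R.
  rewrite /sqnorm (bigD1 j) //= upd_same big1 ?addr0 // => i ij.
  by rewrite upd_neq // mxE expr0n.
have sc1 (u v s : R) : 0 <= s <= 1 ->
  psi (s * u + (1 - s) * v) <= s * psi u + (1 - s) * psi v - kappa / 2 * s * (1 - s) * (u - v) ^+ 2.
  move=> s01; have := H (upd j u 0) (upd j v 0) s s01.
  rewrite (_ : s *: upd j u 0 + (1 - s) *: upd j v 0 = upd j (s * u + (1 - s) * v) 0); last first.
    by apply/rowP => i; rewrite !mxE; case: eqP => // _; rewrite !mulr0 addr0.
  rewrite (_ : upd j u 0 - upd j v 0 = upd j (u - v) 0) ?sq //.
  by apply/rowP => i; rewrite !mxE; case: eqP => // _; rewrite subr0.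
pose R0 := (`|c| + `|psi 0|) / k + 1.
have q0 : 0 <= (`|c| + `|psi 0|) / k by rewrite divr_ge0 ?addr_ge0 // ltW.
have R00 : 0 < R0 by rewrite /R0; lra.
have psi0 t : R0 <= `|t| -> psi 0 <= psi t.
  move=> tR; have := qd (upd j t 0); rewrite sq -/(psi t) => h.
  have t1 : 1 <= `|t| by rewrite /R0 in tR; lra.
  have : `|t| <= t ^+ 2 by rewrite -(real_normK (num_real t)) expr2 ler_peMr.
  move=> t2; have h3 : (`|c| + `|psi 0|) / k <= t ^+ 2 by rewrite /R0 in tR; lra.
  have : `|c| + `|psi 0| <= k * t ^+ 2 by rewrite mulrC -ler_pdivrMr.
  have := ler_norm c; have := ler_norm (psi 0); lra.
exact: (stein_ratio_bounded k0 sc1 R00 psi0 integrable_line_first_moment line_mean_zero).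
Qed.

Lemma measurable_upper_tail : measurable_fun setT (upper_tail w).
Proof.
rewrite /upper_tail /Rintegral; apply: measurableT_comp => //.
apply: (@measurable_fun_integral R _ R (fun q : R * R => (w q.2 * ind (q.1 < q.2)%R)%:E)).
apply/measurable_EFinP; apply: measurable_funM; first exact: measurableT_comp.
by apply: measurable_bool_ind; apply: measurable_fun_ltr.
Qed.

Lemma line_stein_identity (f g : R -> R) (c : R) :
  measurable_fun setT f -> line_loc_int g ->
  {ae leb, forall t, f t - prim g t = c} ->
  leb.-integrable setT (EFin \o (fun t => w t * f t)) ->
  leb.-integrable setT (EFin \o (fun t => upper_tail w t * g t)) ->
  (\int[leb]_t (w t * f t)%:E = \int[leb]_t (upper_tail w t * g t)%:E)%E.
Proof.
move=> mf lg fg iwf iqg.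
have iw := integrable_line_first_moment; have w0 := line_mean_zero.
have [L [L0 HL]] := line_stein_bound.
have [mg _] := lg.
have wk0 u t : 0 <= w u * pker u t.
  exact: (stein_numerator_ge0 (fun t => phi (upd j t 0)) u t).
have mwk t : measurable_fun setT (fun u => (w u * pker u t)%:E).
  by apply/measurable_EFinP; apply: measurable_funM => //; apply: (@measurableT_comp _ _ _ _ _ _ (fun q : R * R => pker q.1 q.2) _ (fun u : R => (u, t)) measurable_pker).
have fin : (\int[leb]_t \int[leb]_u `|(w u * pker u t * g t)%:E| < +oo)%E.
  have /integrableP[_] := iqg; congr (_ < _)%E; apply: eq_integral => t _.
  transitivity (\int[leb]_u ((w u * pker u t)%:E * `|g t|%:E))%E; last first.
    by apply: eq_integral => u _; rewrite /= normrM ger0_norm.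
  rewrite ge0_integralZr //; last 2 first.
  - exact: mwk.
  - by move=> u _; rewrite lee_fin.
  rewrite (upper_tail_pker t iw w0) /= normrM ger0_norm //.
  by have /andP[] := HL t.
rewrite -(primitive_fubini iw w0 mg (fun u => integrable_pker u lg) fin).
have icw := integrableZl measurableT c iw.
have -> : (\int[leb]_u (w u * prim g u)%:E = \int[leb]_u ((w u * f u)%:E - c%:E * (w u)%:E))%E.
  have mp' := measurable_prim mg.
  apply: ae_eq_integral => //.
  - by apply/measurable_EFinP; apply: measurable_funM.
  - by apply: emeasurable_funB; [exact: measurable_int iwf|exact: measurable_int icw].
  rewrite /ae_eq; case: fg => N [mN N0 HN]; exists N; split => // t /= ht; apply: HN => h.
  by apply: ht => _ /=; rewrite -h; congr _%:E; ring.
by rewrite (integralB measurableT iwf icw) (integralZl measurableT iw) w0 mule0 sube0.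
Qed.

End coordinate.

Definition stein_ratio (j : 'I_d) (t : R) : R :=
  upper_tail (fun u => u * line_density phi j u) t / line_density phi j t.

Lemma measurable_stein_ratio j : measurable_fun setT (stein_ratio j).
Proof.
apply: measurable_funM; first exact: measurable_upper_tail.
rewrite (_ : (fun x => _) = (fun t => expR (- ln (line_density phi j t)))).
  apply: measurableT_comp => //; apply: measurableT_comp => //.
  by apply: measurableT_comp; [exact: measurable_ln|exact: measurable_line_density].
by apply/funext => t; rewrite expRN lnK // posrE line_density_gt0.
Qed.

Lemma stein_ratio_bound j : exists L : R, 0 <= L /\ forall t, 0 <= stein_ratio j t <= L.
Proof.
have [L [L0 HL]] := line_stein_bound j; exists L; split => // t.
have p0 := line_density_gt0 j t; have /andP[a b] := HL t.
by rewrite /stein_ratio divr_ge0 ?ler_pdivrMr //= ltW.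
Qed.

Lemma coordinate_stein_identity (j : 'I_d) (f g : V -> R) :
  vec_loc_int f -> vec_loc_int g ->
  (forall psi : 'rV[R]_d -> R, test_fun psi ->
    lebd (fun x => (f x * 'D_(evec j) psi x)%:E) = (- lebd (fun x => (g x * psi x)%:E))%E) ->
  intg (fun u => f (Yv u) ^+ 2) -> intg (fun u => g (Yv u) ^+ 2) ->
  [/\ intg (fun u => Y j u * f (Yv u)), intg (fun u => stein_ratio j (Y j u) * g (Yv u)) &
   Ex (fun u => Y j u * f (Yv u)) = Ex (fun u => stein_ratio j (Y j u) * g (Yv u))].
Proof.
move=> lf lg weak if2 ig2; have [mf _] := lf; have [mg _] := lg.
have mc := @measurable_coord R d j.
have mq := measurable_stein_ratio j; have [L [L0 HL]] := stein_ratio_bound j.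
have mfY : measurable_fun setT (fun u => f (Yv u)) by exact: measurableT_comp.
have mgY : measurable_fun setT (fun u => g (Yv u)) by exact: measurableT_comp.
have i1 : intg (fun u => Y j u * f (Yv u)) by exact: intg_mul.
have i2 : intg (fun u => stein_ratio j (Y j u) * g (Yv u)).
  apply: intg_mul => //; first exact: measurableT_comp.
  apply: (@intg_bounded _ _ _ _ _ (L ^+ 2)).
    by apply: measurable_funX; exact: measurableT_comp.
  by move=> u; have /andP[a b] := HL (Y j u); rewrite ger0_norm ?sqr_ge0 // lerXn2r ?nnegrE.
split => //.
pose h1 (x : V) := x ord0 j * f x; pose h2 (x : V) := stein_ratio j (x ord0 j) * g x.
have mh1 : measurable_fun setT h1 by exact: measurable_funM.
have mh2 : measurable_fun setT h2 by apply: measurable_funM => //; exact: measurableT_comp.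
have e1 u : h1 (\row_i Y i u) = Y j u * f (Yv u) by rewrite /h1 mxE.
have e2 u : h2 (\row_i Y i u) = stein_ratio j (Y j u) * g (Yv u) by rewrite /h2 mxE.
have v1 : lebV.-integrable setT (EFin \o (fun x => h1 x * rho x)).
  by apply: (law_integrable mY sc dens mh1); apply: eq_integrable i1 => // u _ /=; rewrite e1.
have v2 : lebV.-integrable setT (EFin \o (fun x => h2 x * rho x)).
  by apply: (law_integrable mY sc dens mh2); apply: eq_integrable i2 => // u _ /=; rewrite e2.
suff E : (\int[lebV]_x (h1 x * rho x)%:E = \int[lebV]_x (h2 x * rho x)%:E)%E.
  apply: EFin_inj; rewrite -(ExE i1) -(ExE i2).
  transitivity (\int[P]_u (h1 (\row_i Y i u))%:E)%E; first by apply: eq_integral => u _; rewrite e1.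
  rewrite (law_integral mY sc dens mh1) E -(law_integral mY sc dens mh2).
  by apply: eq_integral => u _; rewrite e2.
rewrite (lebV_split j v1) (lebV_split j v2).
have w1 := lebV_integrable_inner j v1; have w2 := lebV_integrable_inner j v2.
apply: ae_eq_integral => //; [exact: measurable_int w1|exact: measurable_int w2|].
have a12 := @filterI _ _ (ae_filter_ringOfSetsType (nuV j)) _ _ (lebV_ae_integrable j v1) (lebV_ae_integrable j v2).
have a34 := @filterI _ _ (ae_filter_ringOfSetsType (nuV j)) _ _ (ae_line_loc_int j lg) (ae_lebV_line j (ae_residual lf lg weak)).
have all4 := @filterI _ _ (ae_filter_ringOfSetsType (nuV j)) _ _ a12 a34.
rewrite /ae_eq; case: all4 => N [mN N0 HN]; exists N; split => // x /= hx; apply: HN => -[[j1 j2] [j3 j4]]; apply: hx => _ /=.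
have r0 := rest_density_gt0 j x.
pose w (u : R) := u * line_density phi j u.
have H1 t : h1 (upd j t x) * rho (upd j t x) = rest_density phi j x * (w t * f (upd j t x)).
  by rewrite /h1 upd_same (rho_factor mY sc dens indY) /w; ring.
have H2 t : h2 (upd j t x) * rho (upd j t x) = rest_density phi j x * (upper_tail w t * g (upd j t x)).
  rewrite /h2 upd_same (rho_factor mY sc dens indY) /stein_ratio.
  have p0 := line_density_gt0 j t; rewrite -/w; move: (upper_tail w t) => q; field; exact: lt0r_neq0.
have k1 : leb.-integrable setT (EFin \o (fun t => w t * f (upd j t x))).
  have := integrableZl measurableT (rest_density phi j x)^-1 j1; apply: eq_integrable => // t _.
  by rewrite /= H1 -EFinM mulKf // gt_eqF.
have k2 : leb.-integrable setT (EFin \o (fun t => upper_tail w t * g (upd j t x))).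
  have := integrableZl measurableT (rest_density phi j x)^-1 j2; apply: eq_integrable => // t _.
  by rewrite /= H2 -EFinM mulKf // gt_eqF.
transitivity ((rest_density phi j x)%:E * \int[leb]_t (w t * f (upd j t x))%:E)%E.
  by rewrite -integralZl //; apply: eq_integral => t _; rewrite H1 EFinM.
transitivity ((rest_density phi j x)%:E * \int[leb]_t (upper_tail w t * g (upd j t x))%:E)%E; last first.
  by rewrite -integralZl //; apply: eq_integral => t _; rewrite H2 EFinM.
have mfx : measurable_fun setT (fun t => f (upd j t x)) by exact: (measurableT_comp mf (measurable_upd_val j x)).
have c4 : {ae leb, forall t, f (upd j t x) - prim (fun t => g (upd j t x)) t = residual_mean j f g x}.
  case: j4 => K [mK K0 HK]; exists K; split; [exact: mK|exact: K0|].
  move=> t ht; apply: HK => h.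
  by apply: ht; move: h => /=; rewrite residual_mean_upd /residual line_prim_upd.
by rewrite (line_stein_identity mfx j3 c4 k1 k2).
Qed.

Lemma loc_integrable_vec (g : V -> R) : loc_integrable g -> vec_loc_int g.
Proof.
move=> [/rv_measurable_funE mg fin]; split => // r.
pose r' := Num.sqrt (d%:R * r ^+ 2) : R.
have sub (x : V) : box r x -> enorm x <= r'.
  move=> bx; rewrite /enorm /r' ler_sqrt; last by rewrite mulr_ge0 ?sqr_ge0.
  rewrite /sqnorm; apply: le_trans (_ : \sum_(i < d) r ^+ 2 <= _); last by rewrite sumr_const card_ord mulr_natl.
  apply: ler_sum => i _; rewrite -(real_normK (num_real (x ord0 i))) lerXn2r ?nnegrE //.
  exact: le_trans (bx i).
have mb : measurable_fun setT (fun x : V => (enorm x <= r')%R).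
  by apply: measurable_fun_ler; [exact: measurable_enorm|exact: measurable_cst].
have mh : measurable_fun setT (fun x : V => `|g x| * (if enorm x <= r' then 1 else 0)).
  apply: measurable_funM; first exact: measurableT_comp.
  rewrite (_ : (fun x => _) = (fun x : V => ind (enorm x <= r')%R)); first exact: measurable_bool_ind.
  by apply/funext => x; case: (enorm x <= r').
have := fin r'; rewrite lebd_ge0E; last 2 first.
- exact/measurable_EFinP.
- by move=> x; rewrite lee_fin mulr_ge0 //; case: ifP.
move=> lt; apply/integrableP; split; first by apply/measurable_EFinP; exact: measurable_funTS.
apply: le_lt_trans lt; rewrite integral_mkcond; apply: ge0_le_integral => //.
- by move=> x _; rewrite patchE; case: ifP.
- apply: (measurable_restrictT (abse \o (EFin \o g)) (measurable_box r)).1.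
  by apply: measurable_funTS; apply: measurableT_comp => //; exact/measurable_EFinP.
- exact/measurable_EFinP.
move=> x _; rewrite patchE; case: ifPn => [/set_mem /sub ->|_]; first by rewrite mulr1.
by rewrite lee_fin mulr_ge0 //; case: ifP.
Qed.

Definition stein_diag (x : 'rV[R]_d) : 'M[R]_d := diag_mx (\row_j stein_ratio j (x ord0 j)).

Lemma stein_kernel_stein_diag : stein_kernel P Yv stein_diag.
Proof.
split=> [j k|f G [lf [lG [f2 [G2 weak]]]]].
  apply/rv_measurable_funE; have [<-|jk] := eqVneq j k.
    have m : measurable_fun setT (fun x : V => stein_ratio j (x ord0 j)).
      exact: (measurableT_comp (measurable_stein_ratio j) (measurable_coord j)).
    rewrite (_ : (fun x => _) = (fun x : V => stein_ratio j (x ord0 j))) //.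
    by apply/funext => x; rewrite !mxE eqxx.
  rewrite (_ : (fun x => _) = cst 0); first exact: measurable_cst.
  by apply/funext => x; rewrite !mxE (negPf jk) mulr0n.
have sqi (h : V -> R) : vec_loc_int h -> (\int[P]_u (h (Yv u) ^+ 2)%:E < +oo)%E -> intg (fun u => h (Yv u) ^+ 2).
  move=> [mh _] fin; have m : measurable_fun setT (fun u => h (Yv u) ^+ 2).
    by apply: measurable_funX; exact: (measurableT_comp mh mYv).
  apply/integrableP; split; first exact/measurable_EFinP.
  rewrite (eq_integral (fun u => (h (Yv u) ^+ 2)%:E)) // => u _.
  by rewrite /= ger0_norm // sqr_ge0.
have K j := @coordinate_stein_identity j _ _ (loc_integrable_vec (lf j)) (loc_integrable_vec (lG j j))
  (weak j j) (sqi _ (loc_integrable_vec (lf j)) (f2 j)) (sqi _ (loc_integrable_vec (lG j j)) (G2 j j)).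
have k1 j : intg (fun u => Y j u * f (Yv u) ord0 j) by case: (K j).
have k2 j : intg (fun u => stein_ratio j (Y j u) * G (Yv u) j j) by case: (K j).
transitivity (\int[P]_u (\sum_(j < d) Y j u * f (Yv u) ord0 j)%:E)%E.
  by apply: eq_integral => u _; congr _%:E; apply: eq_bigr => j _; rewrite mxE.
transitivity (\int[P]_u (\sum_(j < d) stein_ratio j (Y j u) * G (Yv u) j j)%:E)%E; last first.
  apply: eq_integral => u _; congr _%:E; apply: eq_bigr => j _.
  rewrite (bigD1 j) //= big1 ?addr0; first by rewrite !mxE eqxx mulr1n.
  by move=> k kj; rewrite !mxE eq_sym (negPf kj) mulr0n mul0r.
rewrite ExE; last by apply: intg_sum => j _; exact: k1.
rewrite ExE; last by apply: intg_sum => j _; exact: k2.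
rewrite Ex_sum; last by move=> j _; exact: k1.
rewrite Ex_sum; last by move=> j _; exact: k2.
by congr _%:E; apply: eq_bigr => j _; case: (K j).
Qed.

Lemma stein_diag_bounded (s : R) : exists L : R, forall x (i : 'I_d), `|s - stein_diag x i i| <= L.
Proof.
pose L i := sval (cid (stein_ratio_bound i)).
have L0 i : 0 <= L i by exact: (svalP (cid (stein_ratio_bound i))).1.
have HL i t : 0 <= stein_ratio i t <= L i by exact: (svalP (cid (stein_ratio_bound i))).2.
exists (`|s| + \sum_i L i) => x i; rewrite !mxE eqxx mulr1n.
have /andP[a b] := HL i (x ord0 i); apply: le_trans (ler_normB _ _) _; rewrite lerD2l ger0_norm //.
apply: le_trans b _; rewrite (bigD1 i) //= lerDl; apply: sumr_ge0 => k _; exact: L0.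
Qed.

End stein_existence.

Unset Implicit Arguments. Set Strict Implicit. Set Printing Implicit Defensive.

Theorem mainTheorem12 (R : realType) :
  exists B : R -> R, (forall c, 0 < c -> 0 < B c) /\
  forall (d : nat) (dO : measure_display) (O : measurableType dO)
    (P : probability O R) (theta : 'rV[R]_d) (Y : 'I_d -> O -> R)
    (sigma : R) (phi : 'rV[R]_d -> R),
  (forall i, measurable_fun setT (Y i)) ->
  (forall i, P.-integrable setT (fun w => (Y i w ^+ 2)%:E)) ->
  (forall i, (\int[P]_w (Y i w)%:E = 0)%E) ->
  (forall i j, (\int[P]_w (Y i w * Y j w)%:E = (sigma ^+ 2 * (i == j)%:R)%:E)%E) ->
  indep_coords P Y ->
  strongly_convex phi ->
  has_density P (fun w => \row_i Y i w) phi ->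
  let Yv := fun w => \row_i Y i w in
  let X := fun w => theta + Yv w in
  ((exists T, stein_kernel P Yv T /\
      exists L : R, {ae P, forall w, forall i, `|sigma ^+ 2 - T (Yv w) i i| <= L}) /\
   (exists a C : R, 0 < a /\ 0 < C /\
      forall t : R, 0 < t -> (P [set w | (t <= enorm (Yv w))%R] <= (a * expR (- (t ^+ 2) / C))%:E)%E)) /\
  forall (T : 'rV[R]_d -> 'M[R]_d) (L a C : R),
    stein_kernel P Yv T ->
    {ae P, forall w, forall i, `|sigma ^+ 2 - T (Yv w) i i| <= L} ->
    0 < a -> 0 < C ->
    (forall t : R, 0 < t -> (P [set w | (t <= enorm (Yv w))%R] <= (a * expR (- (t ^+ 2) / C))%:E)%E) ->
    let I := [set lam : R | 0 <= lam <= Num.sqrt (C * ln d%:R)] in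
    let A := \big[Num.max/0]_(i < d) `|theta ord0 i| in
    let M := ereal_sup [set r | exists lam (i : 'I_d), I lam /\
               r = ratioE (fine (P [set w | (lam < `|X w ord0 i|)%R]))
                          (fine (P [set w | (lam + A + 1 < `|X w ord0 i|)%R]))] in
    (L%:E * M < (1 / 2)%:E)%E ->
    forall lamhat : O -> R, measurable_fun setT lamhat ->
    (forall w, I (lamhat w) /\
       forall lam, I lam -> SURE sigma (lamhat w) (X w) <= SURE sigma lam (X w)) ->
    ((1%:E - 2%:E * (L%:E * M)) * \int[P]_w (sqnorm (soft (lamhat w) (X w) - theta))%:E
     <= (1%:E + 2%:E * (L%:E * M)) *
          ereal_inf [set \int[P]_w (sqnorm (soft lam (X w) - theta))%:E | lam in I]
        + (B C * Num.sqrt (d%:R * ln d%:R ^+ 3))%:E)%E.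
Proof.
exists (@oracle_const R); split; first exact: oracle_const_gt0.
move=> d dO O P theta Y sigma phi mY iY2 EY covY indY sc dens Yv X; split; last first.
  exact: (oracle_inequality mY iY2 covY indY dens).
split; last exact: gaussian_tails sc dens.
exists (stein_diag phi); split; first exact: (stein_kernel_stein_diag mY iY2 EY indY sc dens).
have [L HL] := stein_diag_bounded mY iY2 EY indY sc dens (sigma ^+ 2).
by exists L; apply: aeW => w i; exact: HL.
Qed.
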